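(* Let $B:=\overline{B}_1(\mathbf{0})\subset\mathbb{H}$ be the closed unit ball. For any $\varepsilon>0$, there is a contact diffeomorphism $\beta\colon B\to B$ with the following properties: (1) $\beta$ is the identity on $\partial B$. In fact, the closure of $\{x\in B:\beta(x)\neq x\}$ is contained in the interior of $B$. (2) For all $p\in B$, $d(p,\beta(p))<\varepsilon$. (3) $$\int_{\mathbb{R}^2}\mathcal{H}^2\big((\pi\circ\beta)^{-1}(v)\big)\,\mathrm{d}v<\varepsilon.$$
   Context: $\mathbb{H}$ is the first Heisenberg group, identified with $\mathbb{R}^3$ with the group law $(x,y,z)(x',y',z')=\left(x+x',y+y',z+z'+\tfrac12(xy'-x'y)\right)$ and identity $\mathbf{0}$. The Kor\'anyi norm is $|(x,y,z)|_{\mathrm{Kor}}=\sqrt[4]{(x^2+y^2)^2+16z^2}$ and the distance is $d(a,b)=|b^{-1}a|_{\mathrm{Kor}}$; balls are with respect to $d$. $\mathcal{H}^2$ is the two-dimensional Hausdorff measure with respect to $d$, and $\pi\colon\mathbb{H}\to\mathbb{R}^2$ is $\pi(x,y,z)=(x,y)$. The horizontal distribution is spanned at each point by the left-invariant vector fields $X=\partial_x-\frac{y}{2}\partial_z$ and $Y=\partial_y+\frac{x}{2}\partial_z$; a tangent vector is horizontal if it lies in this distribution. A contact diffeomorphism is a ($C^\infty$) diffeomorphism whose differential sends horizontal vectors to horizontal vectors. *)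

(* Defs.v *)
From HB Require Import structures.
From mathcomp Require Import all_boot all_order all_algebra.
From mathcomp Require Import all_classical all_reals all_analysis.

Set Implicit Arguments.
Unset Strict Implicit.
Unset Printing Implicit Defensive.

Import Order.TTheory GRing.Theory Num.Theory.
Import numFieldNormedType.Exports.

Local Open Scope classical_set_scope.
Local Open Scope ring_scope.

(* Points (x, y, z) of R^3, with p.1.1 = x, p.1.2 = y, p.2 = z. The topology and
   the differential calculus are the standard ones of R^3; the former is also
   the topology induced by hdist below. *)
Definition heis (R : realType) : Type := (R * R * R)%type.

Definition hmul (R : realType) (p q : heis R) : heis R :=
  (p.1.1 + q.1.1, p.1.2 + q.1.2,
   p.2 + q.2 + 2^-1 * (p.1.1 * q.1.2 - q.1.1 * p.1.2)).

Definition hone (R : realType) : heis R := (0, 0, 0).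

Definition hinv (R : realType) (p : heis R) : heis R :=
  (- p.1.1, - p.1.2, - p.2).

Lemma hmulV (R : realType) (p : heis R) : hmul (hinv p) p = hone R.
Proof.
case: p => [[x y] z]; rewrite /hmul /hinv /hone /= !addNr add0r.
by rewrite mulNr mulrN opprK addNr mulr0.
Qed.

Definition koranyi (R : realType) (p : heis R) : R :=
  ((p.1.1 ^+ 2 + p.1.2 ^+ 2) ^+ 2 + 16 * p.2 ^+ 2) `^ (4^-1).

Definition hdist (R : realType) (a b : heis R) : R := koranyi (hmul (hinv b) a).

Definition hclosed_ball (R : realType) (c : heis R) (r : R) : set (heis R) :=
  [set p | hdist p c <= r].

Definition hproj (R : realType) (p : heis R) : R * R := p.1.

Definition hX (R : realType) (p : heis R) : heis R := (1, 0, - (p.1.2 / 2)).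

Definition hY (R : realType) (p : heis R) : heis R := (0, 1, p.1.1 / 2).

Definition horizontal (R : realType) (p w : heis R) : Prop :=
  exists a b : R, w = a *: hX p + b *: hY p.

Definition frontier (T : topologicalType) (A : set T) : set T :=
  closure A `\` interior A.

Fixpoint Ck (R : realType) (V W : normedModType R) (k : nat) (U : set V)
    (f : V -> W) : Prop :=
  match k with
  | 0%N => forall x, U x -> {for x, continuous f}
  | k'.+1 => (forall x, U x -> differentiable f x) /\
             (forall v : V, Ck k' U ('D_v f))
  end.

(* Meaningful for open U. *)
Definition smooth (R : realType) (V W : normedModType R) (U : set V)
    (f : V -> W) : Prop := forall k, Ck k U f.

Definition smooth_extension (R : realType) (V W : normedModType R) (A : set V)
    (f : V -> W) (p : V) (U : set V) (g : V -> W) : Prop :=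
  [/\ open U, U p, smooth U g & forall q, A q -> U q -> f q = g q].

(* Smoothness on a set that need not be open, such as a manifold with boundary.
   Values of f outside A are irrelevant. *)
Definition smooth_on (R : realType) (V W : normedModType R) (A : set V)
    (f : V -> W) : Prop :=
  forall p, A p -> exists U g, smooth_extension A f p U g.

Definition diffeomorphism (R : realType) (V W : normedModType R) (A : set V)
    (B : set W) (f : V -> W) : Prop :=
  [/\ set_bij A B f, smooth_on A f &
      exists2 g : W -> V, forall p, A p -> g (f p) = p & smooth_on B g].

(* The differential of f at p is that of any local smooth extension of f; it
   does not depend on the extension when A is contained in the closure of its
   interior, as is the case for balls of positive radius. *)
Definition contact_on (R : realType) (A : set (heis R))
    (f : heis R -> heis R) : Prop :=
  forall p, A p -> forall U g, smooth_extension A f p U g ->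
  forall w, horizontal p w -> horizontal (f p) ('d g p w).

Definition contact_diffeomorphism (R : realType) (A B : set (heis R))
    (f : heis R -> heis R) : Prop :=
  diffeomorphism A B f /\ contact_on A f.

(* The maximum with 0 only matters for the empty set. *)
Definition ediam (R : realType) (T : Type) (d : T -> T -> R) (A : set T) :
    \bar R :=
  maxe 0%E (ereal_sup [set (d x y)%:E | x in A & y in A]).

Definition hausdorff_content (R : realType) (T : Type) (d : T -> T -> R)
    (s delta : R) (A : set T) : \bar R :=
  ereal_inf [set (\sum_(0 <= i <oo) (ediam d (U i) `^ s))%E | U in
    [set U : nat -> set T | A `<=` \bigcup_i U i /\
                            forall i, (ediam d (U i) <= delta%:E)%E]].

(* Hausdorff measure of dimension s > 0 for the distance d, without a
   normalizing constant. *)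
Definition hausdorff_measure (R : realType) (T : Type) (d : T -> T -> R)
    (s : R) (A : set T) : \bar R :=
  ereal_sup [set hausdorff_content d s delta A | delta in
    [set delta : R | 0 < delta]].

(* Main.v *)
Require Import Defs.
From HB Require Import structures.
From mathcomp Require Import all_boot all_order all_algebra.
From mathcomp Require Import all_classical all_reals all_analysis.
From mathcomp Require Import measurable_realfun.
From mathcomp Require Import ring lra zify.
Import Order.TTheory GRing.Theory Num.Theory.
Import numFieldNormedType.Exports.
Local Open Scope classical_set_scope.
Local Open Scope ring_scope.
Set Implicit Arguments.
Unset Strict Implicit.
Unset Printing Implicit Defensive.

(** The _horizontal jacobian_ of a contact map [b] at [p] is the determinant
    [hjac b p] of its differential on the horizontal plane at [p], in the frames
    [hX], [hY]; it is multiplicative under composition, and invariant under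
    conjugation by left translations and dilations. Write [L = |hjac b|].

    _Fibers are small when the mean of [L] is small._ A contact map sends a tile
    of size [h] onto a set whose projection lies, up to [o(h)], in a parallelogram
    of area [4 h^2 L]. The fiber of [hproj \o b] over [v] meets only the tiles for
    which [v] lies in that parallelogram, and each tile has diameter at most
    [4 h]. Its Hausdorff content is thus at most the sum of [(4 h)^2] over these
    tiles, a function of [v] whose integral is about a constant times the sum of
    [h^4 L] over all tiles, that is the integral of [L] over the ball. Fatou's
    lemma along [h] tending to [0] bounds the integral of the Hausdorff measure of
    the fibers ([tile_image_strip], [content_finite], [small_fibers]).

    _Reducing the mean of [L] once._ Since [b] multiplies the contact form by
    [hjac b], it multiplies volume by [L^2]: a contact diffeomorphism that is the
    identity outside a tile preserves the mean of [L^2], and by Cauchy-Schwarz it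
    has mean of [L] below [1] as soon as [L] is not constant. To have an explicit
    bound we use a twist. With [s = (x^2 + y^2) / 2], the maps that commute with
    rotations about the vertical axis are governed by the half-plane with
    coordinates [a = ln s], [b = z / s]: every area-preserving map
    [(a, b) |-> (a', b')] lifts to a contact map, and the lift has horizontal
    jacobian [exp (a' - a)]. Rotating each circle [a^2 + b^2 = t] by an angle that
    is [pi] for small [t] and [0] for large [t] gives a map with jacobian [s^-2] in
    most of its support and [1] outside. As [s] is large in most of the support,
    the mean is below [kappa = 1 - 2^-26] ([contact_twist], [btwist_average]).

    _Iterating._ Given [b], fill the tiles of a fine lattice by conjugates of the
    twist, and let [sigma] be their composition. It preserves each tile, so it
    moves points by [O(h)] only, and since [hjac b] is almost constant on each
    tile, [hjac (b \o sigma) = (hjac b \o sigma) * hjac sigma] has mean at most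
    [kappa] times that of [hjac b], up to a small error. After [n] steps the mean
    of [L] is at most about [kappa^n] ([iteration]). Only tiles contained in the open ball
    are filled, which keeps the map equal to the identity near the sphere; the
    remaining tiles contribute at most [2^(64 n)] times their total volume, which
    the choice of the initial lattice makes negligible ([sphere_tiles]).

    The means are taken over lattice points: refining a lattice then replaces a
    change of variables in an integral over the tiles. *)

(** * Calculus of the classes [Ck] *)

Section directional.
Context {R : realType}.
Implicit Types (V W Z : normedModType R).

Lemma derive_lin V W (L : {linear V -> W}) x v :
  continuous L -> 'D_v L x = L v.
Proof.
by move=> cL; rewrite deriveE; [rewrite diff_lin|exact: linear_differentiable].
Qed.

Lemma derive_comp V W Z (f : V -> W) (g : W -> Z) x v :
  differentiable f x -> differentiable g (f x) ->
  'D_v (g \o f) x = 'D_('D_v f x) g (f x).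
Proof.
move=> df dg; rewrite [LHS]deriveE; last exact: differentiable_comp.
by rewrite diff_comp// [RHS]deriveE// [in RHS]deriveE.
Qed.

Lemma derive_lin_comp V W Z (L : {linear W -> Z}) (f : V -> W) x v :
  continuous L -> differentiable f x -> 'D_v (L \o f) x = L ('D_v f x).
Proof.
move=> cL df; rewrite derive_comp ?derive_lin//.
exact: linear_differentiable.
Qed.

Lemma derive_pair V W Z (f : V -> W) (g : V -> Z) x v :
  differentiable f x -> differentiable g x ->
  'D_v (fun y => (f y, g y)) x = ('D_v f x, 'D_v g x).
Proof.
move=> df dg; rewrite [LHS]deriveE; last exact: differentiable_pair.
by rewrite diff_pair// [in RHS]deriveE// [in RHS]deriveE.
Qed.

Lemma derive_linear V W (f : V -> W) x (a : R) u v : differentiable f x ->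
  'D_(a *: u + v) f x = a *: 'D_u f x + 'D_v f x.
Proof. by move=> df; rewrite !deriveE// linearP. Qed.

Lemma derive_scale V W (f : V -> W) x (a : R) u : differentiable f x ->
  'D_(a *: u) f x = a *: 'D_u f x.
Proof.
by move=> df; have := derive_linear a u 0 df; rewrite derive0 !addr0.
Qed.

Lemma derive_comp1 V (f : V -> R) (g : R -> R) x v :
  differentiable f x -> differentiable g (f x) ->
  'D_v (fun y => g (f y)) x = 'D_1 g (f x) * 'D_v f x.
Proof.
move=> df dg; rewrite -/(g \o f) derive_comp//; set d := 'D_v f x.
have := derive_linear d (1 : R^o) 0 dg.
by rewrite addr0 derive0 addr0 [d%:A]mulr1 => ->; exact: mulrC.
Qed.

End directional.

Lemma near_eq_diff {R : realType} (V W : normedModType R) (f g : V -> W) x :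
  (\near x, f x = g x) -> differentiable f x -> differentiable g x.
Proof.
move=> nfg df; have fgx : f x = g x by exact: nbhs_singleton nfg.
have cd : continuous ('d f x) by exact: diff_continuous.
have e : g \o shift x = cst (g x) + 'd f x +o_ (0 : V) id.
  apply/eqaddoP => e e0; have /eqaddoP/(_ e e0) := diff_locally df.
  have : \forall y \near (0 : V), f (y + x) = g (y + x).
    by have := nfg; rewrite (near_shift (0 : V) x) subr0; apply: filterS.
  apply: filterS2 => y fgy; rewrite ![(_ - _) y]/GRing.add /= ![(- _) y]/GRing.opp /=.
  by rewrite fgx fgy.
by apply/diff_locallyP; rewrite (diff_unique cd e).
Qed.

Section Ck_calculus.
Context {R : realType}.
Implicit Types (V W Z : normedModType R).

Lemma Ck_sub V W k (U U' : set V) (f : V -> W) :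
  U' `<=` U -> Ck k U f -> Ck k U' f.
Proof.
move=> UU'; elim: k f => [|k IH] f /=; first by move=> h x /UU'; exact: h.
by move=> [df h]; split=> [x /UU'|v]; [exact: df|exact: IH].
Qed.

Lemma Ck_union V W k (U U' : set V) (f : V -> W) :
  Ck k U f -> Ck k U' f -> Ck k (U `|` U') f.
Proof.
elim: k f => [|k IH] f /=; first by move=> h h' x [/h|/h'].
by move=> [df h] [df' h']; split=> [x [/df|/df']//|v]; exact: IH.
Qed.

Lemma CkS V W k (U : set V) (f : V -> W) : Ck k.+1 U f -> Ck k U f.
Proof.
elim: k f => [|k IH] f.
  by move=> [df _] x Ux; apply: differentiable_continuous; exact: df.
by move=> [df h]; split=> // v; apply: IH; exact: h.
Qed.

Lemma Ck_diff V W k (U : set V) (f : V -> W) x :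
  Ck k.+1 U f -> U x -> differentiable f x.
Proof. by case=> df _; exact: df. Qed.

Lemma Ck_eq V W k (U : set V) (f g : V -> W) : open U ->
  (forall x, U x -> f x = g x) -> Ck k U f -> Ck k U g.
Proof.
move=> oU; elim: k f g => [|k IH] f g fg.
  move=> cf x Ux; rewrite /prop_for /continuous_at -(fg _ Ux).
  apply: cvg_trans (cf x Ux); apply: near_eq_cvg.
  have : nbhs x U by exact: open_nbhs_nbhs.
  by apply: filterS => y /fg ->.
move=> [df h]; have nfg x : U x -> \near x, f x = g x.
  move=> Ux; have : nbhs x U by exact: open_nbhs_nbhs.
  exact: filterS.
split=> [x Ux|v]; last first.
  apply: IH (h v) => x Ux; exact: near_eq_derive (nfg _ Ux).
exact: near_eq_diff (nfg _ Ux) (df _ Ux).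
Qed.

Lemma Ck_cst V W k (U : set V) (c : W) : Ck k U (fun=> c).
Proof.
elim: k c => [|k IH] c /=; first by move=> x _; exact: cvg_cst.
split=> [x _|v]; first exact: differentiable_cst.
by rewrite (_ : 'D_v _ = fun=> 0)//; apply/funext => x; rewrite derive_cst.
Qed.

Lemma Ck_lin V W k (U : set V) (L : {linear V -> W}) : continuous L -> Ck k U L.
Proof.
move=> cL; case: k => [|k] /=; first by move=> x _; exact: cL.
split=> [x _|v]; first exact: linear_differentiable.
rewrite (_ : 'D_v _ = fun=> L v); first exact: Ck_cst.
by apply/funext => x; rewrite derive_lin.
Qed.

Section open_domain.
Variables (V : normedModType R) (U : set V).
Hypothesis oU : open U.

Lemma Ck_lin_comp W Z k (L : {linear W -> Z}) (f : V -> W) :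
  continuous L -> Ck k U f -> Ck k U (L \o f).
Proof.
move=> cL; elim: k f => [|k IH] f /=.
  by move=> cf x Ux; apply: continuous_comp; [exact: cf|exact: cL].
move=> [df h]; split=> [x Ux|v].
  by apply: differentiable_comp; [exact: df|exact: linear_differentiable].
apply: Ck_eq oU _ (IH _ (h v)) => x Ux; rewrite derive_lin_comp//; exact: df.
Qed.

Lemma Ck_pair W Z k (f : V -> W) (g : V -> Z) :
  Ck k U f -> Ck k U g -> Ck k U (fun x => (f x, g x)).
Proof.
elim: k f g => [|k IH] f g /=.
  by move=> cf cg x Ux; apply: cvg_pair; [exact: cf|exact: cg].
move=> [df hf] [dg hg]; split=> [x Ux|v].
  by apply: differentiable_pair; [exact: df|exact: dg].
apply: Ck_eq oU _ (IH _ _ (hf v) (hg v)) => x Ux.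
by rewrite derive_pair//; [exact: df|exact: dg].
Qed.

Lemma Ck_add W k (f g : V -> W) :
  Ck k U f -> Ck k U g -> Ck k U (fun x => f x + g x).
Proof.
elim: k f g => [|k IH] f g /=.
  by move=> cf cg x Ux; apply: cvgD; [exact: cf|exact: cg].
move=> [df hf] [dg hg]; split=> [x Ux|v].
  by apply: differentiableD; [exact: df|exact: dg].
apply: Ck_eq oU _ (IH _ _ (hf v) (hg v)) => x Ux.
by rewrite [RHS]deriveD//; apply: diff_derivable; [exact: df|exact: dg].
Qed.

Lemma Ck_opp W k (f : V -> W) : Ck k U f -> Ck k U (fun x => - f x).
Proof.
elim: k f => [|k IH] f /=; first by move=> cf x Ux; apply: cvgN; exact: cf.
move=> [df hf]; split=> [x Ux|v].
  by apply: differentiableN; exact: df.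
apply: Ck_eq oU _ (IH _ (hf v)) => x Ux.
by rewrite [RHS]deriveN//; apply: diff_derivable; exact: df.
Qed.

Lemma Ck_mul k (f g : V -> R) :
  Ck k U f -> Ck k U g -> Ck k U (fun x => f x * g x).
Proof.
elim: k f g => [|k IH] f g.
  by move=> cf cg x Ux; apply: cvgM; [exact: cf|exact: cg].
move=> Cf Cg; split=> [x Ux|v].
  by apply: differentiableM; [exact: Ck_diff Cf _|exact: Ck_diff Cg _].
apply: Ck_eq oU _ (Ck_add (IH _ _ (CkS Cf) (Cg.2 v)) (IH _ _ (CkS Cg) (Cf.2 v))).
move=> x Ux; rewrite [RHS]deriveM//; apply: diff_derivable.
  exact: Ck_diff Cf _.
exact: Ck_diff Cg _.
Qed.

Lemma Ck_comp1 k (f : V -> R) (g : R -> R) (U' : set R) :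
  (forall x, U x -> U' (f x)) ->
  Ck k U f -> Ck k U' g -> Ck k U (fun x => g (f x)).
Proof.
move=> fU; elim: k g => [|k IH] g.
  by move=> cf cg x Ux; apply: continuous_comp; [exact: cf|apply: cg; exact: fU].
move=> Cf Cg; split=> [x Ux|v].
  apply: (@differentiable_comp _ _ _ _ f g); first exact: Ck_diff Cf _.
  by apply: Ck_diff Cg _; exact: fU.
apply: Ck_eq oU _ (Ck_mul (IH _ (CkS Cf) (Cg.2 1)) (Cf.2 v)) => x Ux.
rewrite (@derive_comp1 _ _ f g)//; first exact: Ck_diff Cf _.
by apply: Ck_diff Cg _; exact: fU.
Qed.

End open_domain.

End Ck_calculus.

(** * Calculus on the Heisenberg group *)

Section heis_calculus.
Context {R : realType}.
Implicit Types (V W Z : normedModType R).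

Definition ex : heis R := (1, 0, 0).
Definition ey : heis R := (0, 1, 0).
Definition ez : heis R := (0, 0, 1).

Lemma heis_decomp (w : heis R) :
  w = w.1.1 *: ex + (w.1.2 *: ey + (w.2 *: ez + 0)).
Proof.
case: w => [[a b] c]; rewrite /ex /ey /ez.
congr (_, _, _) => /=; rewrite /GRing.scale /= ?mulr1 ?mulr0 ?addr0 ?add0r //.
Qed.

Lemma derive_coord W (f : heis R -> W) p (w : heis R) : differentiable f p ->
  'D_w f p = w.1.1 *: 'D_ex f p + w.1.2 *: 'D_ey f p + w.2 *: 'D_ez f p.
Proof.
move=> df; rewrite [in LHS](heis_decomp w) !derive_linear// derive0 addr0.
by rewrite addrA.
Qed.

Lemma fst_continuous V W : continuous (@fst V W).
Proof. by move=> p; exact: cvg_fst. Qed.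

Lemma snd_continuous V W : continuous (@snd V W).
Proof. by move=> p; exact: cvg_snd. Qed.

Lemma Ck_id V k (U : set V) : Ck k U id.
Proof.
by have := @Ck_lin R V V k U idfun (fun x => cvg_id); apply.
Qed.

Lemma Ck_fst V W Z k (U : set V) (f : V -> W * Z) : open U ->
  Ck k U f -> Ck k U (fun x => (f x).1).
Proof. by move=> oU; apply: (Ck_lin_comp oU (L := fst)); exact: fst_continuous. Qed.

Lemma Ck_snd V W Z k (U : set V) (f : V -> W * Z) : open U ->
  Ck k U f -> Ck k U (fun x => (f x).2).
Proof. by move=> oU; apply: (Ck_lin_comp oU (L := snd)); exact: snd_continuous. Qed.

Lemma Ck_coord k (U : set (heis R)) : open U ->
  [/\ Ck k U (fun p => p.1.1), Ck k U (fun p => p.1.2) & Ck k U (fun p => p.2)].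
Proof.
move=> oU; have C1 : Ck k U fst by exact: Ck_fst (Ck_id k U).
by split; [exact: Ck_fst C1|exact: Ck_snd C1|exact: Ck_snd (Ck_id k U)].
Qed.

Lemma Ck_heis V k (U : set V) (f : V -> heis R) : open U ->
  Ck k U (fun x => (f x).1.1) -> Ck k U (fun x => (f x).1.2) ->
  Ck k U (fun x => (f x).2) -> Ck k U f.
Proof.
move=> oU f1 f2 f3; apply: Ck_eq oU _ (Ck_pair oU (Ck_pair oU f1 f2) f3) => x _.
by case: (f x) => [[]].
Qed.

Lemma derive_fst V W Z (f : V -> W * Z) x v : differentiable f x ->
  'D_v (fun y => (f y).1) x = ('D_v f x).1.
Proof. by move=> df; exact: (derive_lin_comp (L := fst) v (@fst_continuous W Z) df). Qed.

Lemma derive_snd V W Z (f : V -> W * Z) x v : differentiable f x ->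
  'D_v (fun y => (f y).2) x = ('D_v f x).2.
Proof. by move=> df; exact: (derive_lin_comp (L := snd) v (@snd_continuous W Z) df). Qed.

Lemma diff_fst V W Z (f : V -> W * Z) x : differentiable f x ->
  differentiable (fun y => (f y).1) x.
Proof.
move=> df; apply: (@differentiable_comp _ _ _ _ f fst) => //.
by apply: linear_differentiable; exact: fst_continuous.
Qed.

Lemma diff_snd V W Z (f : V -> W * Z) x : differentiable f x ->
  differentiable (fun y => (f y).2) x.
Proof.
move=> df; apply: (@differentiable_comp _ _ _ _ f snd) => //.
by apply: linear_differentiable; exact: snd_continuous.
Qed.

(** The chain rule in coordinates: the derivative of [g \o f] is a sum of products
    of derivatives of [f] with compositions of class one lower. *)
Lemma Ck_compH V k (U : set V) (U' : set (heis R)) (f : V -> heis R)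
    (g : heis R -> R) : open U -> (forall x, U x -> U' (f x)) ->
  Ck k U f -> Ck k U' g -> Ck k U (g \o f).
Proof.
move=> oU fU; elim: k g => [|k IH] g.
  by move=> cf cg x Ux; apply: continuous_comp; [exact: cf|apply: cg; exact: fU].
move=> Cf Cg; have df x : U x -> differentiable f x by exact: Ck_diff Cf.
have dg x : U x -> differentiable g (f x) by move/fU; exact: Ck_diff Cg.
split=> [x Ux|v]; first by apply: differentiable_comp; [exact: df|exact: dg].
have E e : Ck k U ('D_e g \o f) by apply: IH; [exact: CkS|exact: Cg.2].
have Df := Cf.2 v.
apply: Ck_eq oU _ (Ck_add oU (Ck_add oU
  (Ck_mul oU (Ck_fst oU (Ck_fst oU Df)) (E ex))
  (Ck_mul oU (Ck_snd oU (Ck_fst oU Df)) (E ey)))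
  (Ck_mul oU (Ck_snd oU Df) (E ez))) => x Ux.
rewrite [RHS]derive_comp; [|exact: df|exact: dg].
by rewrite [RHS]derive_coord//; exact: dg.
Qed.

Lemma Ck_compHH V k (U : set V) (U' : set (heis R)) (f : V -> heis R)
    (g : heis R -> heis R) : open U -> open U' -> (forall x, U x -> U' (f x)) ->
  Ck k U f -> Ck k U' g -> Ck k U (g \o f).
Proof.
move=> oU oU' fU Cf Cg; apply: Ck_heis => //.
- exact: (@Ck_compH _ k U U' f (fun p => (g p).1.1) oU fU Cf
    (Ck_fst oU' (Ck_fst oU' Cg))).
- exact: (@Ck_compH _ k U U' f (fun p => (g p).1.2) oU fU Cf
    (Ck_snd oU' (Ck_fst oU' Cg))).
- exact: (@Ck_compH _ k U U' f (fun p => (g p).2) oU fU Cf (Ck_snd oU' Cg)).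
Qed.

Lemma smooth_diff V W (f : V -> W) x : smooth setT f -> differentiable f x.
Proof. by move=> sf; exact: Ck_diff (sf 1%N) I. Qed.

Lemma smooth_comp (f g : heis R -> heis R) :
  smooth setT f -> smooth setT g -> smooth setT (g \o f).
Proof.
move=> sf sg k; apply: (Ck_compHH _ _ _ (sf k) (sg k)) => //; exact: openT.
Qed.

(** The contact form [dz - (x dy - y dx) / 2], whose kernel is the horizontal
    plane. *)
Definition theta (p w : heis R) : R :=
  w.2 - 2^-1 * (p.1.1 * w.1.2 - p.1.2 * w.1.1).

Lemma horizontalP (p w : heis R) : horizontal p w <-> theta p w = 0.
Proof.
rewrite /horizontal /theta; split=> [[a [b ->]]|].
  rewrite /hX /hY /= /GRing.scale /= !mulr1 !mulr0 addr0 add0r; ring.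
move/eqP; rewrite subr_eq0 => /eqP e; exists w.1.1, w.1.2.
case: w e => [[a b] c] /= ->; rewrite /hX /hY.
congr (_, _, _) => /=; rewrite /GRing.scale /= ?mulr1 ?mulr0 ?addr0 ?add0r//.
by ring.
Qed.

Lemma horizontalE (p w : heis R) : horizontal p w ->
  w = w.1.1 *: hX p + w.1.2 *: hY p.
Proof.
move=> [a [b ->]]; rewrite /hX /hY.
congr (_, _, _) => /=; rewrite /GRing.scale /= ?mulr1 ?mulr0 ?addr0 ?add0r//.
Qed.

Definition contact (f : heis R -> heis R) :=
  smooth setT f /\
  forall p w, horizontal p w -> horizontal (f p) ('D_w f p).

Definition hjac (f : heis R -> heis R) p : R :=
  ('D_(hX p) f p).1.1 * ('D_(hY p) f p).1.2 -
  ('D_(hX p) f p).1.2 * ('D_(hY p) f p).1.1.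

Lemma horizontal_hX (p : heis R) : horizontal p (hX p).
Proof. by exists 1, 0; rewrite scale1r scale0r addr0. Qed.

Lemma horizontal_hY (p : heis R) : horizontal p (hY p).
Proof. by exists 0, 1; rewrite scale1r scale0r add0r. Qed.

Lemma contact_comp f g : contact f -> contact g -> contact (g \o f).
Proof.
move=> [sf hf] [sg hg]; split; first exact: smooth_comp.
move=> p w pw; rewrite derive_comp; [|exact: smooth_diff..].
by apply: hg; exact: hf.
Qed.

(** The chain rule for the determinant in the frames [hX], [hY]; it needs that the
    differential of [f] has no component transverse to the horizontal plane. *)
Lemma hjac_comp f g p : contact f -> contact g ->
  hjac (g \o f) p = hjac g (f p) * hjac f p.
Proof.
move=> [sf hf] [sg hg]; have df := smooth_diff p sf.
have dg := smooth_diff (f p) sg.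
have C w : horizontal p w -> 'D_w (g \o f) p =
    ('D_w f p).1.1 *: 'D_(hX (f p)) g (f p) +
    ('D_w f p).1.2 *: 'D_(hY (f p)) g (f p).
  move=> pw; rewrite derive_comp// {1}(horizontalE (hf _ _ pw)).
  by rewrite (derive_linear _ _ _ dg) (derive_scale _ _ dg).
rewrite /hjac (C _ (horizontal_hX p)) (C _ (horizontal_hY p)).
move: ('D_(hX (f p)) g (f p)) ('D_(hY (f p)) g (f p)) => u v.
move: ('D_(hX p) f p) ('D_(hY p) f p) => a b.
by rewrite /= /GRing.scale /=; ring.
Qed.

Lemma hjac_near f g p : (\near p, f p = g p) -> hjac f p = hjac g p.
Proof. by move=> fg; rewrite /hjac !(near_eq_derive _ fg). Qed.

End heis_calculus.

(** * Elementary smooth functions of one variable *)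

Section one_variable.
Context {R : realType}.

Lemma open_gt0 : open [set t : R | 0 < t].
Proof. exact: open_gt. Qed.

(** The induction that makes a function smooth once its derivative is an expression
    in functions already known to be of class [k]. *)
Lemma Ck_derive1 k (U : set R) (f df : R -> R) : open U ->
  (forall x, U x -> is_derive x 1 f (df x)) -> Ck k U df -> Ck k.+1 U f.
Proof.
move=> oU h Cdf; have dif x : U x -> differentiable f x.
  by move=> /h H; apply/derivable1_diffP; exact: ex_derive.
split=> // v; apply: Ck_eq oU _ (Ck_mul oU (Ck_cst k U v) Cdf) => x Ux.
have e : v = v *: (1 : R^o) by rewrite [v%:A]mulr1.
rewrite [in RHS]e (derive_scale _ _ (dif x Ux)).
by have H := h x Ux; rewrite derive_val.
Qed.

Lemma smooth_expR : smooth setT (@expR R).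
Proof.
elim=> [|k IH]; first by move=> x _; exact: continuous_expR.
exact: (Ck_derive1 openT _ IH).
Qed.

Lemma smooth_sin_cos k : Ck k setT (@sin R) /\ Ck k setT (@cos R).
Proof.
elim: k => [|k [IHs IHc]].
  by split=> x _; [exact: continuous_sin|exact: continuous_cos].
split; first exact: (Ck_derive1 openT _ IHc).
by apply: (Ck_derive1 openT _ (Ck_opp openT IHs)).
Qed.

Lemma smooth_inv : smooth [set t : R | 0 < t] (fun t => t^-1).
Proof.
elim=> [|k IH].
  by move=> x x0; apply: inv_continuous; rewrite gt_eqF.
apply: (Ck_derive1 open_gt0 _ (Ck_opp open_gt0 (Ck_mul open_gt0 IH IH))) => x x0.
apply: DeriveDef; first by apply: derivableV => //; rewrite gt_eqF.
rewrite deriveV ?gt_eqF// derive_id /GRing.scale /= mulr1.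
by rewrite expr2 invfM.
Qed.

Lemma smooth_ln : smooth [set t : R | 0 < t] (@ln R).
Proof.
case=> [|k]; first by move=> x x0; exact: continuous_ln.
exact: (Ck_derive1 open_gt0 _ (smooth_inv k)).
Qed.

(** The derivatives of [exp (-1/t)] are combinations of the functions
    [t^-n exp (-1/t)], all of them flat at [0]. *)
Definition flat n (t : R) : R :=
  if 0 < t then t^-1 ^+ n * expR (- t^-1) else 0.

(** Quadratic flatness at [0], from [u^(n+2) / (n+2)! <= exp u] at [u = 1/t]; it
    gives differentiability there. *)
Lemma flat_le n (t : R) : `|flat n t| <= (n.+2)`!%:R * t ^+ 2.
Proof.
rewrite /flat; case: ifPn => [t0|_]; last first.
  by rewrite normr0 mulr_ge0 ?sqr_ge0.
have u0 : 0 < t^-1 by rewrite invr_gt0.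
rewrite ger0_norm; last by rewrite mulr_ge0 ?expR_ge0// exprn_ge0// ltW.
have : t^-1 ^+ n.+2 / n.+2`!%:R <= expR t^-1.
  by apply: le_trans (expR_ge1Dxn n.+1 (ltW u0)); rewrite lerDr.
have f0 : 0 < n.+2`!%:R :> R by rewrite ltr0n fact_gt0.
rewrite ler_pdivrMr// => h.
rewrite expRN ler_pdivrMr ?expR_gt0// -(ler_pM2r (exprn_gt0 2 u0)).
rewrite -exprD addn2 (le_trans h)//.
have -> : n.+2`!%:R * t ^+ 2 * expR t^-1 * t^-1 ^+ 2 =
    expR t^-1 * n.+2`!%:R * (t * t^-1) ^+ 2 by ring.
by rewrite divff ?gt_eqF// expr1n mulr1.
Qed.

Lemma is_derive_flat n (t : R) :
  is_derive t 1 (flat n) (flat n.+2 t - n%:R * flat n.+1 t).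
Proof.
have [t0|t0|->] := ltgtP t 0.
- rewrite /flat !ltNge (ltW t0)/= mulr0 subr0.
  apply: (near_eq_is_derive (f := cst 0)).
    have : nbhs t [set s : R | s < 0] by apply: open_nbhs_nbhs; split=> //; exact: open_lt.
    by apply: filterS => s /= s0; rewrite ltNge (ltW s0).
- rewrite /flat t0.
  apply: (near_eq_is_derive (f := fun s : R => s^-1 ^+ n * expR (- s^-1))).
    have : nbhs t [set s : R | 0 < s] by apply: open_nbhs_nbhs; split=> //; exact: open_gt.
    by apply: filterS => s /= ->.
  have t1 : t != 0 by rewrite gt_eqF.
  have dV : is_derive t 1 (fun s : R => s^-1) (- (t^-1 * t^-1)).
    apply: DeriveDef; first by apply: derivableV.
    by rewrite deriveV// derive_id /GRing.scale /= mulr1 expr2 invfM.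
  have dX : is_derive t^-1 1 (fun s : R => s ^+ n) (n%:R * t^-1 ^+ n.-1).
    apply: DeriveDef; first exact: exprn_derivable.
    by rewrite exp_derive /GRing.scale /= mulr1.
  have dE : is_derive t^-1 1 (fun s : R => expR (- s)) (- expR (- t^-1)).
    by apply: is_derive_eq; rewrite /GRing.scale /= ?mulrN1 ?mulN1r.
  have dG := is_deriveM dX dE.
  apply: (is_derive_eq
    (@is_derive1_comp _ (fun s => s ^+ n * expR (- s)) _ t _ _ dG dV)).
  rewrite /GRing.scale /=; case: n {dX dG} => [|n] /=; rewrite ?exprS; ring.
- rewrite /flat ltxx mulr0 subr0.
  (* At [0] the difference quotient is at most a constant times [|h|]. *)
  have D : (fun h : R => h^-1 *: (flat n (h *: (1 : R^o) + 0) - flat n 0)) @ 0^' --> (0 : R).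
    apply/cvgr0Pnorm_lt => e e0; near=> h.
    have h0 : h != 0 by near: h; exact: nbhs_dnbhs_neq.
    rewrite [h%:A]mulr1 addr0 [flat n 0]/flat ltxx subr0.
    rewrite /GRing.scale /= normrM normfV.
    rewrite mulrC ltr_pdivrMr ?normr_gt0//.
    apply: le_lt_trans (flat_le n h) _.
    rewrite -(ger0_norm (sqr_ge0 h)) normrX expr2 mulrA ltr_pM2r ?normr_gt0//.
    rewrite mulrC -ltr_pdivlMr ?ltr0n ?fact_gt0//.
    near: h; apply: dnbhs0_lt; rewrite divr_gt0 ?ltr0n ?fact_gt0//.
  apply: DeriveDef; first by apply/cvg_ex; exists 0.
  exact: cvg_lim D.
Unshelve. all: by end_near. Qed.

Lemma smooth_flat n : smooth setT (flat n).
Proof.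
move=> k; elim: k n => [|k IH] n.
  move=> x _; apply: differentiable_continuous; apply/derivable1_diffP.
  by case: (is_derive_flat n x).
have cn := Ck_mul openT (Ck_cst k setT (n%:R : R)) (IH n.+1).
apply: (Ck_derive1 openT _ (Ck_add openT (IH n.+2) (Ck_opp openT cn))) => x _.
exact: is_derive_flat.
Qed.

End one_variable.

(** * Directional derivatives of explicit functions *)

Section hasD.
Context {R : realType} {V : normedModType R}.
Implicit Types (f g : V -> R) (x v : V).

(** Differentiability together with the value of one directional derivative, so
    that the derivative of an explicit formula can be computed by unification. *)
Definition hasD f x v (d : R) := differentiable f x /\ 'D_v f x = d.

Lemma hasD_eq f x v d d' : hasD f x v d -> d = d' -> hasD f x v d'.
Proof. by move=> h <-. Qed.

Lemma hasD_cst (c : R) x v : hasD (fun=> c) x v 0.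
Proof. by split; [exact: differentiable_cst|rewrite derive_cst]. Qed.

Lemma hasD_add f g x v df dg : hasD f x v df -> hasD g x v dg ->
  hasD (fun y => f y + g y) x v (df + dg).
Proof.
move=> [hf <-] [hg <-]; split; first exact: differentiableD.
by rewrite [LHS]deriveD//; exact: diff_derivable.
Qed.

Lemma hasD_opp f x v df : hasD f x v df -> hasD (fun y => - f y) x v (- df).
Proof.
move=> [hf <-]; split; first exact: differentiableN.
by rewrite [LHS]deriveN//; exact: diff_derivable.
Qed.

Lemma hasD_mul f g x v df dg : hasD f x v df -> hasD g x v dg ->
  hasD (fun y => f y * g y) x v (f x * dg + g x * df).
Proof.
move=> [hf <-] [hg <-]; split; first exact: differentiableM.
by rewrite [LHS]deriveM//; exact: diff_derivable.
Qed.

Lemma hasD_comp f (h : R -> R) x v df dh : is_derive (f x) 1 h dh ->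
  hasD f x v df -> hasD (fun y => h (f y)) x v (dh * df).
Proof.
move=> Dh [hf <-]; have dif : differentiable h (f x).
  by apply/derivable1_diffP; exact: ex_derive.
split; first exact: (@differentiable_comp _ _ _ _ f h).
by rewrite (@derive_comp1 _ _ f h)// derive_val.
Qed.

End hasD.

(** * Twists of the half-plane lifted to contact maps *)

Section twist.
Context {R : realType}.
Variable N : R -> R.
Implicit Types p w : heis R.

(** Off the vertical axis the rotation-invariant coordinates are [a = cha],
    [b = chb]; [twa], [twb] rotate [(a, b)] by the angle [tau = N'(t)], which
    depends only on [t = a^2 + b^2], and [twA] is the angle by which the lift turns
    [(x, y)]. *)
Definition halfsq p : R := 2^-1 * (p.1.1 * p.1.1 + p.1.2 * p.1.2).
Definition cha p : R := ln (halfsq p).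
Definition chb p : R := p.2 * (halfsq p)^-1.
Definition cht p : R := cha p * cha p + chb p * chb p.
Definition tau p : R := 'D_1 N (cht p).
Definition twa p : R := cha p * cos (tau p) - chb p * sin (tau p).
Definition twb p : R := cha p * sin (tau p) + chb p * cos (tau p).
Definition twA p : R := twb p - chb p +
  2^-1 * (twa p * twb p - cha p * chb p - (cht p * tau p - N (cht p))).
(** The square root of the ratio of the new to the old value of [halfsq]. *)
Definition twm p : R := expR (2^-1 * (twa p - cha p)).
Definition twx p : R := p.1.1 * cos (twA p) - p.1.2 * sin (twA p).
Definition twy p : R := p.1.1 * sin (twA p) + p.1.2 * cos (twA p).
Definition twist0 p : heis R :=
  (twm p * twx p, twm p * twy p, twb p * expR (twa p)).
Definition twist p : heis R := if halfsq p <= 0 then p else twist0 p.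

Hypothesis sN : smooth setT N.

Let dN : smooth setT ('D_1 N).
Proof. by move=> k; exact: (sN k.+1).2. Qed.

Let U : set (heis R) := [set p | 0 < halfsq p].

Let Cx k : Ck k setT (fun p : heis R => p.1.1).
Proof. by have [] := Ck_coord k (@openT (heis R)). Qed.
Let Cy k : Ck k setT (fun p : heis R => p.1.2).
Proof. by have [] := Ck_coord k (@openT (heis R)). Qed.
Let Cz k : Ck k setT (fun p : heis R => p.2).
Proof. by have [] := Ck_coord k (@openT (heis R)). Qed.

Lemma smooth_halfsq : smooth setT halfsq.
Proof.
move=> k; rewrite /halfsq; apply: Ck_mul; [exact: openT|exact: Ck_cst|].
by apply: Ck_add; [exact: openT|apply: Ck_mul => //; exact: openT..].
Qed.

Lemma open_halfsq_gt0 : open U.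
Proof.
rewrite -[U]/(halfsq @^-1` [set t | 0 < t]); apply: open_comp; last exact: open_gt0.
by move=> p _; exact: smooth_halfsq 0%N p I.
Qed.

Let oU := open_halfsq_gt0.
Let CT (W : normedModType R) k (f : heis R -> W) : Ck k setT f -> Ck k U f.
Proof. by apply: Ck_sub. Qed.
Let comp_T k (f : heis R -> R) (g : R -> R) :
  Ck k setT g -> Ck k U f -> Ck k U (fun p => g (f p)).
Proof. by move=> Cg Cf; exact: (Ck_comp1 oU (U' := setT)). Qed.

Let Ca k : Ck k U cha.
Proof. exact: (Ck_comp1 oU _ (CT (smooth_halfsq k)) (smooth_ln k)). Qed.
Let Cb k : Ck k U chb.
Proof.
apply: Ck_mul => //; first exact: CT.
exact: (Ck_comp1 oU _ (CT (smooth_halfsq k)) (smooth_inv k)).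
Qed.
Let Ct k : Ck k U cht.
Proof. by apply: Ck_add => //; exact: Ck_mul. Qed.
Let Ctau k : Ck k U tau.
Proof. exact: (comp_T (g := 'D_1 N) (dN k) (Ct k)). Qed.
Let Ccos k f : Ck k U f -> Ck k U (fun p => cos (f p)).
Proof. by move=> Cf; apply: (comp_T (g := cos)) => //; have [] := @smooth_sin_cos R k. Qed.
Let Csin k f : Ck k U f -> Ck k U (fun p => sin (f p)).
Proof. by move=> Cf; apply: (comp_T (g := sin)) => //; have [] := @smooth_sin_cos R k. Qed.
Let Cexp k f : Ck k U f -> Ck k U (fun p => expR (f p)).
Proof. by move=> Cf; apply: (comp_T (g := expR)) => //; exact: smooth_expR. Qed.
Let CB k (f g : heis R -> R) : Ck k U f -> Ck k U g -> Ck k U (fun p => f p - g p).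
Proof. by move=> Cf Cg; apply: Ck_add => //; exact: Ck_opp. Qed.
Let CM k (f g : heis R -> R) := @Ck_mul _ _ _ oU k f g.
Let CA k (f g : heis R -> R) := @Ck_add _ _ _ oU _ k f g.
Let Ccst k c : Ck k U (fun=> c : R) := Ck_cst k U c.

Let Ctwa k : Ck k U twa.
Proof. by apply: CB; apply: CM => //; [exact: Ccos|exact: Csin]. Qed.
Let Ctwb k : Ck k U twb.
Proof. by apply: CA; apply: CM => //; [exact: Csin|exact: Ccos]. Qed.
Let CtwA k : Ck k U twA.
Proof.
apply: CA; first exact: CB.
apply: CM => //; apply: CB; first by apply: CB; exact: CM.
by apply: CB; [exact: CM|exact: (comp_T (g := N))].
Qed.
Let Ctwm k : Ck k U twm.
Proof. by apply: Cexp; apply: CM => //; exact: CB. Qed.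

Lemma smooth_twist0 : smooth U twist0.
Proof.
have Cx' k := CT (Cx k); have Cy' k := CT (Cy k).
move=> k; apply: Ck_heis => //=.
- apply: CM => //; apply: CB; apply: CM => //; [exact: Ccos|exact: Csin].
- apply: CM => //; apply: CA; apply: CM => //; [exact: Csin|exact: Ccos].
- by apply: CM => //; exact: Cexp.
Qed.

Lemma hasD_coord p w :
  [/\ hasD (fun q : heis R => q.1.1) p w w.1.1,
      hasD (fun q : heis R => q.1.2) p w w.1.2 &
      hasD (fun q : heis R => q.2) p w w.2].
Proof.
have di : differentiable (id : heis R -> heis R) p.
  exact: (smooth_diff p (fun k => Ck_id k setT)).
have d1 := diff_fst di.
split; (split; first by [exact: diff_fst|exact: diff_snd]).
- by rewrite (derive_fst w d1) (derive_fst w di) derive_id.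
- by rewrite (derive_snd w d1) (derive_fst w di) derive_id.
- by rewrite (derive_snd w di) derive_id.
Qed.

Lemma hasD_halfsq p w :
  hasD halfsq p w (p.1.1 * w.1.1 + p.1.2 * w.1.2).
Proof.
have [hx hy _] := hasD_coord p w.
apply: hasD_eq; first by apply: hasD_mul (hasD_cst _ _ _) _;
  apply: hasD_add; apply: hasD_mul; [exact: hx..|exact: hy|exact: hy].
by rewrite mulr0 addr0; field.
Qed.

Lemma hasD_cha p w : 0 < halfsq p ->
  hasD cha p w ((halfsq p)^-1 * (p.1.1 * w.1.1 + p.1.2 * w.1.2)).
Proof.
by move=> s0; apply: hasD_comp (hasD_halfsq p w); exact: is_derive1_ln.
Qed.

Lemma hasD_chb p w : 0 < halfsq p ->
  hasD chb p w ((halfsq p)^-1 * w.2 -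
    chb p * ((halfsq p)^-1 * (p.1.1 * w.1.1 + p.1.2 * w.1.2))).
Proof.
move=> s0; have [_ _ hz] := hasD_coord p w.
have dV : is_derive (halfsq p) 1 (fun s : R => s^-1) (- ((halfsq p)^-1 ^+ 2)).
  have s1 : halfsq p != 0 by rewrite gt_eqF.
  apply: DeriveDef; first by apply: derivableV.
  by rewrite deriveV// derive_id /GRing.scale /= mulr1 exprVn.
apply: hasD_eq; first exact: hasD_mul hz (hasD_comp dV (hasD_halfsq p w)).
rewrite /chb; ring.
Qed.

Section derivatives.
Variables (p w : heis R) (da db : R).
Hypotheses (Da : hasD cha p w da) (Db : hasD chb p w db).

Lemma twab2 : twa p ^+ 2 + twb p ^+ 2 = cht p.
Proof.
rewrite /twa /twb /cht; have := cos2Dsin2 (tau p).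
move: (cos _) (sin _) (cha p) (chb p) => c d a b e.
by rewrite -[RHS]mulr1 -e; ring.
Qed.

Let dtau := 'D_1 ('D_1 N) (cht p) * (2 * (cha p * da + chb p * db)).
Definition dtwa := cos (tau p) * da - sin (tau p) * db - twb p * dtau.
Definition dtwb := sin (tau p) * da + cos (tau p) * db + twa p * dtau.
Definition dtwA := dtwb - db + twb p * dtwa - chb p * da.

Let Dt : hasD cht p w (2 * (cha p * da + chb p * db)).
Proof.
apply: hasD_eq; first exact: hasD_add (hasD_mul Da Da) (hasD_mul Db Db).
ring.
Qed.

Let diffN k (f : R -> R) : Ck k.+1 setT f -> is_derive (cht p) 1 f ('D_1 f (cht p)).
Proof.
by move=> Cf; apply: DeriveDef => //; apply/derivable1_diffP; exact: Ck_diff Cf I.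
Qed.

Let Dtau : hasD tau p w dtau.
Proof. exact: hasD_comp (diffN (dN 1)) Dt. Qed.

Let Dcos : hasD (fun q => cos (tau q)) p w (- sin (tau p) * dtau).
Proof. exact: hasD_comp Dtau. Qed.

Let Dsin : hasD (fun q => sin (tau q)) p w (cos (tau p) * dtau).
Proof. exact: hasD_comp Dtau. Qed.

Lemma hasD_twa : hasD twa p w dtwa.
Proof.
apply: hasD_eq.
  exact: hasD_add (hasD_mul Da Dcos) (hasD_opp (hasD_mul Db Dsin)).
rewrite /dtwa /twb; ring.
Qed.

Lemma hasD_twb : hasD twb p w dtwb.
Proof.
apply: hasD_eq; first exact: hasD_add (hasD_mul Da Dsin) (hasD_mul Db Dcos).
rewrite /dtwb /twa; ring.
Qed.

(** The angle is chosen so that [dA = dZ/S - dz/s]: in the coordinates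
    [a = ln s], [b = z/s] this reads [dA = (db' + b' da') - (db + b da)]. *)
Lemma hasD_twA : hasD twA p w dtwA.
Proof.
have Da' := hasD_twa; have Db' := hasD_twb.
apply: hasD_eq.
  apply: hasD_add (hasD_add Db' (hasD_opp Db)) (hasD_mul (hasD_cst _ _ _) _).
  apply: hasD_add; first exact: hasD_add (hasD_mul Da' Db') (hasD_opp (hasD_mul Da Db)).
  apply: hasD_opp; apply: hasD_add (hasD_mul Dt Dtau) _.
  exact: hasD_opp (hasD_comp (diffN (sN 1)) Dt).
have rot : twa p * dtwb - twb p * dtwa =
    cht p * dtau + (cha p * db - chb p * da).
  rewrite -twab2 /dtwa /dtwb; have := cos2Dsin2 (tau p).
  move: dtau; rewrite /twa /twb.
  move: (cos _) (sin _) (cha p) (chb p) => c d a b dt e.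
  rewrite -[a * db - b * da]mulr1 -e; ring.
rewrite -/(tau p) /dtwA; move: rot.
move: dtwa dtwb dtau (tau p) (twa p) (twb p) (cha p) (chb p) (cht p) => *; lra.
Qed.

Lemma hasD_twm : hasD twm p w (2^-1 * twm p * (dtwa - da)).
Proof.
apply: hasD_eq.
  apply: (hasD_comp (is_derive_expR _)).
  exact: hasD_mul (hasD_cst _ _ _) (hasD_add hasD_twa (hasD_opp Da)).
rewrite /twm; ring.
Qed.

Lemma hasD_twx :
  hasD twx p w (w.1.1 * cos (twA p) - w.1.2 * sin (twA p) - twy p * dtwA).
Proof.
have [hx hy _] := hasD_coord p w; have DA := hasD_twA.
have Dc : hasD (fun q => cos (twA q)) p w (- sin (twA p) * dtwA) by exact: hasD_comp DA.
have Ds : hasD (fun q => sin (twA q)) p w (cos (twA p) * dtwA) by exact: hasD_comp DA.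
apply: hasD_eq; first exact: hasD_add (hasD_mul hx Dc) (hasD_opp (hasD_mul hy Ds)).
rewrite /twy; ring.
Qed.

Lemma hasD_twy :
  hasD twy p w (w.1.1 * sin (twA p) + w.1.2 * cos (twA p) + twx p * dtwA).
Proof.
have [hx hy _] := hasD_coord p w; have DA := hasD_twA.
have Dc : hasD (fun q => cos (twA q)) p w (- sin (twA p) * dtwA) by exact: hasD_comp DA.
have Ds : hasD (fun q => sin (twA q)) p w (cos (twA p) * dtwA) by exact: hasD_comp DA.
apply: hasD_eq; first exact: hasD_add (hasD_mul hx Ds) (hasD_mul hy Dc).
rewrite /twx; ring.
Qed.

Lemma twxy2 : twx p * twx p + twy p * twy p = 2 * halfsq p.
Proof.
rewrite /twx /twy /halfsq; have := cos2Dsin2 (twA p).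
move: (cos _) (sin _) => c d e.
rewrite mulrA divff ?mul1r// -[RHS]mulr1 -e; ring.
Qed.

Definition dtwx := w.1.1 * cos (twA p) - w.1.2 * sin (twA p) - twy p * dtwA.
Definition dtwy := w.1.1 * sin (twA p) + w.1.2 * cos (twA p) + twx p * dtwA.

Lemma derive_twist0 : differentiable twist0 p ->
  'D_w twist0 p =
   (twm p * dtwx + twx p * (2^-1 * twm p * (dtwa - da)),
    twm p * dtwy + twy p * (2^-1 * twm p * (dtwa - da)),
    expR (twa p) * (dtwb + twb p * dtwa)).
Proof.
move=> df; have d1 := diff_fst df.
rewrite [LHS]surjective_pairing [X in (X, _)]surjective_pairing.
rewrite -(derive_fst w df) -(derive_snd w df).
rewrite -(derive_fst w d1) -(derive_snd w d1).
congr (_, _, _).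
- by have [_ ->] := hasD_mul hasD_twm hasD_twx; rewrite /dtwx.
- by have [_ ->] := hasD_mul hasD_twm hasD_twy; rewrite /dtwy.
- have De : hasD (fun q => expR (twa q)) p w (expR (twa p) * dtwa) by exact: hasD_comp hasD_twa.
  have [_ ->] := hasD_mul hasD_twb De; ring.
Qed.

End derivatives.

Lemma twm2 p : 0 < halfsq p -> twm p * twm p = expR (twa p) / halfsq p.
Proof.
move=> s0; rewrite /twm -expRD.
have -> : 2^-1 * (twa p - cha p) + 2^-1 * (twa p - cha p) = twa p - cha p by field.
by rewrite expRB /cha lnK.
Qed.

Lemma diff_twist0 p : 0 < halfsq p -> differentiable twist0 p.
Proof. by move=> s0; exact: (Ck_diff (smooth_twist0 1) s0). Qed.

(** The lift is contact: it multiplies the contact form by [exp (a' - a)]. The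
    angle [twA] was chosen for this: its derivative cancels the variation of the
    vertical coordinate. *)
Lemma theta_twist0 p w : 0 < halfsq p ->
  theta (twist0 p) ('D_w twist0 p) = expR (twa p) / halfsq p * theta p w.
Proof.
move=> s0; have Da := hasD_cha w s0; have Db := hasD_chb w s0.
rewrite (derive_twist0 Da Db (diff_twist0 s0)).
set da := (_ * _) in Da Db *; set db := _ - _ in Db *.
rewrite /theta /=.
set l := dtwa _ _ _ - da.
have mm := twm2 s0; have xy := twxy2 p.
have xdy : twx p * dtwy p w da db - twy p * dtwx p w da db =
    p.1.1 * w.1.2 - p.1.2 * w.1.1 + 2 * halfsq p * dtwA p da db.
  rewrite -xy /dtwx /dtwy /twx /twy; have := cos2Dsin2 (twA p).
  move: (cos _) (sin _) (dtwA _ _ _) => c d D e.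
  rewrite -[X in _ = X + _]mulr1 -[X in _ = _ * X + _]e; ring.
have -> : twm p * twx p * (twm p * dtwy p w da db + twy p * (2^-1 * twm p * l)) -
   twm p * twy p * (twm p * dtwx p w da db + twx p * (2^-1 * twm p * l)) =
   twm p * twm p * (twx p * dtwy p w da db - twy p * dtwx p w da db) by ring.
rewrite xdy mm /dtwA.
have wz : w.2 = halfsq p * (db + chb p * da).
  by rewrite /db subrK mulrA divff ?mul1r// gt_eqF.
rewrite wz; have s1 : halfsq p != 0 by rewrite gt_eqF.
move: (dtwa _ _ _) (dtwb _ _ _) => A B; by field.
Qed.

(** The factor by which a contact map multiplies the contact form is also the
    factor for its exterior derivative on horizontal planes, that is the
    horizontal jacobian. *)
Lemma hjac_twist0 p : 0 < halfsq p ->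
  hjac twist0 p = expR (twa p) / halfsq p.
Proof.
move=> s0; rewrite -twm2//.
have Da1 := hasD_cha (hX p) s0; have Db1 := hasD_chb (hX p) s0.
have Da2 := hasD_cha (hY p) s0; have Db2 := hasD_chb (hY p) s0.
rewrite /hjac (derive_twist0 Da1 Db1 (diff_twist0 s0)).
rewrite (derive_twist0 Da2 Db2 (diff_twist0 s0)) /hX /hY /= {Da1 Db1 Da2 Db2}.
rewrite !mulr1 !mulr0 !addr0 !add0r.
set da1 := _ * p.1.1; set da2 := _ * p.1.2.
set db1 := (X in dtwa p da1 X); set db2 := (X in dtwa p da2 X).
have s1 : halfsq p != 0 by rewrite gt_eqF.
have jac : dtwa p da1 db1 * dtwb p da2 db2 - dtwa p da2 db2 * dtwb p da1 db1 =
    (halfsq p)^-1.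
  have -> : (halfsq p)^-1 = da1 * db2 - da2 * db1.
    have h : 2 * halfsq p = p.1.1 * p.1.1 + p.1.2 * p.1.2.
      by rewrite /halfsq mulrA divff ?mul1r.
    rewrite /db1 /db2 /da1 /da2; transitivity
      (2^-1 * (p.1.1 * p.1.1 + p.1.2 * p.1.2) / halfsq p / halfsq p).
      by rewrite -h; field.
    by field.
  rewrite /dtwa /dtwb /twa /twb; have := cos2Dsin2 (tau p).
  move: (derive _ (cht p) _) (cos _) (sin _) (cha p) (chb p) => k c d a b e.
  rewrite -[RHS]mulr1 -e; ring.
have hx : p.1.1 = halfsq p * da1 by rewrite mulrA divff ?mul1r.
have hy : p.1.2 = halfsq p * da2 by rewrite mulrA divff ?mul1r.
have hdb1 : db1 = - (2^-1 * da2) - chb p * da1 by rewrite /db1 /da1 /da2; field.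
have hdb2 : db2 = 2^-1 * da1 - chb p * da2 by rewrite /db2 /da1 /da2; field.
have two : 2^-1 * (halfsq p * (da1 * da1 + da2 * da2)) = 1.
  have : 2 * halfsq p = halfsq p * (halfsq p * (da1 * da1 + da2 * da2)).
    transitivity (p.1.1 * p.1.1 + p.1.2 * p.1.2).
      by rewrite /halfsq mulrA divff ?mul1r.
    by rewrite hx hy; ring.
  by rewrite mulrC => /(mulfI s1) <-; rewrite mulVf.
have xy := twxy2 p; rewrite /dtwx /dtwy /=.
have cx : cos (twA p) * twx p + sin (twA p) * twy p = halfsq p * da1.
  rewrite -hx /twx /twy; have := cos2Dsin2 (twA p).
  move: (cos _) (sin _) => c d e; rewrite -[RHS]mulr1 -e; ring.
have cy : cos (twA p) * twy p - sin (twA p) * twx p = halfsq p * da2.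
  rewrite -hy /twx /twy; have := cos2Dsin2 (twA p).
  move: (cos _) (sin _) => c d e; rewrite -[RHS]mulr1 -e; ring.
have := cos2Dsin2 (twA p); move: xy cx cy.
rewrite -/db1 -/db2 /dtwA.
move: jac; move: (dtwa p da1 db1) (dtwa p da2 db2) => a1 a2.
move: (dtwb p da1 db1) (dtwb p da2 db2) => b1 b2 jac.
rewrite hdb1 hdb2; move: two jac s1; clearbody da1 da2.
move: (halfsq p) (chb p) (twa p) (twb p) (twm p) (twx p) (twy p) (cos _) (sin _).
move=> s b ta tb m X Y c d two jac s1 xy cx cy cd.
(* The determinant, grouped so that only the invariants [X^2 + Y^2], [c X + d Y],
   [c Y - d X] and [c^2 + d^2] of the rotation by [twA] remain. *)
transitivity (m * m * ((c ^+ 2 + d ^+ 2) +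
  (b2 - (2^-1 * da1 - b * da2) + tb * a2 - b * da2) * (c * X + d * Y) -
  (b1 - (- (2^-1 * da2) - b * da1) + tb * a1 - b * da1) * (c * Y - d * X) +
  2^-1 * (a1 - da1) * ((c * X + d * Y) + (X * X + Y * Y) *
    (b2 - (2^-1 * da1 - b * da2) + tb * a2 - b * da2)) +
  2^-1 * (a2 - da2) * ((c * Y - d * X) - (X * X + Y * Y) *
    (b1 - (- (2^-1 * da2) - b * da1) + tb * a1 - b * da1)))).
  by field.
rewrite xy cx cy cd.
transitivity (m * m * (1 + s * (a1 * b2 - a2 * b1) -
  2^-1 * (s * (da1 * da1 + da2 * da2)))); first by field.
by rewrite two jac divff// addrK mulr1.
Qed.

End twist.

(** * The twist as a map of the whole group *)

Section twist_global.
Context {R : realType}.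
Implicit Types p w : heis R.

Lemma hjac_id p : hjac id p = 1.
Proof. by rewrite /hjac !derive_id /hX /hY /= mulr1 mul0r subr0. Qed.

Lemma contact_id : contact (@id (heis R)).
Proof. by split=> [k|p w]; [exact: Ck_id|rewrite derive_id]. Qed.

(** The coordinates of the image, which show that composing two twists composes
    the maps of the half-plane. *)
Lemma twab_twist0 (N : R -> R) p : 0 < halfsq p ->
  [/\ halfsq (twist0 N p) = expR (twa N p),
      cha (twist0 N p) = twa N p & chb (twist0 N p) = twb N p].
Proof.
move=> s0; have s1 : halfsq p != 0 by rewrite gt_eqF.
have hs : halfsq (twist0 N p) = expR (twa N p).
  rewrite /halfsq /=.
  have -> : 2^-1 * (twm N p * twx N p * (twm N p * twx N p) +
      twm N p * twy N p * (twm N p * twy N p)) =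
    twm N p * twm N p * (2^-1 * (twx N p * twx N p + twy N p * twy N p)) by ring.
  by rewrite twm2// twxy2 mulKf// divfK.
split=> //; first by rewrite /cha hs expRK.
by rewrite /chb hs /= mulfK// expR_eq0.
Qed.

(** The opposite profile rotates every circle back, and undoes the angle [twA]. *)
Lemma twist0K (N : R -> R) p : 0 < halfsq p ->
  'D_1 (fun t => - N t) (cht p) = - 'D_1 N (cht p) ->
  twist0 (fun t => - N t) (twist0 N p) = p.
Proof.
move=> s0 DN; have [hs ha hb] := twab_twist0 N s0.
have ht : cht (twist0 N p) = cht p.
  by rewrite [LHS]/cht ha hb -!expr2 twab2.
set q := twist0 N p in hs ha hb ht *.
have htau : tau (fun t => - N t) q = - tau N p.
  by rewrite /tau ht DN.
have ea : twa (fun t => - N t) q = cha p.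
  rewrite /twa ha hb htau cosN sinN /twa /twb; have := cos2Dsin2 (tau N p).
  move: (cos _) (sin _) => c d e; rewrite -[RHS]mulr1 -e; ring.
have eb : twb (fun t => - N t) q = chb p.
  rewrite /twb ha hb htau cosN sinN /twa /twb; have := cos2Dsin2 (tau N p).
  move: (cos _) (sin _) => c d e; rewrite -[RHS]mulr1 -e; ring.
have eA : twA (fun t => - N t) q = - twA N p.
  by rewrite /twA ea eb ha hb ht htau; ring.
have em : twm (fun t => - N t) q = (twm N p)^-1.
  by rewrite /twm ea ha -expRN; congr expR; ring.
have m0 : twm N p != 0 by rewrite expR_eq0.
rewrite {1}/twist0 /twx /twy ea eb eA em cosN sinN /q /= /twx /twy.
have := cos2Dsin2 (twA N p); move: (cos _) (sin _) => c d e.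
rewrite /chb /cha lnK// divfK ?gt_eqF//; case: p e {s0 DN hs ha hb ht q htau ea eb eA em} m0 => [[x y] z] /= e m0.
congr (_, _, _); rewrite -[RHS]mulr1 -e; field.
all: exact: m0.
Qed.

Section support.
Variables (N : R -> R) (T2 sig : R).
Hypotheses (sN : smooth setT N) (N0 : forall t, T2 < t -> N t = 0).
Hypotheses (sig_gt0 : 0 < sig)
  (sigP : forall s : R, 0 < s -> s < sig -> T2 < ln s * ln s).

Lemma DN0 t : T2 < t -> 'D_1 N t = 0.
Proof.
move=> tT; rewrite (@near_eq_derive _ _ _ _ (cst 0)) ?derive_cst//.
have : nbhs t [set s | T2 < s] by apply: open_nbhs_nbhs; split=> //; exact: open_gt.
by apply: filterS => s /N0.
Qed.

Lemma tw0 p : 0 < halfsq p -> T2 < cht p -> [/\ twa N p = cha p & twist0 N p = p].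
Proof.
move=> s0 tT; have t0 : tau N p = 0 by rewrite /tau DN0.
have ea : twa N p = cha p by rewrite /twa t0 cos0 sin0 mulr1 mulr0 subr0.
have eb : twb N p = chb p by rewrite /twb t0 cos0 sin0 mulr1 mulr0 add0r.
have eA : twA N p = 0 by rewrite /twA ea eb t0 (N0 tT); ring.
split=> //; rewrite /twist0 /twm /twx /twy ea eb eA !subrr mulr0 expR0 cos0 sin0.
rewrite /cha /chb lnK// divfK ?gt_eqF// !mulr1 !mulr0 !mul1r subr0 add0r.
by case: p {s0 tT t0 ea eb eA} => [[]].
Qed.

Lemma twist_id p : T2 < cht p -> twist N p = p.
Proof.
rewrite /twist; case: ifPn => //; rewrite -ltNge => s0 tT.
by have [] := tw0 s0 tT.
Qed.

(** Near the axis [t >= (ln s)^2] is large, so the twist is the identity there,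
    which is why it extends smoothly across the axis. *)
Lemma twist_near_axis p : halfsq p < sig -> twist N p = p.
Proof.
move=> sp; have [s0|s0] := leP (halfsq p) 0; first by rewrite /twist s0.
apply: twist_id; apply: lt_le_trans (sigP s0 sp) _.
by rewrite /cht lerDl -expr2 sqr_ge0.
Qed.

Lemma twistE p : 0 < halfsq p -> twist N p = twist0 N p.
Proof. by move=> s0; rewrite /twist leNgt s0. Qed.

Lemma open_axis : open [set p : heis R | halfsq p < sig].
Proof.
rewrite -[X in open X]/(halfsq @^-1` [set t | t < sig]).
apply: open_comp; last exact: open_lt.
by move=> p _; exact: smooth_halfsq 0%N p I.
Qed.

Lemma smooth_twist : smooth setT (twist N).
Proof.
move=> k; have -> : [set: heis R] =
    [set p | 0 < halfsq p] `|` [set p | halfsq p < sig].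
  apply/seteqP; split=> // p _; have [sp|sp] := ltP (halfsq p) sig; first by right.
  by left; apply: lt_le_trans sp.
apply: Ck_union.
  apply: Ck_eq (@open_halfsq_gt0 R) _ (smooth_twist0 sN k) => p s0.
  by rewrite twistE.
by apply: Ck_eq open_axis _ (Ck_id _ _) => p /twist_near_axis.
Qed.

Lemma near_twist0 p : 0 < halfsq p -> \near p, twist N p = twist0 N p.
Proof.
move=> s0; have : nbhs p [set q : heis R | 0 < halfsq q].
  by apply: open_nbhs_nbhs; split=> //; exact: open_halfsq_gt0.
by apply: filterS => q /= /twistE.
Qed.

Lemma near_twist_id p : halfsq p <= 0 -> \near p, twist N p = id p.
Proof.
move=> s0; have : nbhs p [set q : heis R | halfsq q < sig].
  apply: open_nbhs_nbhs; split; first exact: open_axis.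
  exact: le_lt_trans s0 _.
by apply: filterS => q /= /twist_near_axis.
Qed.

Lemma contact_twist : contact (twist N).
Proof.
split; first exact: smooth_twist.
move=> p w pw; have [s0|s0] := leP (halfsq p) 0.
  rewrite (near_eq_derive _ (near_twist_id s0)) derive_id.
  by rewrite /twist s0.
rewrite (near_eq_derive _ (near_twist0 s0)) twistE//; apply/horizontalP.
by rewrite theta_twist0//; move/horizontalP: pw => ->; rewrite mulr0.
Qed.

Lemma hjac_twist_axis p : halfsq p <= 0 -> hjac (twist N) p = 1.
Proof. by move=> s0; rewrite (hjac_near (near_twist_id s0)) hjac_id. Qed.

Lemma hjac_twist p : 0 < halfsq p ->
  hjac (twist N) p = expR (twa N p) / halfsq p.
Proof. by move=> s0; rewrite (hjac_near (near_twist0 s0)) hjac_twist0. Qed.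

Lemma hjac_twist_id p : T2 < cht p -> hjac (twist N) p = 1.
Proof.
move=> tT; have [s0|s0] := leP (halfsq p) 0; first exact: hjac_twist_axis.
have [ea _] := tw0 s0 tT.
by rewrite hjac_twist// ea /cha lnK// divff// gt_eqF.
Qed.

Lemma twistK p : twist (fun t => - N t) (twist N p) = p.
Proof.
have [s0|s0] := leP (halfsq p) 0; first by rewrite {2}/twist s0 /twist s0.
rewrite [twist N p]twistE//.
have [hs _ _] := twab_twist0 N s0.
rewrite /twist hs leNgt expR_gt0 /=; apply: twist0K => //.
by rewrite deriveN//; apply: diff_derivable; exact: smooth_diff.
Qed.

(** The twist preserves [t], hence moves points only inside the compact set
    [t <= T2]; there both [ln s] and its image are at most [sqrt T2]. *)
Lemma support_twist p (r : R) : 0 <= r -> T2 <= r ^+ 2 -> 0 < halfsq p ->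
  cht p <= T2 -> [/\ `|cha p| <= r, `|chb p| <= r & `|twa N p| <= r].
Proof.
move=> r0 Tr s0 tT.
have H (u v : R) : u ^+ 2 + v ^+ 2 <= r ^+ 2 -> `|u| <= r.
  move=> uv; rewrite -(ger0_norm r0) -ler_sqr ?nnegrE ?normr_ge0//.
  by rewrite !real_normK ?num_real// (le_trans _ uv)// lerDl sqr_ge0.
have tr : cht p <= r ^+ 2 by exact: le_trans tT Tr.
split.
- by apply: (H _ (chb p)); rewrite !expr2.
- by apply: (H _ (cha p)); rewrite addrC !expr2.
- by apply: (H _ (twb N p)); rewrite twab2.
Qed.

End support.
End twist_global.

(** * The angle profile *)

Section profile.
Context {R : realType}.
Variables (t1 t2 : R).
Hypothesis t12 : t1 < t2.

Let den (t : R) := flat 0 (t2 - t) + flat 0 (t - t1).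
Definition cutoff (t : R) : R := flat 0 (t2 - t) * (den t)^-1.
(** The primitive of the rotation angle: the angle is its derivative, equal to [pi]
    below [t1] and to [0] above [t2]. *)
Definition profile (t : R) : R := pi * t * cutoff t.

Lemma flat_ge0 n (t : R) : 0 <= flat n t.
Proof.
rewrite /flat; case: ifPn => // t0.
by rewrite mulr_ge0 ?expR_ge0// exprn_ge0// ltW// invr_gt0.
Qed.

Lemma flat0_gt0 (t : R) : 0 < t -> 0 < flat 0 t.
Proof. by move=> t0; rewrite /flat t0 expr0 mul1r expR_gt0. Qed.

Lemma flat_eq0 n (t : R) : t <= 0 -> flat n t = 0.
Proof. by move=> t0; rewrite /flat ltNge t0. Qed.

Lemma den_gt0 t : 0 < den t.
Proof.
have [tt2|tt2] := ltP t t2.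
  by rewrite ltr_pwDl ?flat_ge0// flat0_gt0// subr_gt0.
by rewrite ltr_wpDl ?flat_ge0// flat0_gt0// subr_gt0 (lt_le_trans t12).
Qed.

Lemma cutoff1 t : t <= t1 -> cutoff t = 1.
Proof.
move=> tt; have := den_gt0 t; rewrite /cutoff /den (@flat_eq0 _ (t - t1)) ?subr_le0//.
by rewrite addr0 => d0; rewrite divff// gt_eqF.
Qed.

Lemma cutoff0 t : t2 <= t -> cutoff t = 0.
Proof. by move=> tt; rewrite /cutoff flat_eq0 ?mul0r// subr_le0. Qed.

Lemma smooth_profile : smooth setT profile.
Proof.
move=> k; have oT := @openT R.
have C1 : Ck k setT (fun t : R => flat 0 (t2 - t)).
  apply: (Ck_comp1 oT (U' := setT)) => //; last exact: smooth_flat.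
  by apply: Ck_add => //; [exact: Ck_cst|apply: Ck_opp => //; exact: Ck_id].
have C2 : Ck k setT (fun t : R => flat 0 (t - t1)).
  apply: (Ck_comp1 oT (U' := setT)) => //; last exact: smooth_flat.
  by apply: Ck_add => //; [exact: Ck_id|exact: Ck_cst].
apply: Ck_mul => //.
  by apply: Ck_mul => //; [exact: Ck_cst|exact: Ck_id].
apply: Ck_mul => //; apply: (Ck_comp1 oT _ _ (smooth_inv k)) => [t _|].
  exact: den_gt0.
exact: Ck_add.
Qed.

Lemma profile0 t : t2 < t -> profile t = 0.
Proof. by move=> tt; rewrite /profile cutoff0 ?mulr0// ltW. Qed.

Lemma derive_profile t : t < t1 -> 'D_1 profile t = pi.
Proof.
move=> tt; have nr : \near t, profile t = pi * t.
  have : nbhs t [set s | s < t1] by apply: open_nbhs_nbhs; split=> //; exact: open_lt.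
  by apply: filterS => s /= st; rewrite /profile cutoff1 ?mulr1// ltW.
rewrite (near_eq_derive _ nr).
have hid : hasD (fun s : R => s) t 1 1.
  by split; [exact: (smooth_diff t (fun k => Ck_id k setT))|exact: derive_id].
by have [_ ->] := hasD_mul (hasD_cst pi t 1) hid; rewrite mulr1 mulr0 addr0.
Qed.

(** Below [t1] the twist is the half-turn of the [(a, b)]-plane, which inverts
    [s]. *)
Lemma hjac_half_turn (p : heis R) : 0 < halfsq p -> cht p < t1 ->
  hjac (twist0 profile) p = (halfsq p)^-1 ^+ 2.
Proof.
move=> s0 tt; rewrite hjac_twist0//; last exact: smooth_profile.
rewrite /twa /tau derive_profile// cospi sinpi mulr0 subr0 mulrN1 expRN lnK//.
Qed.

End profile.

(** * Counting grid points *)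

Section counting.
Context {R : realType}.

(** The selected indices lie between the smallest and the largest of them, which are
    at most [L / a] apart. *)
Lemma count_spread n (P : pred 'I_n) (a L : R) : 0 < a -> 0 <= L ->
  (forall i j : 'I_n, P i -> P j -> a * (j%:R - i%:R) <= L) ->
  a * (\sum_(i < n) (P i)%:R) <= L + a.
Proof.
move=> a0 L0 h; case: (pickP P) => [i0 Pi0|P0]; last first.
  rewrite big1 ?mulr0 ?addr_ge0// ?ltW// => i _.
  by rewrite P0.
case: (arg_minnP (fun i : 'I_n => i : nat) Pi0) => m Pm hm.
case: (arg_maxnP (fun i : 'I_n => i : nat) Pi0) => M PM hM.
have mM : (m <= M)%N by exact: hm.
have : \sum_(i < n) (P i)%:R <= (M - m).+1%:R :> R.
  rewrite -natr_sum ler_nat.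
  apply: (@leq_trans (\sum_(i < n) (m <= i < M.+1)%N)).
    by apply: leq_sum => i _; case Pi: (P i) => //=; rewrite ltnS hm//=; have /= -> := hM _ Pi.
  rewrite -(big_mkord xpredT (fun i => (m <= i < M.+1)%N : nat)).
  rewrite (big_cat_nat _ (n := m)) //=; last exact: ltnW.
  rewrite (@big_cat_nat _ _ _ M.+1 m n) //=; last exact: leqW.
  rewrite big_nat_cond big1 ?add0n; last first.
    by move=> i /andP[/andP[_ im] _]; rewrite leqNgt im.
  rewrite addnC big_nat_cond big1 ?add0n; last first.
    by move=> i /andP[/andP[im _] _]; rewrite [(i < _)%N]ltnNge im andbF.
  rewrite (eq_big_nat _ _ (F2 := fun=> 1%N)) => [|i ->//].
  by rewrite sum_nat_const_nat muln1 subSn.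
move=> c; apply: (@le_trans _ _ (a * (M - m).+1%:R)); first by rewrite ler_pM2l.
rewrite -natr1 mulrDr mulr1 lerD2r natrB//; exact: h.
Qed.

(** The indices between the integer parts of [(u - b) / a] and [(v - b) / a] are
    selected. *)
Lemma count_ge n (P : pred 'I_n) (a b u v : R) : 0 < a ->
  (forall i : 'I_n, u <= a * i%:R + b -> a * i%:R + b <= v -> P i) ->
  b <= u -> v < a * n%:R + b ->
  v - u - a <= a * (\sum_(i < n) (P i)%:R).
Proof.
move=> a0 h bu vn.
have [vb|vb] := ltP v b.
  apply: (@le_trans _ _ 0); last by apply: mulr_ge0; [exact: ltW|exact: sumr_ge0].
  by rewrite subr_le0 lerBlDr (le_trans (ltW vb))// (le_trans bu)// lerDr ltW.
pose al := (u - b) / a; pose be := (v - b) / a.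
have al0 : 0 <= al by rewrite divr_ge0 ?subr_ge0// ltW.
have be0 : 0 <= be by rewrite divr_ge0 ?subr_ge0// ltW.
have /andP[A1 A2] := truncn_itv al0; have /andP[B1 B2] := truncn_itv be0.
set A := Num.truncn al in A1 A2; set B := Num.truncn be in B1 B2.
have Bn : (B < n)%N.
  rewrite -(ltr_nat R); apply: le_lt_trans B1 _.
  by rewrite /be ltr_pdivrMr// ltrBlDr mulrC.
have H (i : 'I_n) : (A < i <= B)%N -> P i.
  move=> /andP[Ai iB]; apply: h.
    have : al <= i%:R by rewrite (le_trans (ltW A2))// ler_nat.
    by rewrite /al ler_pdivrMr// lerBlDr mulrC.
  have : i%:R <= be by rewrite (le_trans _ B1)// ler_nat.
  by rewrite /be ler_pdivlMr// lerBrDr mulrC.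
have c : (B - A)%:R <= \sum_(i < n) (P i)%:R :> R.
  rewrite -natr_sum ler_nat.
  apply: (@leq_trans (\sum_(i < n) (A < i <= B)%N)); last first.
    by apply: leq_sum => i _; case: (boolP (A < i <= B)%N) => // /H ->.
  have [AB|AB] := leqP B A; first by rewrite (eqP AB).
  rewrite -(big_mkord xpredT (fun i => (A < i <= B)%N : nat)).
  rewrite (big_cat_nat _ (n := A.+1)) //=; last exact: leq_trans (ltnW Bn).
  rewrite (@big_cat_nat _ _ _ B.+1 A.+1 n) //=.
  rewrite addnC -addnA (leq_trans _ (leq_addr _ _))//.
  rewrite (eq_big_nat _ _ (F2 := fun=> 1%N)) => [|i].
    by rewrite sum_nat_const_nat muln1 subSS.
  by rewrite ltnS => ->.
  exact: leqW.
apply: (@le_trans _ _ (a * (B - A)%:R)); last by rewrite ler_pM2l.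
have BA : B%:R - A%:R <= (B - A)%:R :> R.
  by rewrite lerBlDr -natrD ler_nat addnC -leq_subLR.
apply: (@le_trans _ _ (a * (B%:R - A%:R))); last by rewrite ler_pM2l.
have : be - 1 - al <= B%:R - A%:R.
  rewrite lerB//; last by rewrite lerBlDr natr1 ltW.
rewrite -(ler_pM2l a0) => BA'; apply: le_trans BA'; rewrite le_eqVlt; apply/orP; left.
rewrite /al /be; apply/eqP; field; exact: lt0r_neq0.
Qed.

End counting.

(** * A compactly supported contact map with mean horizontal jacobian below 1 *)

Lemma norm_le_sqr {R : realType} (u c : R) : 0 <= c -> u ^+ 2 <= c ^+ 2 -> `|u| <= c.
Proof.
move=> c0 uc; rewrite -(@ler_pXn2r _ 2) ?nnegrE//.
by rewrite real_normK ?num_real.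
Qed.

Section block_bounds.
Context {R : realType}.
Implicit Types p w : heis R.

(** The support is [t <= r^2], hence [2^-32 <= s <= 2^32] there. The angle goes
    from [pi] to [0] in the shell [t2 - zeta^2 <= t <= t2], which is so thin that the
    crude bound [2^64] on the jacobian costs little on it. *)
Let r : R := 32 * ln 2.
Let t2 : R := r ^+ 2.
Let zeta : R := (2 ^+ 90)^-1.
Let t1 : R := t2 - zeta ^+ 2.
Definition blockN : R -> R := profile t1 t2.

Let r_expR : expR r = 2 ^+ 32.
Proof. by rewrite /r expRM_natl lnK// posrE. Qed.

Let ln2_le1 : ln 2 <= 1 :> R.
Proof.
rewrite -ler_expR lnK ?posrE//; apply: le_trans (expR_ge1Dx _); lra.
Qed.

Let ln2_ge : 2^-1 <= ln 2 :> R.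
Proof.
rewrite -ler_expR lnK; last by rewrite posrE.
rewrite -[2^-1]opprK expRN invf_ple ?posrE ?expR_gt0//.
by apply: le_trans (expR_ge1Dx _); lra.
Qed.

Let r_ge0 : 0 <= r.
Proof. by have := ln2_ge; rewrite /r; lra. Qed.

Let r_le : r <= 32.
Proof. by have := ln2_le1; rewrite /r; lra. Qed.

Let zeta_gt0 : 0 < zeta.
Proof. by rewrite invr_gt0 exprn_gt0. Qed.

Let t12 : t1 < t2.
Proof. by rewrite /t1 ltrBlDr ltrDl exprn_gt0. Qed.

Lemma smooth_blockN : smooth setT blockN.
Proof. exact: smooth_profile. Qed.

Lemma blockN0 t : t2 < t -> blockN t = 0.
Proof. exact: profile0. Qed.

Let sig : R := expR (- r).
Let sig_gt0 : 0 < sig. Proof. exact: expR_gt0. Qed.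
Let sigP s : 0 < s -> s < sig -> t2 < ln s * ln s.
Proof.
move=> s0 ss; rewrite /t2 -expr2 -[ltRHS]sqrrN ltr_pXn2r ?nnegrE//.
  rewrite ltrNr -ltr_expR lnK//.
have : ln s < - r by rewrite -ltr_expR lnK.
by move: r_ge0; lra.
Qed.

Definition btwist := twist blockN.
Definition btwistV := twist (fun t => - blockN t).

Lemma contact_btwist : contact btwist.
Proof. exact: (contact_twist smooth_blockN blockN0 sig_gt0 sigP). Qed.

Lemma contact_btwistV : contact btwistV.
Proof.
apply: (contact_twist _ _ sig_gt0 sigP).
  by move=> k; apply: Ck_opp; [exact: openT|exact: smooth_blockN].
by move=> t /blockN0 ->; rewrite oppr0.
Qed.

Lemma btwistK p : btwistV (btwist p) = p.
Proof. exact: (twistK smooth_blockN). Qed.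

Lemma btwistVK p : btwist (btwistV p) = p.
Proof.
have := @twistK R (fun t => - blockN t) _ p; rewrite /btwist /btwistV.
have -> : (fun t => - - blockN t) = blockN by apply/funext => t; rewrite opprK.
by apply => k; apply: Ck_opp; [exact: openT|exact: smooth_blockN].
Qed.

Lemma btwist_support p : 0 < halfsq p -> cht p <= t2 ->
  [/\ halfsq p <= 2 ^+ 32, (2 ^+ 32)^-1 <= halfsq p,
      `|p.2| <= 32 * halfsq p & `|hjac btwist p| <= 2 ^+ 64].
Proof.
move=> s0 tT.
have [ha hb ha'] := support_twist blockN r_ge0 (lexx t2) s0 tT.
have s1 : halfsq p != 0 by rewrite gt_eqF.
have es : expR (cha p) = halfsq p by rewrite /cha lnK.
have [a1 a2] : - r <= cha p /\ cha p <= r by move: ha; rewrite ler_norml => /andP.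
have su : halfsq p <= 2 ^+ 32 by rewrite -r_expR -es ler_expR.
have sl : (2 ^+ 32)^-1 <= halfsq p by rewrite -r_expR -expRN -es ler_expR.
split=> //.
  have -> : p.2 = chb p * halfsq p by rewrite /chb divfK.
  rewrite normrM (gtr0_norm s0) ler_pM2r// (le_trans hb)//.
rewrite (hjac_twist smooth_blockN)// ger0_norm; last first.
  by rewrite mulr_ge0 ?expR_ge0// invr_ge0 ltW.
have -> : (2 : R) ^+ 64 = 2 ^+ 32 * 2 ^+ 32 by rewrite -exprD.
apply: ler_pM; rewrite ?expR_ge0 ?invr_ge0 ?(ltW s0)//.
  by rewrite -r_expR ler_expR; move: ha'; rewrite ler_norml => /andP[].
by rewrite -[leRHS]invrK lef_pV2// posrE invr_gt0 exprn_gt0.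
Qed.

Lemma btwist_out p : t2 < cht p -> btwist p = p /\ hjac btwist p = 1.
Proof.
move=> tT; split; first exact: (twist_id blockN0 tT).
exact: (hjac_twist_id smooth_blockN blockN0 sig_gt0 sigP).
Qed.

Lemma btwist_axis p : halfsq p <= 0 -> btwist p = p /\ hjac btwist p = 1.
Proof.
move=> s0; split; first by rewrite /btwist /twist s0.
exact: (hjac_twist_axis blockN0 sig_gt0 sigP).
Qed.

Lemma hjac_btwist_in p : 0 < halfsq p -> cht p < t1 ->
  `|hjac btwist p| = (halfsq p)^-1 ^+ 2.
Proof.
move=> s0 tt; rewrite (hjac_near (near_twist0 _ s0)) hjac_half_turn//.
by rewrite ger0_norm// exprn_ge0// invr_ge0 ltW.
Qed.

(** The three regions of the estimate: boxes around the origin, which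
    contain the points of the support with small [s], where the jacobian is large;
    the shell, where it is not explicit; and a big box where it is at most [1/4]. *)
Definition box (c d : R) p : bool :=
  [&& `|p.1.1| <= c, `|p.1.2| <= c & `|p.2| <= d].
Definition shell p : bool :=
  [&& 0 < halfsq p, halfsq p <= 2 ^+ 32, t1 <= cht p & cht p <= t2].
Definition gain p : bool :=
  [&& 2 ^+ 14 <= p.1.1, p.1.1 <= 2 ^+ 15, `|p.1.2| <= 2 ^+ 14 &
      `|p.2| <= 2 ^+ 28].

Lemma gain_in p : gain p -> 2 <= halfsq p /\ cht p < t1.
Proof.
case: p => [[x y] z] /and4P[/= x1 x2 y1 z1].
have sE : halfsq (x, y, z) = 2^-1 * (x * x + y * y) by [].
have yy : y * y <= 2 ^+ 28.
  rewrite -expr2 -real_normK ?num_real//.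
  have -> : (2 : R) ^+ 28 = (2 ^+ 14) ^+ 2 by rewrite -exprM.
  by rewrite ler_pXn2r ?nnegrE.
have y0 : 0 <= y * y by rewrite -expr2 sqr_ge0.
have xx1 : 2 ^+ 28 <= x * x.
  have -> : (2 : R) ^+ 28 = 2 ^+ 14 * 2 ^+ 14 by rewrite -exprD.
  by apply: ler_pM.
have xx2 : x * x <= 2 ^+ 30.
  have -> : (2 : R) ^+ 30 = 2 ^+ 15 * 2 ^+ 15 by rewrite -exprD.
  by apply: ler_pM => //; apply: le_trans x1; lra.
have s1 : 2 ^+ 27 <= halfsq (x, y, z) by rewrite sE; lra.
have s2 : halfsq (x, y, z) <= 2 ^+ 30 by rewrite sE; lra.
have s0 : 0 < halfsq (x, y, z) by lra.
split; first by lra.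
have a0 : 0 <= cha (x, y, z) by rewrite /cha ln_ge0//; lra.
have a1 : cha (x, y, z) <= 30 * ln 2.
  by rewrite -ler_expR /cha lnK ?posrE// expRM_natl lnK ?posrE.
have b1 : `|chb (x, y, z)| <= 2.
  rewrite /chb normrM normfV (gtr0_norm s0) ler_pdivrMr//=.
  by apply: le_trans z1 _; lra.
have bb : chb (x, y, z) * chb (x, y, z) <= 4.
  rewrite -expr2 -real_normK ?num_real//.
  have -> : (4 : R) = 2 ^+ 2 by lra.
  by rewrite ler_pXn2r ?nnegrE.
have aa : cha (x, y, z) * cha (x, y, z) <= (30 * ln 2) * (30 * ln 2).
  by apply: ler_pM.
have l2 : 4^-1 <= ln 2 * ln 2 :> R.
  have -> : 4^-1 = 2^-1 * 2^-1 :> R by field.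
  by apply: ler_pM => //; exact: ln2_ge.
have z2 : zeta ^+ 2 <= 1.
  rewrite -(expr1n _ 2) ler_pXn2r ?nnegrE ?(ltW zeta_gt0)//.
  by rewrite /zeta; lra.
rewrite /cht /t1 /t2 /r expr2; lra.
Qed.

(** Inside the shell radius the jacobian is [s^-2]: at most [2^64] and [2^32] on the
    two boxes, at most [1] beyond them, and at most [1/4] in the gain region. *)
Lemma btwist_ptwise p : `|hjac btwist p| + 2^-1 * (gain p)%:R <=
  1 + 2 ^+ 64 * (box (2 ^+ 7)^-1 (2 ^+ 11)^-1 p)%:R +
  2 ^+ 32 * (box 2 32 p)%:R + 2 ^+ 64 * (shell p)%:R.
Proof.
have i0 (b : bool) : 0 <= b%:R :> R by [].
set I1 := (box _ _ p)%:R; set I2 := (box 2 32 p)%:R; set I3 := (shell p)%:R.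
have [j1 j2 j3] : [/\ 0 <= I1, 0 <= I2 & 0 <= I3] by split.
have [s0|s0] := leP (halfsq p) 0.
  have [_ ->] := btwist_axis s0; have -> : gain p = false.
    by apply/negP => /gain_in [s2 _]; lra.
  by rewrite normr1 mulr0; lra.
have [tT|tT] := ltP t2 (cht p).
  have [_ ->] := btwist_out tT; have -> : gain p = false.
    by apply/negP => /gain_in [_ tt]; move: t12; lra.
  by rewrite normr1 mulr0; lra.
have [su sl zs hl] := btwist_support s0 tT.
(* In the shell, only the bound [2^64] is available. *)
have [tt|tt] := leP t1 (cht p).
  have -> : gain p = false.
    by apply/negP => /gain_in [_]; lra.
  have -> : I3 = 1 by rewrite /I3 /shell s0 su tt tT.
  by rewrite mulr0; lra.
rewrite hjac_btwist_in//; set s := halfsq p in s0 su sl zs *.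
have s1 : s != 0 by rewrite gt_eqF.
have xy : p.1.1 ^+ 2 + p.1.2 ^+ 2 = 2 * s by rewrite /s /halfsq; field.
have X2 := sqr_ge0 p.1.1; have Y2 := sqr_ge0 p.1.2.
have inbox c d : 0 <= c -> 2 * s <= c ^+ 2 -> 32 * s <= d -> box c d p.
  move=> c0 sc sd; rewrite /box (le_trans zs sd) andbT.
  by apply/andP; split; apply: norm_le_sqr => //; lra.
have u0 : 0 < s^-1 by rewrite invr_gt0.
(* Below the shell the jacobian is [s^-2], treated according to the size of [s]. *)
have [s16|s16] := ltP s (2 ^+ 16)^-1.
  have -> : I1 = 1 by rewrite /I1 inbox//; lra.
  have -> : gain p = false by apply/negP => /gain_in []; rewrite -/s; lra.
  have : s^-1 ^+ 2 <= 2 ^+ 64.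
    have -> : (2 : R) ^+ 64 = (2 ^+ 32) ^+ 2 by rewrite -exprM.
    rewrite ler_pXn2r ?nnegrE ?(ltW u0)//.
    by rewrite -[leRHS]invrK lef_pV2 ?posrE ?invr_gt0 ?exprn_gt0.
  by rewrite mulr0; lra.
have [s11|s11] := leP s 1.
  have -> : I2 = 1 by rewrite /I2 inbox//; lra.
  have -> : gain p = false by apply/negP => /gain_in []; rewrite -/s; lra.
  have : s^-1 ^+ 2 <= 2 ^+ 32.
    have -> : (2 : R) ^+ 32 = (2 ^+ 16) ^+ 2 by rewrite -exprM.
    rewrite ler_pXn2r ?nnegrE ?(ltW u0)//.
    by rewrite -[leRHS]invrK lef_pV2 ?posrE ?invr_gt0 ?exprn_gt0.
  by rewrite mulr0; lra.
have V1 : s^-1 <= 1 by rewrite invf_le1// ltW.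
have [g|g] := boolP (gain p); last first.
  have : s^-1 ^+ 2 <= 1 by rewrite expr_le1// ltW.
  by rewrite mulr0; lra.
have [s2 _] := gain_in g.
have V2 : s^-1 <= 2^-1 by rewrite lef_pV2 ?posrE.
have : s^-1 ^+ 2 <= 2^-1 * 1.
  by rewrite expr2; apply: ler_pM => //; exact: ltW.
by rewrite mulr1n; lra.
Qed.

(** Two points of the shell over the same [(x, y)] and on the same side of
    [z = 0] are close: [|z - z'|^2 <= |z^2 - z'^2| <= s^2 (t2 - t1)]. *)
Lemma shell_spread (x y z z' : R) : shell (x, y, z) -> shell (x, y, z') ->
  0 <= z * z' -> `|z - z'| <= 2 ^+ 32 * zeta.
Proof.
move=> /and4P[s0 s32 h1 h2] /and4P[_ _ h1' h2'] zz.
rewrite /cht /chb in h1 h2 h1' h2'; rewrite /cha /= in h1 h2 h1' h2'.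
have sE : halfsq (x, y, z') = halfsq (x, y, z) by [].
rewrite sE in h1' h2'; set s := halfsq _ in s0 s32 h1 h2 h1' h2'.
have u : 0 <= s^-1 by rewrite invr_ge0 ltW.
have s1 : s * s^-1 = 1 by rewrite divff// gt_eqF.
have D : `|z ^+ 2 - z' ^+ 2| <= s ^+ 2 * zeta ^+ 2.
  have E : `|(z * s^-1) ^+ 2 - (z' * s^-1) ^+ 2| <= zeta ^+ 2.
    rewrite ler_norml !expr2; move: h1 h2 h1' h2'; rewrite /t1.
    by move=> *; apply/andP; split; rewrite -!expr2; lra.
  have -> : z ^+ 2 - z' ^+ 2 = s ^+ 2 * ((z * s^-1) ^+ 2 - (z' * s^-1) ^+ 2).
    transitivity ((s * s^-1) ^+ 2 * (z ^+ 2 - z' ^+ 2)); last by ring.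
    by rewrite s1 expr1n mul1r.
  by rewrite normrM (ger0_norm (sqr_ge0 s)) ler_pM2l ?exprn_gt0.
have sq : `|z - z'| ^+ 2 <= (2 ^+ 32 * zeta) ^+ 2.
  apply: (@le_trans _ _ (s ^+ 2 * zeta ^+ 2)); last first.
    by rewrite [leRHS]exprMn ler_wpM2r ?sqr_ge0// ler_pXn2r ?nnegrE ?(ltW s0)//.
  apply: le_trans D; rewrite real_normK ?num_real//.
  have -> : z ^+ 2 - z' ^+ 2 = (z - z') * (z + z') by ring.
  rewrite -real_normK ?num_real// expr2 normrM ler_wpM2l//.
  rewrite -(@ler_pXn2r _ 2) ?nnegrE// !real_normK ?num_real//; lra.
have c0 : 0 <= 2 ^+ 32 * zeta by rewrite mulr_ge0 ?exprn_ge0// ltW.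
by apply: norm_le_sqr; rewrite // -real_normK ?num_real.
Qed.

End block_bounds.

(** * The mean jacobian of the twist over a tile *)

Section block_average.
Context {R : realType}.

Lemma sum3_prod n1 n2 n3 (A : 'I_n1 -> R) (B : 'I_n2 -> R) (C : 'I_n3 -> R) :
  \sum_i \sum_j \sum_l A i * (B j * C l) =
  (\sum_i A i) * ((\sum_j B j) * (\sum_l C l)).
Proof.
rewrite mulr_suml; apply: eq_bigr => i _; rewrite mulr_suml mulr_sumr.
by apply: eq_bigr => j _; rewrite -mulr_sumr -mulr_sumr.
Qed.

(** The gain outweighs the losses: [2^51] against [2^43 + 2^46]. *)
Lemma average_arith (a m m2 S g b1 b2 sh : R) :
  0 < m -> m <= (2 ^+ 29)^-1 -> 0 < m2 -> m2 <= (2 ^+ 58)^-1 ->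
  a * S + a * (2^-1 * g) <= 2 ^+ 76 + a * (2 ^+ 64 * b1) +
    a * (2 ^+ 32 * b2) + a * (2 ^+ 64 * sh) ->
  a * b1 <= ((2 ^+ 7)^-1 + m) * (((2 ^+ 7)^-1 + m) * ((2 ^+ 11)^-1 + m2)) ->
  a * b2 <= (2 + m) * ((2 + m) * (32 + m2)) ->
  a * sh <= (2 ^+ 19) ^+ 2 * (2 ^+ 32 * (2 ^+ 90)^-1 + 2 * m2) ->
  2 ^+ 52 <= a * g -> a * S <= (1 - (2 ^+ 26)^-1) * 2 ^+ 76.
Proof.
move=> m0 ms m20 m2s P B1 B2 Sh G.
have pM3 (x y z x' y' z' : R) : 0 <= x -> 0 <= y -> 0 <= z ->
    x <= x' -> y <= y' -> z <= z' -> x * (y * z) <= x' * (y' * z').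
  by move=> *; apply: ler_pM; rewrite ?mulr_ge0//; exact: ler_pM.
have D1 : a * b1 <= (2 ^+ 6)^-1 * ((2 ^+ 6)^-1 * (2 ^+ 10)^-1).
  by apply: le_trans B1 _; apply: pM3; clear -m0 ms m20 m2s; lra.
have D2 : a * b2 <= 4 * (4 * 64).
  by apply: le_trans B2 _; apply: pM3; clear -m0 ms m20 m2s; lra.
have D3 : a * sh <= 2 ^+ 38 * (2 ^+ 56)^-1.
  apply: le_trans Sh _; rewrite -exprM ler_pM2l ?exprn_gt0//.
  by clear -m2s; lra.
rewrite (mulrCA a) (mulrCA a _ b1) (mulrCA a _ b2) (mulrCA a _ sh) in P.
clear -P D1 D2 D3 G; move: (a * S) (a * g) (a * b1) (a * b2) (a * sh) P D1 D2 D3 G.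
by move=> *; lra.
Qed.

Variable (k : nat).
Hypothesis k48 : (48 <= k)%N.
Let n := (2 ^ k)%N.
Let L := (4 ^ k)%N.
Let M : R := 2 ^+ 19.
Let m : R := M / n%:R.
Let m2 : R := m ^+ 2.

(** A grid in the tile of size [M], which contains the support of the twist. *)
Definition gridpt (i j l : nat) : heis R :=
  (2 * m * i%:R - M, 2 * m * j%:R - M, 2 * m2 * l%:R - M ^+ 2).

Let n_gt0 : 0 < n%:R :> R. Proof. by rewrite ltr0n expn_gt0. Qed.
Let M_gt0 : 0 < M. Proof. exact: exprn_gt0. Qed.
Let m_gt0 : 0 < m. Proof. exact: divr_gt0. Qed.
Let m2_gt0 : 0 < m2. Proof. exact: exprn_gt0. Qed.
Let mn : m * n%:R = M. Proof. by rewrite divfK ?gt_eqF. Qed.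
Let Ln : L%:R = n%:R ^+ 2 :> R.
Proof. by rewrite /L /n -natrX -expnM mulnC expnM. Qed.
Let m2L : m2 * L%:R = M ^+ 2. Proof. by rewrite Ln -exprMn mn. Qed.
Let m_small : m <= (2 ^+ 29)^-1.
Proof.
rewrite /m ler_pdivrMr// /M mulrC ler_pdivlMr ?exprn_gt0// -exprD /n natrX.
by rewrite ler_eXn2l ?ltr1n.
Qed.
Let m2_small : m2 <= (2 ^+ 58)^-1.
Proof.
have -> : (2 ^+ 58)^-1 = ((2 ^+ 29)^-1) ^+ 2 :> R by rewrite exprVn -exprM.
by rewrite ler_pXn2r ?nnegrE ?(ltW m_gt0)// invr_ge0 exprn_ge0.
Qed.

Let count_norm N (a b c : R) : 0 < a -> 0 <= c ->
  a * (\sum_(i < N) (`|2 * a * i%:R - b| <= c)%R%:R) <= c + a.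
Proof.
move=> a0 c0; have a2 : 0 < 2 * a by lra.
have c2 : 0 <= 2 * c by lra.
have := @count_spread R N (fun i => `|2 * a * i%:R - b| <= c) _ _ a2 c2.
have H (i j : 'I_N) : `|2 * a * i%:R - b| <= c -> `|2 * a * j%:R - b| <= c ->
    2 * a * (j%:R - i%:R) <= 2 * c.
  by rewrite !ler_norml => /andP[? ?] /andP[? ?]; lra.
by move=> /(_ H); lra.
Qed.

Let box_sum (c d : R) : 0 <= c -> 0 <= d ->
  m * m * m2 * (\sum_(i < n) \sum_(j < n) \sum_(l < L) (box c d (gridpt i j l))%:R)
  <= (c + m) * ((c + m) * (d + m2)).
Proof.
move=> c0 d0.
have -> : \sum_(i < n) \sum_(j < n) \sum_(l < L) (box c d (gridpt i j l))%:R =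
  \sum_(i < n) \sum_(j < n) \sum_(l < L) (`|2 * m * i%:R - M| <= c)%R%:R *
  ((`|2 * m * j%:R - M| <= c)%R%:R * (`|2 * m2 * l%:R - M ^+ 2| <= d)%R%:R) :> R.
  apply: eq_bigr => i _; apply: eq_bigr => j _; apply: eq_bigr => l _.
  by rewrite /box /=; do 3 case: (_ <= _); rewrite ?mulr1 ?mulr0 ?mul0r.
rewrite sum3_prod.
have -> (x y z : R) : m * m * m2 * (x * (y * z)) = (m * x) * ((m * y) * (m2 * z)) by ring.
have s0 (a : R) N (P : pred 'I_N) : 0 < a -> 0 <= a * \sum_(i < N) (P i)%:R :> R.
  by move=> a0; rewrite mulr_ge0 ?(ltW a0)//; exact: sumr_ge0.
apply: ler_pM; [exact: s0|apply: mulr_ge0; exact: s0|exact: count_norm|].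
by apply: ler_pM; [exact: s0|exact: s0|exact: count_norm|exact: count_norm].
Qed.

Let gain_sum :
  2 ^+ 52 <= m * m * m2 *
    (\sum_(i < n) \sum_(j < n) \sum_(l < L) (gain (gridpt i j l))%:R).
Proof.
have -> : \sum_(i < n) \sum_(j < n) \sum_(l < L) (gain (gridpt i j l))%:R =
  \sum_(i < n) \sum_(j < n) \sum_(l < L)
  ((2 ^+ 14 <= 2 * m * i%:R - M) && (2 * m * i%:R - M <= 2 ^+ 15))%R%:R *
  ((`|2 * m * j%:R - M| <= 2 ^+ 14)%R%:R *
   (`|2 * m2 * l%:R - M ^+ 2| <= 2 ^+ 28)%R%:R) :> R.
  apply: eq_bigr => i _; apply: eq_bigr => j _; apply: eq_bigr => l _.
  by rewrite /gain /=; do 4 case: (_ <= _); rewrite ?mulr1 ?mulr0 ?mul0r.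
rewrite sum3_prod.
have -> (x y z : R) : m * m * m2 * (x * (y * z)) = (m * x) * ((m * y) * (m2 * z)) by ring.
have -> : (2 : R) ^+ 52 = 2 ^+ 12 * (2 ^+ 13 * 2 ^+ 27) by rewrite -!exprD.
have mM : m < M by move: m_small; rewrite /M => ?; lra.
apply: ler_pM; [exact: exprn_ge0|by rewrite mulr_ge0 ?exprn_ge0| |apply: ler_pM; try exact: exprn_ge0].
- have := @count_ge R n (fun i => (2 ^+ 14 <= 2 * m * i%:R - M) && (2 * m * i%:R - M <= 2 ^+ 15)%R)
    (2 * m) (- M) (2 ^+ 14) (2 ^+ 15).
  have H (i : 'I_n) : 2 ^+ 14 <= 2 * m * i%:R - M -> 2 * m * i%:R - M <= 2 ^+ 15 ->
    (2 ^+ 14 <= 2 * m * i%:R - M) && (2 * m * i%:R - M <= 2 ^+ 15)%R by move=> -> ->.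
  have X1 : - M <= 2 ^+ 14 by rewrite /M; lra.
  have X2 : 2 ^+ 15 < 2 * m * n%:R - M by rewrite -mulrA mn /M; lra.
  have X0 : 0 < 2 * m by rewrite mulr_gt0.
  by move=> /(_ X0 H X1 X2); move: m_small; lra.
- have := @count_ge R n (fun i => `|2 * m * i%:R - M| <= 2 ^+ 14)
    (2 * m) (- M) (- 2 ^+ 14) (2 ^+ 14).
  have H (i : 'I_n) : - 2 ^+ 14 <= 2 * m * i%:R - M -> 2 * m * i%:R - M <= 2 ^+ 14 ->
    `|2 * m * i%:R - M| <= 2 ^+ 14 by rewrite ler_norml => -> ->.
  have X1 : - M <= - 2 ^+ 14 by rewrite /M; lra.
  have X2 : 2 ^+ 14 < 2 * m * n%:R - M by rewrite -mulrA mn /M; lra.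
  have X0 : 0 < 2 * m by rewrite mulr_gt0.
  by move=> /(_ X0 H X1 X2); move: m_small; lra.
- have := @count_ge R L (fun i => `|2 * m2 * i%:R - M ^+ 2| <= 2 ^+ 28)
    (2 * m2) (- M ^+ 2) (- 2 ^+ 28) (2 ^+ 28).
  have H (i : 'I_L) : - 2 ^+ 28 <= 2 * m2 * i%:R - M ^+ 2 ->
      2 * m2 * i%:R - M ^+ 2 <= 2 ^+ 28 ->
    `|2 * m2 * i%:R - M ^+ 2| <= 2 ^+ 28 by rewrite ler_norml => -> ->.
  have X1 : - M ^+ 2 <= - 2 ^+ 28 by rewrite /M; lra.
  have X2 : 2 ^+ 28 < 2 * m2 * L%:R - M ^+ 2 by rewrite -mulrA m2L /M; lra.
  have X0 : 0 < 2 * m2 by rewrite mulr_gt0.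
  by move=> /(_ X0 H X1 X2); move: m2_small; lra.
Qed.

Let shell_sum :
  m * m * m2 * (\sum_(i < n) \sum_(j < n) \sum_(l < L) (shell (gridpt i j l))%:R)
  <= M ^+ 2 * (2 ^+ 32 * (2 ^+ 90)^-1 + 2 * m2).
Proof.
set c := (X in _ <= _ * X).
have c0 : 0 <= 2 ^+ 32 * (2 ^+ 90)^-1 :> R by lra.
have H (i j : 'I_n) : m2 * (\sum_(l < L) (shell (gridpt i j l))%:R) <= c.
  have X0 : 0 < 2 * m2 by rewrite mulr_gt0.
  pose z (l : 'I_L) := 2 * m2 * l%:R - M ^+ 2.
  have half (Q : pred R) : (forall u v, Q u -> Q v -> 0 <= u * v) ->
    2 * m2 * (\sum_(l < L) (shell (gridpt i j l) && Q (z l))%:R) <=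
      2 ^+ 32 * (2 ^+ 90)^-1 + 2 * m2.
    move=> hQ; apply: count_spread => // l l' /andP[s1 q1] /andP[s2 q2].
    have := shell_spread s1 s2 (hQ _ _ q1 q2).
    by rewrite ler_norml => /andP[? ?]; lra.
  have hp := half (fun t => 0 <= t) (fun u v => @mulr_ge0 _ u v).
  have hn := half (fun t => t <= 0) (fun u v => @mulr_le0 _ u v).
  have : \sum_(l < L) (shell (gridpt i j l))%:R <=
    \sum_(l < L) (shell (gridpt i j l) && (0 <= z l))%:R +
    \sum_(l < L) (shell (gridpt i j l) && (z l <= 0))%:R :> R.
    rewrite -big_split /=; apply: ler_sum => l _.
    case: (shell _) => /=; last by rewrite addr0.
    have [z0|z0] := ltP 0 (z l); first by rewrite (ltW z0) addr0.
    by rewrite lerDr.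
  rewrite -(ler_pM2l m2_gt0); rewrite /c; lra.
apply: (@le_trans _ _ (\sum_(i < n) \sum_(j < n) (m * m * c))).
  rewrite mulr_sumr; apply: ler_sum => i _; rewrite mulr_sumr.
  by apply: ler_sum => j _; rewrite -[leLHS]mulrA ler_wpM2l// mulr_ge0// ltW.
have E (a b : R) N : a * a * b *+ N *+ N = (a * N%:R) ^+ 2 * b.
  transitivity (a * a * b * N%:R * N%:R); first by rewrite !mulr_natr.
  by ring.
by rewrite !sumr_const !card_ord E mn lexx.
Qed.

(** The boxes and the gain region are products of intervals, and the shell meets
    each vertical line in two short segments at most: the grid points of each region
    are counted one coordinate at a time. *)
Theorem btwist_average :
  \sum_(i < n) \sum_(j < n) \sum_(l < L) `|hjac btwist (gridpt i j l)|
  <= (1 - (2 ^+ 26)^-1) * 16%:R ^+ k.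
Proof.
have mm : 0 < m * m * m2 by exact: mulr_gt0 (mulr_gt0 m_gt0 m_gt0) m2_gt0.
set S := \sum_(i < n) _.
have tot : m * m * m2 * 16%:R ^+ k = 2 ^+ 76.
  have -> : 16%:R ^+ k = n%:R * n%:R * L%:R :> R.
    by rewrite -!natrM /n /L -!expnMn natrX.
  have -> : m * m * m2 * (n%:R * n%:R * L%:R) = (m * n%:R) * (m * n%:R) * (m2 * L%:R) by ring.
  by rewrite mn m2L /M -exprM -!exprD.
have P : S + 2^-1 * (\sum_(i < n) \sum_(j < n) \sum_(l < L) (gain (gridpt i j l))%:R) <=
  16%:R ^+ k +
  2 ^+ 64 * (\sum_(i < n) \sum_(j < n) \sum_(l < L) (box (2 ^+ 7)^-1 (2 ^+ 11)^-1 (gridpt i j l))%:R) +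
  2 ^+ 32 * (\sum_(i < n) \sum_(j < n) \sum_(l < L) (box 2 32 (gridpt i j l))%:R) +
  2 ^+ 64 * (\sum_(i < n) \sum_(j < n) \sum_(l < L) (shell (gridpt i j l))%:R).
  have -> : 16%:R ^+ k = \sum_(i < n) \sum_(j < n) \sum_(l < L) 1 :> R.
    by rewrite !sumr_const !card_ord -!mulrnA -!expnMn natrX.
  rewrite !mulr_sumr -!big_split; apply: ler_sum => i _.
  rewrite !mulr_sumr -!big_split; apply: ler_sum => j _.
  rewrite !mulr_sumr -!big_split; apply: ler_sum => l _.
  exact: btwist_ptwise.
have c7 : 0 <= (2 ^+ 7)^-1 :> R by lra.
have c11 : 0 <= (2 ^+ 11)^-1 :> R by lra.
have B1 := box_sum c7 c11.
have B2 := box_sum (ler0n R 2) (ler0n R 32).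
have G := gain_sum; have Sh := shell_sum.
rewrite -(ler_pM2l mm) in P; rewrite -(ler_pM2l mm) [leRHS]mulrCA tot.
move: P; rewrite !mulrDr tot => P.
exact: average_arith m_gt0 m_small m2_gt0 m2_small P B1 B2 Sh G.
Qed.

End block_average.

(** * Dilations and translations *)

Section dilations.
Context {R : realType}.
Implicit Types (p q w g : heis R) (r : R).

Lemma derive_heis (f : heis R -> heis R) p w d1 d2 d3 : differentiable f p ->
  hasD (fun q => (f q).1.1) p w d1 -> hasD (fun q => (f q).1.2) p w d2 ->
  hasD (fun q => (f q).2) p w d3 -> 'D_w f p = (d1, d2, d3).
Proof.
move=> df [_ <-] [_ <-] [_ <-]; have dff := diff_fst df.
rewrite (derive_fst w dff) (derive_fst w df) (derive_snd w dff) (derive_fst w df).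
by rewrite (derive_snd w df); case: ('D_w f p) => [[]].
Qed.

Definition dil (r : R) p : heis R := (r * p.1.1, r * p.1.2, r ^+ 2 * p.2).

Lemma dilK r p : r != 0 -> dil r^-1 (dil r p) = p.
Proof.
by move=> r0; case: p => [[x y] z]; congr (_, _, _) => /=; field.
Qed.

Lemma dilVK r p : r != 0 -> dil r (dil r^-1 p) = p.
Proof. by move=> r0; rewrite -{1}[r]invrK dilK// invr_eq0. Qed.

Let Cx k : Ck k setT (fun p : heis R => p.1.1).
Proof. by have [] := Ck_coord k (@openT (heis R)). Qed.
Let Cy k : Ck k setT (fun p : heis R => p.1.2).
Proof. by have [] := Ck_coord k (@openT (heis R)). Qed.
Let Cz k : Ck k setT (fun p : heis R => p.2).
Proof. by have [] := Ck_coord k (@openT (heis R)). Qed.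

Lemma smooth_dil r : smooth setT (dil r).
Proof.
have oT : open [set: heis R] by exact: openT.
by move=> k; apply: Ck_heis => //=; apply: Ck_mul => //; exact: Ck_cst.
Qed.

Lemma smooth_ltrans g : smooth setT (hmul g).
Proof.
have oT : open [set: heis R] by exact: openT.
have cst k (c : R) : Ck k setT (fun _ : heis R => c) by exact: Ck_cst.
move=> k; apply: Ck_heis => //=; try exact: Ck_add.
apply: Ck_add => //; first exact: Ck_add.
apply: Ck_mul => //; apply: Ck_add => //; first exact: Ck_mul.
by apply: Ck_opp => //; exact: Ck_mul.
Qed.

Lemma derive_dil r p w : 'D_w (dil r) p = dil r w.
Proof.
have [hx hy hz] := hasD_coord p w.
have H (c : R) f d : hasD f p w d -> hasD (fun q : heis R => c * f q) p w (c * d).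
  move=> hf; apply: hasD_eq (hasD_mul (hasD_cst c p w) hf) _.
  by rewrite mulr0 addr0.
exact: derive_heis (smooth_diff p (smooth_dil r)) (H _ _ _ hx) (H _ _ _ hy) (H _ _ _ hz).
Qed.

Lemma derive_ltrans g p w : 'D_w (hmul g) p =
  (w.1.1, w.1.2, w.2 + 2^-1 * (g.1.1 * w.1.2 - w.1.1 * g.1.2)).
Proof.
have [hx hy hz] := hasD_coord p w.
apply: derive_heis (smooth_diff p (smooth_ltrans g)) _ _ _ => /=.
- by apply: hasD_eq (hasD_add (hasD_cst _ _ _) hx) _; rewrite add0r.
- by apply: hasD_eq (hasD_add (hasD_cst _ _ _) hy) _; rewrite add0r.
- apply: hasD_eq (hasD_add (hasD_add (hasD_cst _ _ _) hz) (hasD_mul (hasD_cst _ _ _)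
    (hasD_add (hasD_mul (hasD_cst _ _ _) hy) (hasD_opp (hasD_mul hx (hasD_cst _ _ _)))))) _.
  by ring.
Qed.

Lemma contact_dil r : contact (dil r).
Proof.
split; first exact: smooth_dil.
move=> p w /horizontalP h; apply/horizontalP; rewrite derive_dil /theta /=.
transitivity (r ^+ 2 * theta p w); first by rewrite /theta; ring.
by rewrite h mulr0.
Qed.

Lemma contact_ltrans g : contact (hmul g).
Proof.
split; first exact: smooth_ltrans.
move=> p w /horizontalP h; apply/horizontalP; rewrite derive_ltrans.
by rewrite -h /theta /=; ring.
Qed.

Lemma hjac_dil r p : hjac (dil r) p = r ^+ 2.
Proof. by rewrite /hjac !derive_dil /hX /hY /=; ring. Qed.

Lemma hjac_ltrans g p : hjac (hmul g) p = 1.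
Proof. by rewrite /hjac !derive_ltrans /hX /hY /=; ring. Qed.

Lemma hmulKV g p : hmul (hinv g) (hmul g p) = p.
Proof.
by case: g p => [[a b] c] [[x y] z]; rewrite /hmul /hinv /=; congr (_, _, _); ring.
Qed.

Lemma hmulVK g p : hmul g (hmul (hinv g) p) = p.
Proof.
by case: g p => [[a b] c] [[x y] z]; rewrite /hmul /hinv /=; congr (_, _, _); ring.
Qed.

Definition transport g (r : R) (f : heis R -> heis R) : heis R -> heis R :=
  hmul g \o (dil r \o (f \o (dil r^-1 \o hmul (hinv g)))).

Lemma contact_transport g r f : contact f -> contact (transport g r f).
Proof.
move=> cf; have c1 := contact_comp (contact_ltrans (hinv g)) (contact_dil r^-1).
have c2 := contact_comp (contact_comp c1 cf) (contact_dil r).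
exact: (contact_comp c2 (contact_ltrans g)).
Qed.

Lemma hjac_transport g r f p : r != 0 -> contact f ->
  hjac (transport g r f) p = hjac f (dil r^-1 (hmul (hinv g) p)).
Proof.
move=> r0 cf; have c1 := contact_ltrans (hinv g); have c2 := contact_dil r^-1.
have c12 := contact_comp c1 c2; have c3 := contact_comp c12 cf.
have c4 := contact_comp c3 (contact_dil r).
rewrite /transport (hjac_comp p c4 (contact_ltrans g)) hjac_ltrans mul1r.
rewrite (hjac_comp p c3 (contact_dil r)) hjac_dil.
rewrite (hjac_comp p c12 cf) (hjac_comp p c1 c2) hjac_ltrans hjac_dil mulr1.
by rewrite mulrCA -exprMn divff// expr1n mulr1.
Qed.

Lemma transportK g r f f' : r != 0 -> cancel f f' ->
  cancel (transport g r f) (transport g r f').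
Proof.
by move=> r0 ff' p; rewrite /transport /= hmulKV dilK// ff' dilVK// hmulVK.
Qed.

Lemma loc_transport g r f p : r != 0 ->
  dil r^-1 (hmul (hinv g) (transport g r f p)) = f (dil r^-1 (hmul (hinv g) p)).
Proof. by move=> r0; rewrite /transport /= hmulKV dilK. Qed.

Lemma transport_fix g r f p : r != 0 ->
  f (dil r^-1 (hmul (hinv g) p)) = dil r^-1 (hmul (hinv g) p) ->
  transport g r f p = p.
Proof. by move=> r0 e; rewrite /transport /= e dilVK// hmulVK. Qed.

End dilations.

(** * The twist in the unit tile *)

Section blocks.
Context {R : realType}.
Implicit Types p q : heis R.

Let M : R := 2 ^+ 19.
Let M0 : M != 0. Proof. by rewrite expf_neq0// pnatr_eq0. Qed.
Let MV : M^-1 != 0. Proof. by rewrite invr_eq0 M0. Qed.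

(** The twist shrunk into the unit tile. *)
Definition block : heis R -> heis R := transport (hone R) M^-1 btwist.
Definition blockV : heis R -> heis R := transport (hone R) M^-1 btwistV.

(** Half-open, so that the translates by the lattice partition the group. *)
Definition utile p : bool :=
  [&& -1 <= p.1.1 < 1, -1 <= p.1.2 < 1 & -1 <= p.2 < 1].

Let hmul1 p : hmul (hinv (hone R)) p = p.
Proof.
by case: p => [[x y] z]; rewrite /hmul /hinv /=; congr (_, _, _); ring.
Qed.

Lemma contact_block : contact block.
Proof. by apply: contact_transport; exact: contact_btwist. Qed.

Lemma contact_blockV : contact blockV.
Proof. by apply: contact_transport; exact: contact_btwistV. Qed.

Lemma blockK : cancel block blockV.
Proof. exact: transportK MV btwistK. Qed.

Lemma blockVK : cancel blockV block.
Proof. exact: transportK MV btwistVK. Qed.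

Lemma hjac_block p : hjac block p = hjac btwist (dil M p).
Proof.
by rewrite (hjac_transport (hone R) p MV contact_btwist) hmul1 invrK.
Qed.

(** The support of the twist lies in the tile of size [M = 2^19], since there
    [s <= 2^32] and [|z| <= 2^5 s]. *)
Lemma block_out p : ~~ utile p -> block p = p /\ hjac block p = 1.
Proof.
move=> up; suff [b1 b2] : btwist (dil M p) = dil M p /\ hjac btwist (dil M p) = 1.
  split; last by rewrite hjac_block.
  by apply: (transport_fix MV); rewrite hmul1 invrK.
have [s0|s0] := leP (halfsq (dil M p)) 0; first exact: btwist_axis.
have [tT|tT] := leP (cht (dil M p)) ((32 * ln 2) ^+ 2); last exact: btwist_out.
have [su _ zs _] := btwist_support s0 tT; case/negP: up.
have M2 : M ^+ 2 = 2 ^+ 38 by rewrite -exprM.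
have xy : 2^-1 * (2 ^+ 38 * (p.1.1 ^+ 2 + p.1.2 ^+ 2)) <= 2 ^+ 32.
  by apply: le_trans su; rewrite -M2 /halfsq /dil /= le_eqVlt; apply/orP; left;
    apply/eqP; ring.
have z1 : `|p.2| <= 2^-1.
  have : 2 ^+ 38 * `|p.2| <= 32 * 2 ^+ 32.
    rewrite -M2 -[M ^+ 2]ger0_norm ?sqr_ge0// -normrM.
    by apply: le_trans zs _; rewrite ler_pM2l.
  lra.
have X2 := sqr_ge0 p.1.1; have Y2 := sqr_ge0 p.1.2.
have h0 : 0 <= 2^-1 :> R by lra.
have x1 : `|p.1.1| <= 2^-1 by apply: norm_le_sqr => //; lra.
have y1 : `|p.1.2| <= 2^-1 by apply: norm_le_sqr => //; lra.
move: x1 y1 z1; rewrite !ler_norml /utile => /andP[? ?] /andP[? ?] /andP[? ?].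
by apply/and3P; split; apply/andP; split; lra.
Qed.

Lemma block_utile p : utile p -> utile (block p).
Proof.
move=> up; apply/negP => /negP nb; have [e _] := block_out nb.
have e' : block p = p by exact: (can_inj blockK).
by move: nb; rewrite e' up.
Qed.

Lemma hjac_block_le p : `|hjac block p| <= 2 ^+ 64.
Proof.
rewrite hjac_block; set q := dil M p.
have one : `|1| <= 2 ^+ 64 :> R by rewrite normr1; lra.
have [s0|s0] := leP (halfsq q) 0; first by have [_ ->] := btwist_axis s0.
have [tT|tT] := leP (cht q) ((32 * ln 2) ^+ 2); last by have [_ ->] := btwist_out tT.
by have [] := btwist_support s0 tT.
Qed.

(** The grid points of the unit tile, which are also the positions of the
    subtiles of size [2^-k]. *)
Definition digit k (i j l : nat) : heis R :=
  (2 * i%:R / (2 ^ k)%:R - 1, 2 * j%:R / (2 ^ k)%:R - 1, 2 * l%:R / (4 ^ k)%:R - 1).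

Lemma block_average k : (48 <= k)%N ->
  \sum_(i < 2 ^ k) \sum_(j < 2 ^ k) \sum_(l < 4 ^ k) `|hjac block (digit k i j l)|
  <= (1 - (2 ^+ 26)^-1) * 16%:R ^+ k.
Proof.
move=> k48; apply: le_trans (@btwist_average R k k48).
apply: ler_sum => i _; apply: ler_sum => j _; apply: ler_sum => l _.
rewrite hjac_block le_eqVlt; apply/orP; left; apply/eqP; congr (`|hjac _ _|).
have n0 : (2 ^ k)%:R != 0 :> R by rewrite pnatr_eq0 expn_eq0.
have e4 : (4 ^ k)%:R = (2 ^ k)%:R ^+ 2 :> R.
  by rewrite -natrX -expnM mulnC expnM.
rewrite /dil /gridpt /digit e4 -/M; congr (_, _, _) => /=; by field.
Qed.

End blocks.

(** * The lattice of tiles *)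

Section lattice.
Context {R : realType}.
Implicit Types (p q : heis R) (h : R).

Notation latt := (int * int * int)%type.
Implicit Types u v t : latt.

(** The factor [2] in every coordinate makes the lattice a subgroup with integral
    multiplication law [lmul] and with the unit tile as a fundamental domain. *)
Definition lat h u : heis R :=
  (2 * h * u.1.1%:~R, 2 * h * u.1.2%:~R, 2 * h ^+ 2 * u.2%:~R).
Definition lmul u v : latt :=
  (u.1.1 + v.1.1, u.1.2 + v.1.2, u.2 + v.2 + (u.1.1 * v.1.2 - v.1.1 * u.1.2)).
Definition linv u : latt := (- u.1.1, - u.1.2, - u.2).
(** The position of [p] relative to the tile of index [u] and size [h]: that tile
    contains [p] when [utile (loc h u p)]. *)
Definition loc h u p : heis R := dil h^-1 (hmul (hinv (lat h u)) p).

Lemma lat_mul h u v : hmul (lat h u) (lat h v) = lat h (lmul u v).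
Proof.
by rewrite /hmul /lat /lmul /=; congr (_, _, _);
  rewrite !(rmorphD, rmorphN, rmorphM) /=; field.
Qed.

Lemma lmulKV u v : lmul u (lmul (linv u) v) = v.
Proof.
by case: u v => [[a b] c] [[x y] z]; rewrite /lmul /linv /=; congr (_, _, _); ring.
Qed.

Lemma lmulK u v : lmul (linv u) (lmul u v) = v.
Proof.
by case: u v => [[a b] c] [[x y] z]; rewrite /lmul /linv /=; congr (_, _, _); ring.
Qed.

Lemma locE h u p : h != 0 -> loc h u p =
  (p.1.1 / h - 2 * u.1.1%:~R, p.1.2 / h - 2 * u.1.2%:~R,
   p.2 / h ^+ 2 - 2 * u.2%:~R +
   (u.1.2%:~R * (p.1.1 / h) - u.1.1%:~R * (p.1.2 / h))).
Proof.
by move=> h0; rewrite /loc /dil /hmul /hinv /lat /=; congr (_, _, _); field.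
Qed.

Lemma int_eq_of_close (a b : int) (X : R) :
  -1 <= X - 2 * a%:~R < 1 -> -1 <= X - 2 * b%:~R < 1 -> a = b.
Proof.
move=> /andP[a1 a2] /andP[b1 b2].
have [ab|ba|//] := ltgtP a b; exfalso.
  have : (a + 1)%:~R <= b%:~R :> R by rewrite ler_int lezD1.
  by rewrite rmorphD rmorph1; lra.
have : (b + 1)%:~R <= a%:~R :> R by rewrite ler_int lezD1.
by rewrite rmorphD rmorph1; lra.
Qed.

Lemma int_close (X : R) : exists a : int, -1 <= X - 2 * a%:~R < 1.
Proof.
exists (Num.floor ((X + 1) / 2)).
have := floor_itv ((X + 1) / 2); rewrite rmorphD rmorph1 => /andP[? ?].
by apply/andP; split; lra.
Qed.

Lemma loc_inj h u v p : h != 0 -> utile (loc h u p) -> utile (loc h v p) -> u = v.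
Proof.
move=> h0; rewrite !locE// /utile /=; case: u v => [[a b] c] [[a' b'] c'] /=.
move=> /and3P[xa yb zc] /and3P[xa' yb' zc'].
have ea : a = a' := int_eq_of_close xa xa'; subst a'.
have eb : b = b' := int_eq_of_close yb yb'; subst b'.
rewrite addrAC in zc; rewrite addrAC in zc'.
by congr (_, _, _); exact: int_eq_of_close zc zc'.
Qed.

(** The tiles cover: the vertical index is chosen last, since a translation shears
    the vertical coordinate. *)
Lemma loc_ex h p : h != 0 -> exists u, utile (loc h u p).
Proof.
move=> h0; have [a xa] := int_close (p.1.1 / h).
have [b yb] := int_close (p.1.2 / h).
have [c zc] := int_close (p.2 / h ^+ 2 +
   (b%:~R * (p.1.1 / h) - a%:~R * (p.1.2 / h))).
by exists (a, b, c); rewrite locE//; apply/and3P; split => //=; rewrite addrAC.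
Qed.

Lemma loc_lat h u q : h != 0 -> loc h u (hmul (lat h u) (dil h q)) = q.
Proof. by move=> h0; rewrite /loc hmulKV dilK. Qed.

Lemma lat_loc h u p : h != 0 -> hmul (lat h u) (dil h (loc h u p)) = p.
Proof. by move=> h0; rewrite /loc dilVK// hmulVK. Qed.

(** * Refinement of the lattice *)

(** The index in the lattice of size [h / 2^k] of the lattice point [lat h u]. *)
Definition scaleZ k u : latt :=
  ((2 ^ k)%:Z * u.1.1, (2 ^ k)%:Z * u.1.2, (4 ^ k)%:Z * u.2).
(** The indices of the points [digit k i j l], for [0 < k]. *)
Definition dg k (i j l : nat) : latt :=
  (i%:Z - (2 ^ k.-1)%:Z, j%:Z - (2 ^ k.-1)%:Z, l%:Z - (2 * 4 ^ k.-1)%:Z).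
Definition digits k : seq latt :=
  [seq dg k ij.1 ij.2 l | ij <- [seq (i, j) | i <- iota 0 (2 ^ k), j <- iota 0 (2 ^ k)],
     l <- iota 0 (4 ^ k)].
Definition refine k (P : seq latt) : seq latt :=
  [seq lmul (scaleZ k u) t | u <- P, t <- digits k].

Let n0 k : (2 ^ k)%:R != 0 :> R. Proof. by rewrite pnatr_eq0 expn_eq0. Qed.
Let e4 k : (4 ^ k)%:R = (2 ^ k)%:R ^+ 2 :> R.
Proof. by rewrite -natrX -expnM mulnC expnM. Qed.

Lemma lat_scaleZ h k u : lat (h / (2 ^ k)%:R) (scaleZ k u) = lat h u.
Proof.
have k0 := n0 k.
by rewrite /lat /scaleZ /=; congr (_, _, _);
  rewrite rmorphM /= -pmulrn ?e4; field.
Qed.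

Lemma lat_dg h k i j l : (0 < k)%N ->
  lat (h / (2 ^ k)%:R) (dg k i j l) = dil h (digit k i j l).
Proof.
case: k => // k _; have k0 := n0 k; have k1 := n0 k.+1.
have S2 : (2 ^ k.+1)%:R = 2 * (2 ^ k)%:R :> R by rewrite expnS natrM.
have S4 : (2 * 4 ^ k)%:R = 2 * (2 ^ k)%:R ^+ 2 :> R by rewrite natrM e4.
rewrite /lat /dg /dil /digit /=; congr (_, _, _);
  rewrite rmorphB /= -!pmulrn ?e4 ?S4 S2; field => //.
Qed.

Lemma lat_refine h k u i j l : (0 < k)%N ->
  lat (h / (2 ^ k)%:R) (lmul (scaleZ k u) (dg k i j l)) =
  hmul (lat h u) (dil h (digit k i j l)).
Proof. by move=> k0; rewrite -lat_mul lat_scaleZ lat_dg. Qed.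

Lemma utile_digit k i j l : (i < 2 ^ k)%N -> (j < 2 ^ k)%N -> (l < 4 ^ k)%N ->
  utile (digit k i j l : heis R).
Proof.
have E (x : R) : 0 <= x -> x < 1 -> -1 <= 2 * x - 1 < 1.
  by move=> ? ?; apply/andP; split; lra.
have H (m n : nat) : (m < n)%N -> -1 <= (2 * m%:R / n%:R - 1 : R) < 1.
  move=> mn; have n1 : 0 < n%:R :> R by rewrite ltr0n (leq_ltn_trans _ mn).
  have h1 : m%:R / n%:R < (1 : R) by rewrite ltr_pdivrMr// mul1r ltr_nat.
  have h0 : (0 : R) <= m%:R / n%:R by rewrite divr_ge0.
  by rewrite -mulrA; exact: E.
by move=> hi hj hl; apply/and3P; split; exact: H.
Qed.

Lemma digitsP k t : reflect
  (exists i j l, [/\ (i < 2 ^ k)%N, (j < 2 ^ k)%N, (l < 4 ^ k)%N & t = dg k i j l])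
  (t \in digits k).
Proof.
apply: (iffP allpairsP) => [[[[i j] l] /=]|[i [j [l [hi hj hl ->]]]]].
  move=> [/allpairsP[[i' j'] /= [hi hj [-> ->]]] hl ->]; exists i', j', l.
  by move: hi hj hl; rewrite !mem_iota !add0n.
exists ((i, j), l); split; rewrite ?mem_iota//.
by apply/allpairsP; exists (i, j); split; rewrite ?mem_iota.
Qed.

Lemma digits_inj k i j l i' j' l' : dg k i j l = dg k i' j' l' ->
  [/\ i = i', j = j' & l = l'].
Proof. by move=> [/addIr[->] /addIr[->] /addIr[->]]. Qed.

Lemma uniq_digits k : uniq (digits k).
Proof.
apply: allpairs_uniq; [|exact: iota_uniq|].
  by apply: allpairs_uniq; [exact: iota_uniq..|move=> [? ?] [? ?]].
by move=> [[i j] l] [[i' j'] l'] _ _ /= /digits_inj[-> -> ->].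
Qed.

Lemma size_digits k : size (digits k) = (16 ^ k)%N.
Proof. by rewrite !size_allpairs !size_iota -!expnMn. Qed.

Lemma sum_digits k (F : latt -> R) : \sum_(t <- digits k) F t =
  \sum_(i < 2 ^ k) \sum_(j < 2 ^ k) \sum_(l < 4 ^ k) F (dg k i j l).
Proof.
have H n (G : nat -> R) : \sum_(i <- iota 0 n) G i = \sum_(i < n) G i.
  by rewrite -(big_mkord xpredT) /index_iota subn0.
rewrite big_allpairs_dep big_allpairs_dep /= H; apply: eq_bigr => i _.
by rewrite H; apply: eq_bigr => j _; rewrite H.
Qed.

Lemma refine_inj h k u t u' t' : h != 0 -> (0 < k)%N ->
  t \in digits k -> t' \in digits k ->
  lmul (scaleZ k u) t = lmul (scaleZ k u') t' -> u = u' /\ t = t'.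
Proof.
move=> h0 k0 /digitsP[i [j [l [hi hj hl ->]]]] /digitsP[i' [j' [l' [hi' hj' hl' ->]]]] e.
have uu : u = u'.
  apply: (@loc_inj h _ _ (hmul (lat h u) (dil h (digit k i j l)))) => //.
    by rewrite loc_lat//; exact: utile_digit.
  by rewrite -lat_refine// e lat_refine// loc_lat//; exact: utile_digit.
by split=> //; rewrite -(lmulK (scaleZ k u) (dg k i j l)) e uu lmulK.
Qed.

Lemma uniq_refine k P : (0 < k)%N -> uniq P -> uniq (refine k P).
Proof.
move=> k0 uP; apply: allpairs_uniq => //; first exact: uniq_digits.
move=> [u t] [u' t'] /allpairsP[[a b] /= [_ bd [-> ->]]]
  /allpairsP[[a' b'] /= [_ bd' [-> ->]]] e.
by have [-> ->] := refine_inj (oner_neq0 R) k0 bd bd' e.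
Qed.

Lemma size_refine k P : size (refine k P) = (size P * 16 ^ k)%N.
Proof. by rewrite size_allpairs size_digits. Qed.

Lemma sum_refine k P (F : latt -> R) : \sum_(v <- refine k P) F v =
  \sum_(u <- P) \sum_(t <- digits k) F (lmul (scaleZ k u) t).
Proof. by rewrite big_allpairs_dep. Qed.

(** Converse of [lat_refine], used to recognize the tiles of a fine cover among the
    refined ones. *)
Lemma refine_mem h k u v P : h != 0 -> (0 < k)%N -> u \in P ->
  utile (loc h u (lat (h / (2 ^ k)%:R) v)) -> v \in refine k P.
Proof.
move=> h0 k0 uP; set t := lmul (linv (scaleZ k u)) v.
have -> : v = lmul (scaleZ k u) t by rewrite lmulKV.
rewrite -lat_mul lat_scaleZ => ut; apply/allpairsP; exists (u, t); split => //=.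
have : utile (dil h^-1 (lat (h / (2 ^ k)%:R) t)) by move: ut; rewrite /loc hmulKV.
case: k k0 t {ut} => // k _ [[a b] c].
have n1 := n0 k.+1; have n2 := n0 k.
have S2 : (2 ^ k.+1)%:R = 2 * (2 ^ k)%:R :> R by rewrite expnS natrM.
have H (x : int) (N : nat) : (0 < N)%N -> -1 <= (x%:~R / N%:R : R) < 1 ->
    exists2 i : nat, (i < 2 * N)%N & x = i%:Z - N%:Z.
  move=> N0; have N1 : 0 < N%:R :> R by rewrite ltr0n.
  rewrite ler_pdivlMr// ltr_pdivrMr// mulN1r mul1r.
  have -> : - N%:R = (- N%:Z)%:~R :> R by rewrite rmorphN.
  have -> : N%:R = (N%:Z)%:~R :> R by [].
  rewrite ler_int ltr_int => /andP[x1 x2]; exists (absz (x + N%:Z)%R); lia.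
have P2 m : (0 < 2 ^ m)%N by rewrite expn_gt0.
have P4 m : (0 < 2 * 4 ^ m)%N by rewrite muln_gt0 expn_gt0.
rewrite /dil /lat /utile /= => /and3P[ha hb hc].
have E1 (x : int) : h^-1 * (2 * (h / (2 ^ k.+1)%:R) * x%:~R) = x%:~R / (2 ^ k)%:R.
  by rewrite S2; field; apply/andP.
have E2 (x : int) : h^-1 ^+ 2 * (2 * (h / (2 ^ k.+1)%:R) ^+ 2 * x%:~R) =
    x%:~R / (2 * 4 ^ k)%:R.
  by rewrite S2 natrM e4; field; apply/andP.
rewrite E1 in ha; rewrite E1 in hb; rewrite E2 in hc.
have [i hi ->] := H a _ (P2 k) ha; have [j hj ->] := H b _ (P2 k) hb.
have [l hl ->] := H c _ (P4 k) hc.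
by apply/digitsP; exists i, j, l; split; rewrite // expnS // -?mulnA; lia.
Qed.

End lattice.

(** * Simultaneous twists in a family of tiles *)

Section tile_maps.
Context {R : realType}.
Variable h : R.
Hypothesis h0 : h != 0.
Implicit Types (p q : heis R) (u v : int * int * int) (P : seq (int * int * int)).

Definition tile_map u : heis R -> heis R := transport (lat h u) h block.
Definition tile_mapV u : heis R -> heis R := transport (lat h u) h blockV.
Definition sigma P : heis R -> heis R := foldr (fun u f => tile_map u \o f) id P.
Definition sigmaV P : heis R -> heis R := foldr (fun u f => f \o tile_mapV u) id P.

Lemma contact_tile_map u : contact (tile_map u).
Proof. exact: contact_transport contact_block. Qed.

Lemma contact_tile_mapV u : contact (tile_mapV u).
Proof. exact: contact_transport contact_blockV. Qed.

Lemma contact_sigma P : contact (sigma P).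
Proof.
elim: P => [|u P IH]; first exact: contact_id.
exact: contact_comp IH (contact_tile_map u).
Qed.

Lemma contact_sigmaV P : contact (sigmaV P).
Proof.
elim: P => [|u P IH]; first exact: contact_id.
exact: contact_comp (contact_tile_mapV u) IH.
Qed.

Lemma sigma_cons u P p : sigma (u :: P) p = tile_map u (sigma P p).
Proof. reflexivity. Qed.

Lemma sigmaV_cons u P p : sigmaV (u :: P) p = sigmaV P (tile_mapV u p).
Proof. reflexivity. Qed.

Lemma tile_mapK u : cancel (tile_map u) (tile_mapV u).
Proof. exact: (transportK _ h0 blockK). Qed.

Lemma tile_mapVK u : cancel (tile_mapV u) (tile_map u).
Proof. exact: (transportK _ h0 blockVK). Qed.

Lemma sigmaK P : cancel (sigma P) (sigmaV P).
Proof.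
elim: P => [|u P IH] p; first by [].
by rewrite sigma_cons sigmaV_cons tile_mapK IH.
Qed.

Lemma sigmaVK P : cancel (sigmaV P) (sigma P).
Proof.
elim: P => [|u P IH] p; first by [].
by rewrite sigma_cons sigmaV_cons IH tile_mapVK.
Qed.

Lemma tile_map_out u p : ~~ utile (loc h u p) ->
  tile_map u p = p /\ hjac (tile_map u) p = 1.
Proof.
move=> /block_out [b1 b2]; split; first exact: (transport_fix h0 b1).
by rewrite (hjac_transport _ _ h0 contact_block).
Qed.

Lemma sigma_out P p : {in P, forall u, ~~ utile (loc h u p)} ->
  sigma P p = p /\ hjac (sigma P) p = 1.
Proof.
elim: P => [|u P IH] out; first by split=> //; exact: hjac_id.
have [s1 s2] : sigma P p = p /\ hjac (sigma P) p = 1.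
  by apply: IH => v vP; apply: out; rewrite inE vP orbT.
have [t1 t2] := tile_map_out (out u (mem_head _ _)).
split; first by rewrite sigma_cons s1.
rewrite -[sigma (u :: P)]/(tile_map u \o sigma P).
by rewrite (hjac_comp p (contact_sigma P) (contact_tile_map u)) s1 s2 t2 mulr1.
Qed.

Lemma loc_tile_map u p : loc h u (tile_map u p) = block (loc h u p).
Proof. exact: loc_transport. Qed.

(** The tile maps have disjoint supports and preserve their tiles, so at a point of
    the tile of [u] only the factor of index [u] acts. *)
Lemma sigma_in P u p : uniq P -> u \in P -> utile (loc h u p) ->
  sigma P p = tile_map u p /\ hjac (sigma P) p = hjac block (loc h u p).
Proof.
elim: P => [|v P IH]; first by rewrite in_nil.
rewrite cons_uniq => /andP[vP uP] uvP up.
rewrite sigma_cons -[sigma (v :: P)]/(tile_map v \o sigma P).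
rewrite (hjac_comp p (contact_sigma P) (contact_tile_map v)).
have [uv|uv] := eqVneq u v.
  subst v; have [-> ->] : sigma P p = p /\ hjac (sigma P) p = 1.
    apply: sigma_out => w wP; apply/negP => wp.
    by move: vP; rewrite (loc_inj h0 up wp) wP.
  by split=> //; rewrite mulr1 (hjac_transport _ _ h0 contact_block).
have {}uvP : u \in P by move: uvP; rewrite inE (negPf uv).
have [-> ->] := IH uP uvP up.
have up' : utile (loc h u (tile_map u p)) by rewrite loc_tile_map block_utile.
have /tile_map_out [-> ->] : ~~ utile (loc h v (tile_map u p)).
  by apply/negP => /(loc_inj h0 up') /eqP; rewrite (negPf uv).
by rewrite mul1r.
Qed.

Lemma sigma_cases P p : uniq P ->
  (sigma P p = p /\ hjac (sigma P) p = 1) \/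
  (exists u, [/\ u \in P, utile (loc h u p), utile (loc h u (sigma P p)) &
     hjac (sigma P) p = hjac block (loc h u p)]).
Proof.
move=> uP; have [u up] := loc_ex p h0.
have [uinP|unP] := boolP (u \in P); [right|left].
  have [e1 e2] := sigma_in uP uinP up; exists u.
  split; [exact: uinP|exact: up| |exact: e2].
  by rewrite e1 loc_tile_map; exact: block_utile.
apply: sigma_out => v vP; apply/negP => /(loc_inj h0 up) uv.
by move: unP; rewrite uv vP.
Qed.

Lemma hjac_sigma_le P p : uniq P -> `|hjac (sigma P) p| <= 2 ^+ 64.
Proof.
move=> uP; have [[_ ->]|[u [_ _ _ ->]]] := sigma_cases p uP.
  by rewrite normr1; lra.
exact: hjac_block_le.
Qed.

End tile_maps.

(** * The gauge *)

Section gauge.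
Context {R : realType}.
Implicit Types (p q : heis R) (h : R).

(** The fourth power of the Koranyi norm, a polynomial. *)
Definition N4 p : R := (p.1.1 ^+ 2 + p.1.2 ^+ 2) ^+ 2 + 16 * p.2 ^+ 2.

(** Closeness in Euclidean coordinates, for which smooth functions are uniformly
    continuous on bounded sets. *)
Definition near_pt (d : R) p q : Prop :=
  [/\ `|p.1.1 - q.1.1| <= d, `|p.1.2 - q.1.2| <= d & `|p.2 - q.2| <= d].

Definition bounded_by (c : R) p : Prop :=
  [/\ `|p.1.1| <= c, `|p.1.2| <= c & `|p.2| <= c].

Lemma N4_bounded p : N4 p <= 3 -> bounded_by 2 p.
Proof.
case: p => [[x y] z]; rewrite /N4 /= => N.
have X := sqr_ge0 x; have Y := sqr_ge0 y; have Z := sqr_ge0 z.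
have S := sqr_ge0 (x ^+ 2 + y ^+ 2).
have s2 : `|x ^+ 2 + y ^+ 2| <= 2 by apply: norm_le_sqr => //; lra.
rewrite ger0_norm in s2; last by lra.
split => /=; apply: norm_le_sqr => //; lra.
Qed.

Lemma N4_lip p q d : 0 <= d -> bounded_by 6 p -> bounded_by 6 q -> near_pt d p q ->
  `|N4 p - N4 q| <= 2 ^+ 12 * d.
Proof.
case: p q => [[x y] z] [[x' y'] z'] d0 [/= x1 y1 z1] [/= x2 y2 z2] [/= xx yy zz].
have sq (a b : R) : `|a| <= 6 -> `|b| <= 6 -> `|a - b| <= d ->
    `|a ^+ 2 - b ^+ 2| <= 12 * d.
  move=> ha hb hab; have -> : a ^+ 2 - b ^+ 2 = (a + b) * (a - b) by ring.
  rewrite normrM; apply: ler_pM => //.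
  by apply: le_trans (ler_normD _ _) _; lra.
have sb (a : R) : `|a| <= 6 -> a ^+ 2 <= 36.
  move=> ha; rewrite -real_normK ?num_real//.
  have -> : (36 : R) = 6 ^+ 2 by lra.
  by rewrite ler_pXn2r ?nnegrE.
have Dx := sq _ _ x1 x2 xx; have Dy := sq _ _ y1 y2 yy; have Dz := sq _ _ z1 z2 zz.
have D : `|(x ^+ 2 + y ^+ 2) ^+ 2 - (x' ^+ 2 + y' ^+ 2) ^+ 2| <= 144 * (24 * d).
  have -> : (x ^+ 2 + y ^+ 2) ^+ 2 - (x' ^+ 2 + y' ^+ 2) ^+ 2 =
    (x ^+ 2 + y ^+ 2 + (x' ^+ 2 + y' ^+ 2)) *
    ((x ^+ 2 - x' ^+ 2) + (y ^+ 2 - y' ^+ 2)) by ring.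
  rewrite normrM; apply: ler_pM => //.
    rewrite ger0_norm ?addr_ge0 ?sqr_ge0//.
    by have := sb _ x1; have := sb _ y1; have := sb _ x2; have := sb _ y2; lra.
  by apply: le_trans (ler_normD _ _) _; lra.
rewrite /N4 /=.
have -> : (x ^+ 2 + y ^+ 2) ^+ 2 + 16 * z ^+ 2 - ((x' ^+ 2 + y' ^+ 2) ^+ 2 + 16 * z' ^+ 2) =
  ((x ^+ 2 + y ^+ 2) ^+ 2 - (x' ^+ 2 + y' ^+ 2) ^+ 2) + 16 * (z ^+ 2 - z' ^+ 2) by ring.
apply: le_trans (ler_normD _ _) _; rewrite normrM (ger0_norm (ler0n R 16)).
by lra.
Qed.

(** The translation shears the tile vertically, by an amount proportional to the
    distance to the axis: hence the bound on [g]. *)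
Lemma tile_near h g t : 0 <= h -> h <= 1 -> utile t ->
  (`|g.1.1| <= 3 /\ `|g.1.2| <= 3) -> near_pt (4 * h) (hmul g (dil h t)) g.
Proof.
case: g t => [[a b] c] [[x y] z] h0 h1 /and3P[/= /andP[x1 x2] /andP[y1 y2] /andP[z1 z2]] [ha hb].
have nh (s : R) : -1 <= s -> s < 1 -> `|h * s| <= h.
  move=> s1 s2; rewrite normrM (ger0_norm h0) ler_piMr//.
  by rewrite ler_norml s1 ltW.
have hx := nh _ x1 x2; have hy := nh _ y1 y2; have hz := nh _ z1 z2.
rewrite /near_pt /hmul /dil /=.
have -> : a + h * x - a = h * x by ring.
have -> : b + h * y - b = h * y by ring.
have -> : c + h ^+ 2 * z + 2^-1 * (a * (h * y) - h * x * b) - c =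
  h * (h * z) + 2^-1 * (a * (h * y) - b * (h * x)) by ring.
split; [by lra|by lra|].
have P1 : `|h * (h * z)| <= 1 * h.
  by rewrite normrM (ger0_norm h0); apply: ler_pM.
have P2 : `|a * (h * y)| <= 3 * h by rewrite normrM; apply: ler_pM.
have P3 : `|b * (h * x)| <= 3 * h by rewrite normrM; apply: ler_pM.
move: P1 P2 P3; rewrite !ler_norml => /andP[? ?] /andP[? ?] /andP[? ?].
by apply/andP; split; lra.
Qed.

Lemma near_bounded p q d c : near_pt d p q -> bounded_by c q -> bounded_by (c + d) p.
Proof.
move=> [a1 a2 a3] [b1 b2 b3]; split.
- have := ler_normD (p.1.1 - q.1.1) q.1.1; rewrite subrK; lra.
- have := ler_normD (p.1.2 - q.1.2) q.1.2; rewrite subrK; lra.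
- have := ler_normD (p.2 - q.2) q.2; rewrite subrK; lra.
Qed.

Lemma near_sym p q d : near_pt d p q -> near_pt d q p.
Proof. by move=> [? ? ?]; split; rewrite distrC. Qed.

Lemma near_trans p q r d e : near_pt d p q -> near_pt e q r -> near_pt (d + e) p r.
Proof.
move=> [a1 a2 a3] [b1 b2 b3]; split.
- have := ler_normD (p.1.1 - q.1.1) (q.1.1 - r.1.1); rewrite subrKA; lra.
- have := ler_normD (p.1.2 - q.1.2) (q.1.2 - r.1.2); rewrite subrKA; lra.
- have := ler_normD (p.2 - q.2) (q.2 - r.2); rewrite subrKA; lra.
Qed.

(** It is enough to control one of the two points: the tiles that are filled are
    given by their lattice points, those of the cover by a point that they contain. *)
Lemma N4_tile h u p : 0 < h -> h <= 1 -> utile (loc h u p) ->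
  N4 p <= 2 \/ N4 (lat h u) <= 2 ->
  near_pt (4 * h) p (lat h u) /\ `|N4 p - N4 (lat h u)| <= 2 ^+ 14 * h.
Proof.
move=> h0 h1 up N2; have h00 := ltW h0; have hn : h != 0 by rewrite gt_eqF.
have pE : hmul (lat h u) (dil h (loc h u p)) = p by exact: lat_loc.
have b3 : `|(lat h u).1.1| <= 3 /\ `|(lat h u).1.2| <= 3.
  case: N2 => N2; last by have [? ? _] := @N4_bounded (lat h u) ltac:(lra); split; lra.
  have [b1 b2 _] := @N4_bounded p ltac:(lra).
  move: b1 b2; rewrite -pE /hmul /dil /=; case/and3P: up => [/andP[x1 x2] /andP[y1 y2] _].
  have nh (s : R) : -1 <= s -> s < 1 -> `|h * s| <= 1.
    move=> s1 s2; rewrite normrM (ger0_norm h00) mulr_ile1//.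
    by rewrite ler_norml s1 ltW.
  have := nh _ x1 x2; have := nh _ y1 y2; rewrite !ler_norml.
  move: (2 * h * _) (2 * h * _) (h * _) (h * _) => A B C D.
  move=> /andP[? ?] /andP[? ?] /andP[? ?] /andP[? ?]; split; apply/andP; split; lra.
have nr : near_pt (4 * h) p (lat h u) by rewrite -{1}pE; exact: tile_near.
have w c q : c <= 6 -> bounded_by c q -> bounded_by 6 q.
  by move=> c6 [? ? ?]; split; lra.
have h4 : 2 + 4 * h <= 6 by lra.
split=> //; rewrite (_ : 2 ^+ 14 * h = 2 ^+ 12 * (4 * h)); last by ring.
apply: N4_lip => //; first by lra.
  case: N2 => N2; first by apply: (w 2); [lra|apply: N4_bounded; lra].
  by apply: (w _ _ h4); apply: near_bounded nr _; apply: N4_bounded; lra.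
case: N2 => N2; last by apply: (w 2); [lra|apply: N4_bounded; lra].
by apply: (w _ _ h4); apply: near_bounded (near_sym nr) _; apply: N4_bounded; lra.
Qed.

End gauge.

(** * Uniform continuity on bounded sets *)

Section uniform.
Context {R : realType}.
Implicit Types (p q : heis R).

Lemma near_ball p q d r : d < r -> near_pt d p q -> ball p r q.
Proof.
by move=> dr [h1 h2 h3]; split; [split|]; apply: le_lt_trans dr.
Qed.

Lemma compact_box (c : R) : compact (bounded_by c : set (heis R)).
Proof.
have -> : bounded_by c = (`[- c, c] `*` `[- c, c]) `*` `[- c, c] :> set (heis R).
  apply/seteqP; split => [[[x y] z] [/= hx hy hz]|[[x y] z] [[/= hx hy] hz]].
    by split; [split|]; rewrite /= in_itv/= -ler_norml.
  by split; rewrite /= ler_norml; [move: hx|move: hy|move: hz]; rewrite /= in_itv.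
by apply: compact_setX; [apply: compact_setX|]; exact: segment_compact.
Qed.

Lemma unif_cont (g : heis R -> R) (c e : R) : continuous g -> 0 < e ->
  exists2 d, 0 < d & forall p q, bounded_by c p -> near_pt d p q -> `|g p - g q| <= e.
Proof.
move=> cg e0; have /compact_near_coveringP K := @compact_box c.
have H : \forall d \near (0 : R)^'+, bounded_by c `<=`
    (fun p => forall q, near_pt d p q -> `|g p - g q| <= e).
  apply: (K R _ (fun d p => forall q, near_pt d p q -> `|g p - g q| <= e)) => p _.
  have e2 : 0 < e / 2 by rewrite divr_gt0.
  have /cvgrPdist_lt/(_ _ e2)/nbhs_ballP [r /= r0 hr] := cg p.
  exists (ball p (r / 2), [set d | d < r / 2]) => /=.
    split; first by apply: nbhsx_ballx; rewrite divr_gt0.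
    by apply: nbhs_right_lt; rewrite divr_gt0.
  move=> [p' d] [/= pp' dr] q p'q.
  have h1 : ball p r p' by apply: le_ball pp'; rewrite ler_pdivrMr// ler_peMr// ?ler1n// ltW.
  have h2 : ball p r q.
    have := ball_triangle pp' (near_ball dr p'q).
    by rewrite -splitr.
  have := hr _ h1; have := hr _ h2 => /= a b.
  rewrite -(subrKA (g p)) (le_trans (ler_normD _ _))// distrC.
  lra.
near ((0 : R)^'+) => d; exists d; first by near: d; exact: nbhs_right_gt.
by move=> p q pc; apply: (near H d).
Unshelve. all: by end_near. Qed.

Lemma smooth_continuous (V : normedModType R) (f : heis R -> V) :
  smooth setT f -> continuous f.
Proof. by move=> sf p; exact: sf 0%N p I. Qed.

Lemma continuous_hjac (f : heis R -> heis R) : contact f -> continuous (fun p => `|hjac f p|).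
Proof.
move=> [sf _]; have oT : open [set: heis R] by exact: openT.
have C v k : Ck k setT ('D_v f) by exact: (sf k.+1).2.
have df p := smooth_diff p sf.
have Cx k : Ck k setT (fun p : heis R => p.1.1) by have [] := Ck_coord k oT.
have Cy k : Ck k setT (fun p : heis R => p.1.2) by have [] := Ck_coord k oT.
have C11 v k : Ck k setT (fun p => ('D_v f p).1.1).
  by do 2 apply: Ck_fst => //.
have C12 v k : Ck k setT (fun p => ('D_v f p).1.2).
  by apply: Ck_snd => //; apply: Ck_fst.
pose X1 p := ('D_ex f p).1.1 + - (2^-1 * p.1.2) * ('D_ez f p).1.1.
pose X2 p := ('D_ex f p).1.2 + - (2^-1 * p.1.2) * ('D_ez f p).1.2.
pose Y1 p := ('D_ey f p).1.1 + (2^-1 * p.1.1) * ('D_ez f p).1.1.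
pose Y2 p := ('D_ey f p).1.2 + (2^-1 * p.1.1) * ('D_ez f p).1.2.
have CX k : Ck k setT (fun p : heis R => - (2^-1 * p.1.2)).
  by apply: Ck_opp => //; apply: Ck_mul => //; exact: Ck_cst.
have CY k : Ck k setT (fun p : heis R => 2^-1 * p.1.1).
  by apply: Ck_mul => //; exact: Ck_cst.
have S : smooth setT (fun p => X1 p * Y2 p + - (X2 p * Y1 p)).
  move=> k; apply: Ck_add => //; last apply: Ck_opp => //.
    by apply: Ck_mul => //; apply: Ck_add => //; exact: Ck_mul.
  by apply: Ck_mul => //; apply: Ck_add => //; exact: Ck_mul.
have E p : hjac f p = X1 p * Y2 p + - (X2 p * Y1 p).
  rewrite /hjac (derive_coord (hX p) (df p)) (derive_coord (hY p) (df p)).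
  rewrite /X1 /X2 /Y1 /Y2.
  move: ('D_ex f p) ('D_ey f p) ('D_ez f p) => u v w.
  by rewrite /hX /hY /= /GRing.scale /=; ring.
move=> p; apply: continuous_comp; last exact: norm_continuous.
have -> : hjac f = (fun p => X1 p * Y2 p + - (X2 p * Y1 p)) by apply/funext.
exact: smooth_continuous.
Qed.

End uniform.

(** * The iteration *)

Section iteration.
Context {R : realType}.
Implicit Types (p q : heis R) (P : seq (int * int * int)).

(** The margin [c] makes the support a compact subset of the open ball. *)
Definition ball_contacto (b : heis R -> heis R) : Prop :=
  [/\ contact b,
      exists b', [/\ contact b', cancel b b' & cancel b' b] &
      exists2 c, 0 < c & forall p, 1 - c < N4 p -> b p = p].

Lemma ball_contacto_id : ball_contacto id.
Proof.
split; [exact: contact_id| |by exists 1].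
by exists id; split => //; exact: contact_id.
Qed.

Lemma ball_contacto_sigma h P c : h != 0 -> 0 < c ->
  (forall u p, u \in P -> utile (loc h u p) -> N4 p <= 1 - c) -> ball_contacto (sigma h P).
Proof.
move=> h0 c0 hP; split; first exact: contact_sigma.
  exists (sigmaV h P); split; [exact: contact_sigmaV|exact: sigmaK|exact: sigmaVK].
exists c => // p Np; have [] := @sigma_out _ h h0 P p; last by [].
by move=> u uP; apply/negP => /(hP _ _ uP); rewrite leNgt Np.
Qed.

Lemma ball_contacto_comp s b : ball_contacto s -> ball_contacto b -> ball_contacto (b \o s).
Proof.
move=> [cs [s' [cs' s1 s2]] [c c0 sc]] [cb [b' [cb' b1 b2]] [d d0 bd]].
split; first exact: contact_comp.
  exists (s' \o b'); split; first exact: contact_comp.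
    by move=> p /=; rewrite b1 s1.
  by move=> p /=; rewrite s2 b2.
exists (Num.min c d); first by rewrite lt_min c0.
move=> p Np /=; rewrite sc ?bd//.
  by apply: le_lt_trans Np; rewrite lerD2l lerN2 ge_min lexx orbT.
by apply: le_lt_trans Np; rewrite lerD2l lerN2 ge_min lexx.
Qed.

Definition kappa : R := 1 - (2 ^+ 26)^-1.
Definition scale (H : R) k : R := H / (2 ^ k)%:R.
(** A Riemann sum of the jacobian over the tiles of [P]; a tile of size [h] has
    volume proportional to [h ^ 4]. *)
Definition tile_sum H k P (b : heis R -> heis R) : R :=
  scale H k ^+ 4 * \sum_(u <- P) `|hjac b (lat (scale H k) u)|.

Lemma dist_le_add (x y e : R) : `|x - y| <= e -> y <= x + e.
Proof. by rewrite distrC -lerBlDl; apply: le_trans; exact: ler_norm. Qed.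

(** By the chain rule the jacobian at a point of the tile is that of [b] at another
    point of the tile, times that of the block, whose mean is at most [kappa]. *)
Lemma refined_sum b h P u j (L : R) : contact b -> h != 0 -> uniq P -> u \in P ->
  (48 <= j)%N -> 0 <= L ->
  (forall q, utile (loc h u q) -> `|hjac b q| <= L) ->
  \sum_(t <- digits j)
    `|hjac (b \o sigma h P) (lat (h / (2 ^ j)%:R) (lmul (scaleZ j u) t))| <=
  L * (kappa * (16 ^ j)%:R).
Proof.
move=> cb hn uP uinP j48 L0 hL; rewrite sum_digits.
apply: (@le_trans _ _ (L * (\sum_(i < 2 ^ j) \sum_(i' < 2 ^ j) \sum_(l < 4 ^ j)
    `|hjac block (digit j i i' l)|))); last first.
  by rewrite ler_wpM2l// natrX; exact: block_average.
have j0 : (0 < j)%N by exact: leq_trans j48.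
rewrite mulr_sumr; apply: ler_sum => i _.
rewrite mulr_sumr; apply: ler_sum => i' _.
rewrite mulr_sumr; apply: ler_sum => l _.
rewrite (lat_refine _ _ _ _ _ j0).
have ud : utile (digit j i i' l : heis R) by exact: utile_digit.
move: (digit j i i' l) ud => q uq {j48 j0 i i' l}.
have up : utile (loc h u (hmul (lat h u) (dil h q))) by rewrite loc_lat.
rewrite (hjac_comp _ (contact_sigma h P) cb) normrM.
have [e2 ->] := sigma_in hn uP uinP up; rewrite (loc_lat u q hn).
apply: ler_pM; [exact: normr_ge0|exact: normr_ge0| |exact: lexx].
by apply: hL; rewrite e2 (loc_tile_map hn); exact: block_utile.
Qed.

Variables (H : R) (P0 : seq (int * int * int)).
Hypotheses (H0 : 0 < H) (H1 : H <= 1) (uP0 : uniq P0).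
Hypothesis P0in : forall u, u \in P0 -> N4 (lat H u) <= 1 - 2 ^+ 15 * H.

Let vol : R := (size P0)%:R * H ^+ 4.

Let kappa_ge0 : 0 <= kappa. Proof. by rewrite /kappa; lra. Qed.
Let kappa_le1 : kappa <= 1. Proof. by rewrite /kappa; lra. Qed.
Let vol_ge0 : 0 <= vol.
Proof. by rewrite /vol mulr_ge0// exprn_ge0// ltW. Qed.
Let n_gt0 k : 0 < (2 ^ k)%:R :> R. Proof. by rewrite ltr0n expn_gt0. Qed.
Let scale_gt0 k : 0 < scale H k. Proof. exact: divr_gt0. Qed.
Let scaleD k j : scale H (k + j) = scale H k / (2 ^ j)%:R.
Proof. by rewrite /scale expnD natrM invfM mulrA. Qed.

Lemma scale4 k j : scale H (k + j) ^+ 4 * (16 ^ j)%:R = scale H k ^+ 4.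
Proof.
rewrite scaleD expr_div_n -natrX -expnM mulnC expnM divfK//.
Qed.

Lemma scale_small d : 0 < d -> exists K, forall k, (K <= k)%N -> scale H k <= d.
Proof.
move=> d0; exists (Num.truncn (H / d)).+1 => k Kk.
rewrite /scale ler_pdivrMr// mulrC -ler_pdivrMr//.
have Hd : 0 <= H / d by rewrite divr_ge0// ltW.
have /andP[_ /ltW h] := truncn_itv Hd; apply: le_trans h _.
by rewrite ler_nat (leq_trans Kk)// ltnW// ltn_expl.
Qed.

(** The volume of the initial tiles is the constant [vol]; the tiles of [P] are the
    subtiles of size [scale H k] of the initial ones. The error [e] is needed in the
    induction, where [hjac b] is replaced by its values at lattice points. Since
    the map is chosen before [k], the sum is controlled on all fine scales at
    once, which is what both the next step and the limit [h -> 0] use. *)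
Theorem iteration n : forall e, 0 < e -> exists b : heis R -> heis R,
  [/\ ball_contacto b, forall p, `|hjac b p| <= (2 ^+ 64) ^+ n, forall p, near_pt e p (b p) &
  exists K c, 0 < c /\ forall k, (K <= k)%N -> exists P,
    [/\ uniq P, size P = (size P0 * 16 ^ k)%N,
     forall u, u \in P -> N4 (lat (scale H k) u) <= 1 - c &
     tile_sum H k P b <= kappa ^+ n * vol + e]].
Proof.
elim: n => [|n IH] e e0.
  exists id; split; first exact: ball_contacto_id.
  - by move=> p; rewrite hjac_id normr1.
  - by move=> p; split; rewrite subrr normr0 ltW.
  exists 1%N, (2 ^+ 14 * H); split; first by move: H0; lra.
  move=> k k1; exists (refine k P0); split.
  - exact: (@uniq_refine R k P0 k1 uP0).
  - exact: size_refine.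
  - move=> v /allpairsP[[u t] /= [uP /digitsP[i [j [l [hi hj hl ->]]]] ->]].
    rewrite (lat_refine _ _ _ _ _ k1); have Nu := P0in uP.
    set p := hmul _ _.
    have up : utile (loc H u p) by rewrite loc_lat ?gt_eqF//; exact: utile_digit.
    have [|_] := @N4_tile _ H u p H0 H1 up; first by right; move: H0; lra.
    by rewrite ler_norml => /andP[_ ?]; lra.
  - rewrite expr0 mul1r /tile_sum big_seq (eq_bigr (fun=> 1)) => [|u _]; last first.
      by rewrite hjac_id normr1.
    rewrite -big_seq big_const_seq count_predT size_refine iter_addr addr0.
    have := scale4 0 k; rewrite add0n => S.
    rewrite natrM mulrCA S /vol /scale expn0 divr1.
    by rewrite lerDl ltW.
have e4 : 0 < e / 4 by rewrite divr_gt0.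
have [b [ab lb nb [K [c [c0 hK]]]]] := IH _ e4.
have [cb _ _] := ab; have cj := continuous_hjac cb.
(* The oscillation of [hjac b] allowed on a tile. *)
pose e1 := e / (4 * (vol + 1)).
have v1 : 0 < vol + 1 by rewrite ltr_wpDl.
have e10 : 0 < e1 by rewrite divr_gt0// mulr_gt0.
have e1v : e1 * vol <= e / 4.
  have : e1 * (4 * (vol + 1)) = e by rewrite divfK// mulf_neq0// gt_eqF.
  by move: e10; clearbody e1; lra.
have [d d0 hd] := unif_cont 2 cj e10.
have [K1 h1] := scale_small (divr_gt0 d0 (ltr0n R 4)).
have [K2 h2] := @scale_small (e / 16) ltac:(by rewrite divr_gt0).
have [K3 h3] := @scale_small (c / 2 ^+ 15) ltac:(by rewrite divr_gt0 ?exprn_gt0).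
have [K4 h4] := @scale_small 1 ltr01.
pose k := maxn K (maxn K1 (maxn K2 (maxn K3 K4))).
have kK : (K <= k)%N by rewrite leq_maxl.
have k1 : (K1 <= k)%N by rewrite !leq_max leqnn ?orbT.
have k2 : (K2 <= k)%N by rewrite !leq_max leqnn ?orbT.
have k3 : (K3 <= k)%N by rewrite !leq_max leqnn ?orbT.
have k4 : (K4 <= k)%N by rewrite !leq_max leqnn ?orbT.
have {h1}h1 := h1 _ k1; have {h2}h2 := h2 _ k2; have {h3}h3 := h3 _ k3.
have {h4}h4 := h4 _ k4; have h0 := scale_gt0 k.
have {hK} [P [uP sP NP TP]] := hK k kK.
clearbody k => {k1 k2 k3 k4 K1 K2 K3 K4}.
set h := scale H k in h0 h1 h2 h3 h4 NP.
have hn : h != 0 by rewrite gt_eqF.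
have hd4 : 4 * h <= d by lra.
have c3 : 1 - c <= 3 by lra.
have tileN u p : u \in P -> utile (loc h u p) ->
    near_pt (4 * h) p (lat h u) /\ N4 p <= 1 - c / 2.
  move=> uP' up; have Nu := NP _ uP'.
  have [|nr] := @N4_tile _ h u p h0 h4 up; first by right; lra.
  by rewrite ler_norml => /andP[_ ?]; split => //; lra.
have as_ : ball_contacto (sigma h P).
  apply: (@ball_contacto_sigma h P (c / 2) hn); first by rewrite divr_gt0.
  by move=> u p uP' up; have [] := tileN u p uP' up.
have nears p : near_pt (e / 2) p (sigma h P p).
  have [[-> _]|[u [uP' up up' _]]] := sigma_cases hn p uP.
    by split; rewrite subrr normr0 divr_ge0// ltW.
  have [n1 _] := tileN u p uP' up; have [n2 _] := tileN u _ uP' up'.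
  have [? ? ?] := near_trans n1 (near_sym n2); split; lra.
exists (b \o sigma h P); split.
- exact: ball_contacto_comp.
- move=> p; rewrite (hjac_comp p (contact_sigma h P) cb) normrM exprSr.
  by apply: ler_pM => //; exact: hjac_sigma_le.
- move=> p; have [? ? ?] := near_trans (nears p) (nb (sigma h P p)).
  by split; lra.
(* Subtiles of the tiles of [P] that are [2^j] times smaller, with [48 <= j], are
   fine enough for the mean of the twist. *)
exists (k + 48)%N, (c / 2); split; first by rewrite divr_gt0.
move=> k' kk'; have [j j48 ->] : exists2 j, (48 <= j)%N & k' = (k + j)%N.
  have kk : (k <= k')%N := leq_trans (leq_addr _ _) kk'.
  by exists (k' - k)%N; [rewrite leq_subRL|rewrite subnKC].
have j0 : (0 < j)%N by exact: leq_trans j48.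
have sE : scale H (k + j) = h / (2 ^ j)%:R by exact: scaleD.
exists (refine j P); split.
- exact: (@uniq_refine R j P j0 uP).
- by rewrite size_refine sP expnD mulnA.
- move=> v /allpairsP[[u t] /= [uP' /digitsP[i [i' [l [hi hi' hl ->]]]] ->]].
  rewrite sE (lat_refine _ _ _ _ _ j0).
  have [] // := tileN u (hmul (lat h u) (dil h (digit j i i' l))) uP'.
  by rewrite loc_lat//; exact: utile_digit.
have S4 := scale4 k j; rewrite -/h in S4.
rewrite /tile_sum sum_refine sE.
have B u : u \in P -> \sum_(t <- digits j)
    `|hjac (b \o sigma h P) (lat (h / (2 ^ j)%:R) (lmul (scaleZ j u) t))| <=
    (`|hjac b (lat h u)| + e1) * (kappa * (16 ^ j)%:R).
  move=> uP'; apply: refined_sum; [exact: cb|exact: hn|exact: uP|exact: uP'|exact: j48| |].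
    by apply: addr_ge0; [exact: normr_ge0|exact: ltW].
  move=> q uq; have [[n1 n2 n3] _] := tileN u q uP' uq.
  have bu : bounded_by 2 (lat h u).
    by apply: N4_bounded; apply: le_trans (NP _ uP') c3.
  have nd : near_pt d (lat h u) q.
    by split; rewrite distrC; apply: le_trans hd4.
  by apply: dist_le_add; exact: hd bu nd.
apply: (@le_trans _ _ ((h / (2 ^ j)%:R) ^+ 4 *
   (\sum_(u <- P) (`|hjac b (lat h u)| + e1) * (kappa * (16 ^ j)%:R)))).
  rewrite ler_wpM2l//; first by rewrite -sE exprn_ge0// ltW ?scale_gt0.
  by rewrite [X in X <= _]big_seq [X in _ <= X]big_seq; apply: ler_sum => u; exact: B.
rewrite -mulr_suml big_split /= big_const_seq count_predT iter_addr addr0 sP.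
have VE : h ^+ 4 * (size P0 * 16 ^ k)%:R = vol.
  have := scale4 0 k; rewrite add0n -/h => S.
  by rewrite natrM mulrCA S /vol /scale expn0 divr1.
rewrite sE in S4; rewrite /tile_sum -/h in TP; rewrite -[e1 *+ _]mulr_natr.
move: S4 VE TP; move: ((h / _) ^+ 4) (\sum_(u <- P) _) => X A.
move: ((size P0 * 16 ^ k)%:R) ((16 ^ j)%:R) => s J S4 VE TP.
have -> : X * ((A + e1 * s) * (kappa * J)) = kappa * (h ^+ 4 * A + e1 * vol).
  by rewrite -VE -S4; ring.
apply: (@le_trans _ _ (kappa * (kappa ^+ n * vol + e / 4 + e / 4))).
  by rewrite ler_wpM2l ?kappa_ge0// lerD.
rewrite exprS -mulrA -addrA mulrDr lerD2l.
apply: (@le_trans _ _ (1 * (e / 4 + e / 4))); last by lra.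
by apply: ler_wpM2r => //; rewrite addr_ge0// ltW.
Qed.

End iteration.

(** * The tiles near the unit sphere *)

Section sphere.
Context {R : realType}.
Implicit Types (p : heis R) (u : int * int * int).

(** When [z] and [z'] have the same sign, [|z - z'|^2 <= |z^2 - z'^2|]. *)
Lemma N4_spread (x y z z' E c : R) : 0 <= c -> E <= 16 * c ^+ 2 ->
  `|N4 (x, y, z) - N4 (x, y, z')| <= E -> 0 <= z * z' -> `|z - z'| <= c.
Proof.
move=> c0 Ec D zz; apply: norm_le_sqr => //.
have {}D : 16 * `|z ^+ 2 - z' ^+ 2| <= 16 * c ^+ 2.
  apply: le_trans Ec; apply: le_trans D; rewrite /N4 /=.
  rewrite -(ger0_norm (ler0n R 16)) -normrM le_eqVlt; apply/orP; left.
  by apply/eqP; congr `|_|; rewrite ger0_norm ?ler0n//; ring.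
have {}D : `|z ^+ 2 - z' ^+ 2| <= c ^+ 2 by lra.
apply: le_trans D; have -> : z ^+ 2 - z' ^+ 2 = (z - z') * (z + z') by ring.
rewrite -real_normK ?num_real// expr2 normrM ler_wpM2l//.
by rewrite -(@ler_pXn2r _ 2) ?nnegrE// !real_normK ?num_real//; lra.
Qed.

Local Notation mesh k := (scale (4 : R) k).

(** The lattice points of a tile of size [4], which contains the ball. *)
Definition base k : seq (int * int * int) := refine k [:: (0, 0, 0)].

Let e4 k : (4 ^ k)%:R = (2 ^ k)%:R ^+ 2 :> R.
Proof. by rewrite -natrX -expnM mulnC expnM. Qed.

Lemma base_sum k (F : heis R -> R) : (0 < k)%N ->
  \sum_(u <- base k) F (lat (mesh k) u) =
  \sum_(i < 2 ^ k) \sum_(j < 2 ^ k) \sum_(l < 4 ^ k) F (dil 4 (digit k i j l)).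
Proof.
move=> k0; rewrite sum_refine big_seq1 sum_digits.
apply: eq_bigr => i _; apply: eq_bigr => j _; apply: eq_bigr => l _.
rewrite /scale lat_refine//; congr F; case: (digit k i j l) => [[x y] z].
by rewrite /hmul /lat /dil /=; congr (_, _, _); ring.
Qed.

Lemma base_mem k u : (0 < k)%N -> N4 (lat (mesh k) u) <= 3 -> u \in base k.
Proof.
move=> k0 N3; have [b1 b2 b3] := N4_bounded N3.
apply: (@refine_mem R 4 k (0, 0, 0)) => //; rewrite ?mem_head ?pnatr_eq0//.
rewrite -/(mesh k) locE ?pnatr_eq0//.
move: (lat (mesh k) u) b1 b2 b3 => [[x y] z] /=.
rewrite /utile /= !ler_norml !mulr0z !mulr0 !mul0r !subr0 addr0.
move=> /andP[? ?] /andP[? ?] /andP[? ?].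
by apply/and3P; split; apply/andP; split; lra.
Qed.

Lemma size_base k : size (base k) = (16 ^ k)%N.
Proof. by rewrite size_refine mul1n. Qed.

Lemma uniq_base k : (0 < k)%N -> uniq (base k).
Proof. by move=> k0; apply: (@uniq_refine R). Qed.

Lemma count_natr (T : Type) (a : pred T) (s : seq T) :
  (count a s)%:R = \sum_(x <- s) (a x)%:R :> R.
Proof.
elim: s => [|x s IH]; first by rewrite big_nil.
by rewrite big_cons /= natrD IH.
Qed.

(** By [N4_spread], over each [(x, y)] a shell of width [O(h)] contains
    [O(sqrt h / h^2)] lattice points. *)
Lemma shell_count (q : nat) (P : pred R) : (0 < q)%N ->
  let k := (2 * q)%N in let w : R := 2 / (2 ^ q)%:R in
  (forall s t, P s -> P t -> `|s - t| <= 2 ^+ 17 * mesh k) ->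
  mesh k ^+ 4 * (\sum_(u <- base k) (P (N4 (lat (mesh k) u)))%:R) <= 2 ^+ 12 * w.
Proof.
move=> q0 k w hP; have k0 : (0 < k)%N by rewrite muln_gt0.
have q2 : 2 <= (2 ^ q)%:R :> R by rewrite (ler_nat R 2) -{1}(expn1 2) leq_exp2l.
have qn : (2 ^ q)%:R != 0 :> R by rewrite pnatr_eq0 expn_eq0.
have w0 : 0 < w by rewrite divr_gt0// ltr0n expn_gt0.
have w1 : w <= 1 by rewrite ler_pdivrMr ?mul1r// ltr0n expn_gt0.
have kq : (2 ^ k)%:R = (2 ^ q)%:R ^+ 2 :> R by rewrite -natrX -expnM mulnC.
have HE : mesh k = w ^+ 2 by rewrite /scale /w kq; field.
have H4 : mesh k ^+ 2 * (4 ^ k)%:R = 16.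
  by rewrite /scale e4 kq; field.
have H0 : 0 < mesh k by rewrite HE exprn_gt0.
set H := mesh k in HE H4 H0 hP *.
have w2 : w ^+ 2 <= 1 by rewrite expr_le1// ltW.
have Hw : H ^+ 2 <= w.
  rewrite HE -exprM (exprD _ 1 3) expr1 ler_piMr ?(ltW w0)//.
  by rewrite expr_le1// ltW.
rewrite (base_sum (fun p => (P (N4 p))%:R) k0).
have line (i j : 'I_(2 ^ k)) :
    H ^+ 2 * (\sum_(l < 4 ^ k) (P (N4 (dil 4 (digit k i j l))))%:R) <= 2 ^+ 8 * w.
  pose z (l : 'I_(4 ^ k)) := 16 * (2 * l%:R / (4 ^ k)%:R - 1) : R.
  have zE (l : 'I_(4 ^ k)) : z l = 2 * H ^+ 2 * l%:R - 16.
    have n4 : (4 ^ k)%:R != 0 :> R by rewrite pnatr_eq0 expn_eq0.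
    by rewrite /z -H4; field.
  pose x := 4 * (2 * i%:R / (2 ^ k)%:R - 1) : R.
  pose y := 4 * (2 * j%:R / (2 ^ k)%:R - 1) : R.
  have dE (l : 'I_(4 ^ k)) : dil 4 (digit k i j l) = (x, y, z l).
    by rewrite /dil /digit /x /y /z /=; congr (_, _, _); ring.
  have half (Q : pred R) : (forall a b : R, Q a -> Q b -> 0 <= a * b) ->
    2 * H ^+ 2 * (\sum_(l < 4 ^ k) (P (N4 (x, y, z l)) && Q (z l))%:R) <=
      2 ^+ 7 * w + 2 * H ^+ 2.
    move=> hQ; apply: count_spread.
    - by rewrite mulr_gt0// exprn_gt0.
    - by rewrite mulr_ge0 ?exprn_ge0// ltW.
    move=> l l' /andP[s1 t1] /andP[s2 t2].
    have c0 : 0 <= 2 ^+ 7 * w by rewrite mulr_ge0 ?exprn_ge0// ltW.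
    have Ec : 2 ^+ 17 * H <= 16 * (2 ^+ 7 * w) ^+ 2.
      by rewrite exprMn -HE; lra.
    have := N4_spread c0 Ec (hP _ _ s1 s2) (hQ _ _ t1 t2).
    rewrite !zE ler_norml => /andP[? _]; lra.
  have hp := half (fun t => 0 <= t) (fun a b => @mulr_ge0 _ a b).
  have hn := half (fun t => t <= 0) (fun a b => @mulr_le0 _ a b).
  have : \sum_(l < 4 ^ k) (P (N4 (dil 4 (digit k i j l))))%:R <=
    \sum_(l < 4 ^ k) (P (N4 (x, y, z l)) && (0 <= z l))%:R +
    \sum_(l < 4 ^ k) (P (N4 (x, y, z l)) && (z l <= 0))%:R :> R.
    rewrite -big_split /=; apply: ler_sum => l _; rewrite dE.
    case: (P _) => /=; last by rewrite addr0.
    have [z0|z0] := ltP 0 (z l); first by rewrite (ltW z0) addr0.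
    by rewrite lerDr.
  rewrite -(ler_pM2l (exprn_gt0 2 H0)); lra.
have -> : H ^+ 4 = H ^+ 2 * H ^+ 2 by rewrite -exprD.
rewrite -mulrA; apply: (@le_trans _ _ (H ^+ 2 * (\sum_(i < 2 ^ k) \sum_(j < 2 ^ k) (2 ^+ 8 * w)))).
  rewrite ler_wpM2l ?exprn_ge0 ?(ltW H0)// mulr_sumr; apply: ler_sum => i _.
  by rewrite mulr_sumr; apply: ler_sum => j _.
rewrite !sumr_const !card_ord -mulrnA -expnMn -[_ *+ _]mulr_natl mulrA H4.
by lra.
Qed.

(** The inner tiles and those needed to cover the ball differ by the lattice points
    of a gauge shell of width [O(h)], which are counted by [shell_count]. *)
Lemma sphere_tiles (e : R) : 0 < e ->
  exists k, [/\ (0 < k)%N, 2 ^+ 16 * mesh k <= 1 &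
  exists P0 X0 : seq (int * int * int),
    [/\ uniq P0 /\ uniq X0,
     forall u, u \in P0 -> N4 (lat (mesh k) u) <= 1 - 2 ^+ 15 * mesh k,
     forall u, N4 (lat (mesh k) u) <= 1 + 2 ^+ 16 * mesh k -> u \in X0,
     ((size X0)%:R - (size P0)%:R) * mesh k ^+ 4 <= e &
     (size P0)%:R * mesh k ^+ 4 <= 256]].
Proof.
move=> e0.
have m0 : 0 < Num.min (2 ^+ 8)^-1 (e / 2 ^+ 12).
  by rewrite lt_min invr_gt0 exprn_gt0//= divr_gt0// exprn_gt0.
have [K hK] := scale_small (ltr0n R 2) m0.
pose q := K.+1; pose k := (2 * q)%N; have := hK q (leqnSn K).
rewrite le_min => /andP[q1 q2]; rewrite /scale in q1 q2.
set w := 2 / (2 ^ q)%:R in q1 q2.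
have k0 : (0 < k)%N by rewrite muln_gt0.
have w0 : 0 < w by rewrite divr_gt0// ltr0n expn_gt0.
have HE : mesh k = w ^+ 2.
  rewrite /scale /w /k mulnC expnM natrX; field.
  by rewrite pnatr_eq0 expn_eq0.
have H16 : 2 ^+ 16 * mesh k <= 1.
  have : w * w <= (2 ^+ 8)^-1 * (2 ^+ 8)^-1 by apply: ler_pM => //; exact: ltW.
  by rewrite HE expr2; lra.
have H0 : 0 < mesh k by rewrite HE exprn_gt0.
exists k; split => //.
pose c1 := 1 - 2 ^+ 15 * mesh k; pose c2 := 1 + 2 ^+ 16 * mesh k.
exists [seq u <- base k | N4 (lat (mesh k) u) <= c1].
exists [seq u <- base k | N4 (lat (mesh k) u) <= c2].
have c12 : c1 <= c2 by rewrite /c1 /c2; lra.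
split.
- by split; rewrite filter_uniq// uniq_base.
- by move=> u; rewrite mem_filter => /andP[].
- move=> u Nu; rewrite mem_filter Nu /=; apply: base_mem => //.
  by apply: le_trans Nu _; lra.
- have -> : (size [seq u <- base k | N4 (lat (mesh k) u) <= c2])%:R -
      (size [seq u <- base k | N4 (lat (mesh k) u) <= c1])%:R =
      \sum_(u <- base k) ((fun s => (c1 < s) && (s <= c2)) (N4 (lat (mesh k) u)))%:R :> R.
    rewrite !size_filter !count_natr -sumrB; apply: eq_bigr => u _.
    have [n1|n1] := leP (N4 _) c1; first by rewrite (le_trans n1 c12) subrr.
    by rewrite subr0.
  have hP s t : (c1 < s) && (s <= c2) -> (c1 < t) && (t <= c2) ->
      `|s - t| <= 2 ^+ 17 * mesh k.
    move=> /andP[s1 s2] /andP[t1 t2]; rewrite ler_norml.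
    by move: s1 s2 t1 t2; rewrite /c1 /c2 => *; apply/andP; split; lra.
  have SC := @shell_count q (fun s => (c1 < s) && (s <= c2)) (ltn0Sn K) hP.
  rewrite mulrC; apply: le_trans SC _.
  rewrite -/w; have : 2 ^+ 12 * w <= 2 ^+ 12 * (e / 2 ^+ 12) by rewrite ler_pM2l// exprn_gt0.
  by move/le_trans; apply; rewrite mulrC divfK// gt_eqF// exprn_gt0.
- rewrite size_filter; apply: (@le_trans _ _ ((16 ^ k)%:R * mesh k ^+ 4)).
    by rewrite ler_wpM2r ?exprn_ge0 ?(ltW H0)// ler_nat -(size_base k) count_size.
  rewrite /scale expr_div_n (_ : (16 ^ k)%:R = (2 ^ k)%:R ^+ 4); last first.
    by rewrite -natrX -expnM mulnC expnM.
  rewrite mulrC divfK; last by rewrite expf_neq0// pnatr_eq0 expn_eq0.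
  by lra.
Qed.

End sphere.

(** * The image of a small tile lies in a thin strip *)

Section linear_approximation.
Context {R : realType}.
Implicit Types (p q w : heis R).

Lemma mvt_line (f : heis R -> R) p w : (forall q, differentiable f q) ->
  exists2 s : R, 0 <= s <= 1 & f (p + w) - f p = 'D_w f (p + s *: w).
Proof.
move=> df; pose l (t : R) : heis R := p + t *: w.
have ds t : is_diff t (fun s : R => s *: w) (fun s : R => s *: w).
  exact: is_diff_scalel.
have Hl t : is_diff t l (0 + (fun s : R => s *: w)).
  by apply: is_diffD.
have dl t : differentiable l t by case: (Hl t).
have Dl t : 'D_1 l t = w.
  rewrite (deriveE _ (dl t)); case: (Hl t) => _ ->.
  by rewrite fctE /= add0r scale1r.
have dfl t : is_derive t (1 : R) (f \o l) ('D_w f (l t)).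
  apply: DeriveDef.
    by apply: diff_derivable; apply: differentiable_comp.
  by rewrite derive_comp// Dl.
have [|t t01 E] := @MVT_segment R (f \o l) (fun t => 'D_w f (l t)) 0 1 ler01 (fun t _ => dfl t).
  apply: continuous_subspaceT => t; apply: differentiable_continuous.
  exact: differentiable_comp.
exists t; first by move: t01; rewrite in_itv.
by move: E; rewrite /= /l scale1r scale0r addr0 subr0 mulr1.
Qed.

Lemma cont_bounded (g : heis R -> R) (c : R) : 0 <= c -> continuous g ->
  exists M, forall p, bounded_by c p -> `|g p| <= M.
Proof.
move=> c0 cg; have B0 : (bounded_by c : set (heis R)) !=set0.
  by exists 0; split; rewrite normr0.
have [|q _ hq] := compact_EVT_max (f := fun p => `|g p|) B0 (@compact_box R c).
  apply: continuous_subspaceT => p; apply: continuous_comp; first exact: cg.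
  exact: norm_continuous.
by exists `|g q| => p /mem_set; exact: hq.
Qed.

Let sum5 (a1 a2 a3 a4 a5 e : R) : `|a1| <= e / 8 -> `|a2| <= e / 8 ->
  `|a3| <= e / 8 -> `|a4| <= e / 8 -> `|a5| <= e / 2 ->
  `|a1 + a2 + a3 - a4 + a5| <= e.
Proof.
rewrite !ler_norml.
by move=> /andP[? ?] /andP[? ?] /andP[? ?] /andP[? ?] /andP[? ?]; apply/andP; split; lra.
Qed.

Let sum3 (a1 a2 a3 m : R) : `|a1| <= m -> `|a2| <= m -> `|a3| <= m ->
  `|a1 + a2 - a3| <= 3 * m.
Proof.
rewrite !ler_norml.
by move=> /andP[? ?] /andP[? ?] /andP[? ?]; apply/andP; split; lra.
Qed.

(** Along a tile the horizontal displacement is [O(h)] and the vertical one is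
    [O(h^2)], so that only the horizontal derivatives matter to first order. *)
Lemma tile_approx (f : heis R -> R) : smooth setT f -> exists M : R,
  (forall p, bounded_by 2 p -> `|'D_(hX p) f p| <= M /\ `|'D_(hY p) f p| <= M) /\
  forall e, 0 < e -> exists2 d, 0 < d & forall h p q, 0 < h -> h <= d ->
    bounded_by 2 p -> utile q ->
    `|f (hmul p (dil h q)) - f p -
      h * (q.1.1 * 'D_(hX p) f p + q.1.2 * 'D_(hY p) f p)| <= e * h.
Proof.
move=> sf; have df p := smooth_diff p sf.
have cD v : continuous ('D_v f) by apply: smooth_continuous => k; exact: (sf k.+1).2.
have [M1 h1] := cont_bounded (ler0n R 6) (cD ex).
have [M2 h2] := cont_bounded (ler0n R 6) (cD ey).
have [M3 h3] := cont_bounded (ler0n R 6) (cD ez).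
have b0 : bounded_by 6 (0 : heis R) by split; rewrite normr0.
have M10 : 0 <= M1 by apply: le_trans (h1 _ b0).
have M20 : 0 <= M2 by apply: le_trans (h2 _ b0).
have M30 : 0 <= M3 by apply: le_trans (h3 _ b0).
have DX p : 'D_(hX p) f p = 'D_ex f p - 2^-1 * p.1.2 * 'D_ez f p.
  rewrite (derive_coord (hX p) (df p)).
  move: ('D_ex f p) ('D_ey f p) ('D_ez f p) => u v t.
  by rewrite /hX /= /GRing.scale /=; ring.
have DY p : 'D_(hY p) f p = 'D_ey f p + 2^-1 * p.1.1 * 'D_ez f p.
  rewrite (derive_coord (hY p) (df p)).
  move: ('D_ex f p) ('D_ey f p) ('D_ez f p) => u v t.
  by rewrite /hY /= /GRing.scale /=; ring.
have half (a t m : R) : `|a| <= 2 -> `|t| <= m -> `|2^-1 * a * t| <= m.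
  move=> ha ht; rewrite normrM -[leRHS]mul1r; apply: ler_pM => //.
  by rewrite normrM ger0_norm ?invr_ge0//; lra.
exists (M1 + M2 + M3); split.
  move=> p [p1 p2 p3]; have b6 : bounded_by 6 p by split; lra.
  have := h1 _ b6; have := h2 _ b6; have := h3 _ b6; rewrite DX DY.
  move: ('D_ex f p) ('D_ey f p) ('D_ez f p) => u v t ht hv hu.
  have X := half _ _ _ p1 ht; have Y := half _ _ _ p2 ht; split.
    by apply: le_trans (ler_normB _ _) _; lra.
  by apply: le_trans (ler_normD _ _) _; lra.
move=> e e0; have e8 : 0 < e / 8 by rewrite divr_gt0.
have [d1 d10 u1] := unif_cont 2 (cD ex) e8.
have [d2 d20 u2] := unif_cont 2 (cD ey) e8.
have [d3 d30 u3] := unif_cont 2 (cD ez) e8.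
pose dm := e / (2 * (M3 + 1)).
have M31 : 0 < 2 * (M3 + 1) by rewrite mulr_gt0// ltr_wpDl.
have dm0 : 0 < dm by rewrite divr_gt0.
exists (Num.min (Num.min (d1 / 4) (d2 / 4)) (Num.min (d3 / 4) (Num.min 1 dm))).
  by rewrite !lt_min !divr_gt0 ?ltr01.
move=> h p q h0; rewrite !le_min => /andP[/andP[hd1 hd2] /and3P[hd3 hh1 hdm]].
move=> bp /and3P[/andP[x1 x2] /andP[y1 y2] /andP[z1 z2]].
have [p1 p2 p3] := bp.
have [qx qy qz] : [/\ `|q.1.1| <= 1, `|q.1.2| <= 1 & `|q.2| <= 1].
  by rewrite !ler_norml x1 y1 z1 !ltW.
(* The Euclidean displacement from [p] to the point of the tile. *)
pose w : heis R := (h * q.1.1, h * q.1.2,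
   h ^+ 2 * q.2 + 2^-1 * (p.1.1 * (h * q.1.2) - h * q.1.1 * p.1.2)).
have -> : hmul p (dil h q) = p + w.
  by case: p q @w {x1 x2 y1 y2 z1 z2 p1 p2 p3 qx qy qz bp} => [[x y] z] [[x' y'] z'];
    congr (_, _, _) => /=; ring.
have [s /andP[s0 s1] ->] := mvt_line p w df.
have h34 : 3 * (h * 1) <= 4 * h by clear -h0; lra.
have h14 : h * 1 <= 4 * h by clear -h0; lra.
have h26 : 2 + 4 * h <= 6 by clear -hh1; lra.
have hz0 : h ^+ 2 <= h by rewrite expr2 ler_piMr// ltW.
have w1 : `|w.1.1| <= 4 * h.
  by apply: le_trans h14; rewrite /= normrM (gtr0_norm h0) ler_pM2l.
have w2 : `|w.1.2| <= 4 * h.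
  by apply: le_trans h14; rewrite /= normrM (gtr0_norm h0) ler_pM2l.
have w3 : `|w.2| <= 4 * h.
  have P1 : `|h ^+ 2 * q.2| <= h * 1.
    by rewrite normrM ger0_norm ?exprn_ge0 ?(ltW h0)//; apply: ler_pM; rewrite ?exprn_ge0 ?(ltW h0).
  have P2 : `|2^-1 * p.1.1 * (h * q.1.2)| <= h * 1.
    by apply: half => //; rewrite normrM (gtr0_norm h0) ler_pM2l.
  have P3 : `|2^-1 * p.1.2 * (h * q.1.1)| <= h * 1.
    by apply: half => //; rewrite normrM (gtr0_norm h0) ler_pM2l.
  have -> : w.2 = h ^+ 2 * q.2 + 2^-1 * p.1.1 * (h * q.1.2) - 2^-1 * p.1.2 * (h * q.1.1).
    by rewrite /w /=; ring.
  exact: le_trans (sum3 P1 P2 P3) h34.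
set xi := p + s *: w.
have nxi : near_pt (4 * h) p xi.
  have S (t : R) : `|t| <= 4 * h -> `|s * t| <= 4 * h.
    move=> ht; rewrite normrM (ger0_norm s0); apply: le_trans ht.
    by rewrite ler_piMl.
  by split; rewrite /xi /= opprD addrA subrr add0r normrN; exact: S.
have nd d : h <= d / 4 -> near_pt d p xi.
  rewrite ler_pdivlMr// mulrC => hd.
  by case: nxi => n1 n2 n3; split; exact: le_trans hd.
have e1 := u1 _ _ bp (nd _ hd1); have e2 := u2 _ _ bp (nd _ hd2).
have e3 := u3 _ _ bp (nd _ hd3).
have bxi : bounded_by 6 xi.
  by have [? ? ?] := near_bounded (near_sym nxi) bp; split; exact: le_trans h26.
have Dz := h3 _ bxi.
rewrite (derive_coord w (df xi)) DX DY.
move: e1 e2 e3 Dz; move: ('D_ex f p) ('D_ey f p) ('D_ez f p) => A B C.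
move: ('D_ex f xi) ('D_ey f xi) ('D_ez f xi) => A' B' C' e1 e2 e3 Dz.
rewrite /= /GRing.scale /=.
have -> : h * q.1.1 * A' + h * q.1.2 * B' +
    (h ^+ 2 * q.2 + 2^-1 * (p.1.1 * (h * q.1.2) - h * q.1.1 * p.1.2)) * C' -
    h * (q.1.1 * (A - 2^-1 * p.1.2 * C) + q.1.2 * (B + 2^-1 * p.1.1 * C)) =
    h * (q.1.1 * (A' - A) + q.1.2 * (B' - B) +
      2^-1 * p.1.1 * (q.1.2 * (C' - C)) - 2^-1 * p.1.2 * (q.1.1 * (C' - C)) +
      q.2 * (h * C')) by ring.
rewrite normrM (gtr0_norm h0) mulrC ler_pM2r//.
have m1 (a t m : R) : `|a| <= 1 -> `|t| <= m -> `|a * t| <= m.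
  by move=> ha ht; rewrite normrM -[leRHS]mul1r; apply: ler_pM.
have T1 : `|q.1.1 * (A' - A)| <= e / 8 by apply: m1 => //; rewrite distrC.
have T2 : `|q.1.2 * (B' - B)| <= e / 8 by apply: m1 => //; rewrite distrC.
have T3 : `|2^-1 * p.1.1 * (q.1.2 * (C' - C))| <= e / 8.
  by apply: half => //; apply: m1 => //; rewrite distrC.
have T4 : `|2^-1 * p.1.2 * (q.1.1 * (C' - C))| <= e / 8.
  by apply: half => //; apply: m1 => //; rewrite distrC.
have T5 : `|q.2 * (h * C')| <= e / 2.
  apply: m1 => //; rewrite normrM (gtr0_norm h0).
  apply: (@le_trans _ _ (dm * (M3 + 1))).
    apply: ler_pM; [exact: ltW|exact: normr_ge0|exact: hdm|].
    by apply: le_trans Dz _; rewrite lerDl.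
  by rewrite /dm invfM mulrA -mulrA mulVf ?mulr1// gt_eqF// ltr_wpDl.
exact: sum5.
Qed.

(** The image of the unit square under a matrix, thickened by [w], lies in a
    strip whose area is comparable to the determinant. The strip is a shear of a
    rectangle: its first side covers the first coordinate, and its slope is the
    ratio of the rows along the larger of the two entries [a], [b]. *)
Lemma strip_cover (a b c d M w : R) : 0 < w -> w <= 1 -> 0 <= M ->
  `|a| <= M -> `|b| <= M -> `|c| <= M -> `|d| <= M ->
  exists k P Q, [/\ 0 <= P, 0 <= Q,
    4 * (P * Q) <= 12 * `|a * d - c * b| + 24 * w * (M + 1) &
    forall s t e1 e2, `|s| <= 1 -> `|t| <= 1 -> `|e1| <= w -> `|e2| <= w ->
      `|s * a + t * b + e1| <= P /\
      `|s * c + t * d + e2 - k * (s * a + t * b + e1)| <= Q].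
Proof.
move=> w0 w1 M0 ha hb hc hd.
have m1 (s t m : R) : `|s| <= 1 -> `|t| <= m -> `|s * t| <= m.
  by move=> hs ht; rewrite normrM -[leRHS]mul1r; apply: ler_pM.
have main (a' b' c' d' : R) : `|b'| <= `|a'| -> w < `|a'| -> `|a'| <= M -> `|c'| <= M ->
  exists k P Q, [/\ 0 <= P, 0 <= Q,
    4 * (P * Q) <= 12 * `|a' * d' - c' * b'| + 24 * w * (M + 1) &
    forall s t e1 e2, `|s| <= 1 -> `|t| <= 1 -> `|e1| <= w -> `|e2| <= w ->
      `|s * a' + t * b' + e1| <= P /\
      `|s * c' + t * d' + e2 - k * (s * a' + t * b' + e1)| <= Q].
  move=> ba wa aM cM; set A := `|a'| in ba wa aM *; set L := `|a' * d' - c' * b'|.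
  have A0 : 0 < A by exact: lt_trans wa.
  have a0 : a' != 0 by rewrite -normr_gt0.
  exists (c' / a'), (3 * A), (L / A + w + w * (`|c'| / A)).
  have L0 : 0 <= L by exact: normr_ge0.
  have LA0 : 0 <= L / A by apply: divr_ge0 => //; exact: ltW.
  have cA0 : 0 <= `|c'| / A by apply: divr_ge0; [exact: normr_ge0|exact: ltW].
  split.
  - by rewrite mulr_ge0// ltW.
  - apply: addr_ge0; [apply: addr_ge0; [exact: LA0|exact: ltW]|].
    by apply: mulr_ge0; [exact: ltW|exact: cA0].
  - have -> : 4 * (3 * A * (L / A + w + w * (`|c'| / A))) =
        12 * L + 12 * w * (A + `|c'|) by field; rewrite gt_eqF.
    have : w * (A + `|c'|) <= w * (2 * M) by rewrite ler_pM2l//; lra.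
    by lra.
  move=> s t e1 e2 hs ht h1 h2; split.
    have := m1 _ _ _ hs (lexx A); have := m1 _ _ _ ht ba.
    have := ler_normD (s * a' + t * b') e1; have := ler_normD (s * a') (t * b').
    by lra.
  have -> : s * c' + t * d' + e2 - c' / a' * (s * a' + t * b' + e1) =
    t * ((a' * d' - c' * b') / a') + e2 - c' / a' * e1 by field.
  have T1 : `|t * ((a' * d' - c' * b') / a')| <= L / A.
    by apply: m1 => //; rewrite normrM normfV.
  have T2 : `|c' / a' * e1| <= w * (`|c'| / A).
    by rewrite normrM normrM normfV mulrC; exact: ler_wpM2r.
  have := ler_normB (t * ((a' * d' - c' * b') / a') + e2) (c' / a' * e1).
  by have := ler_normD (t * ((a' * d' - c' * b') / a')) e2; lra.
have [wa|aw] := ltP w `|a|; last have [wb|bw] := ltP w `|b|.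
- have [ba|/ltW ab] := leP `|b| `|a|; first exact: main.
  have [k [P [Q [P0 Q0 area inc]]]] := main b a d c ab (lt_le_trans wa ab) hb hd.
  exists k, P, Q; split => //; first by rewrite distrC [c * b]mulrC [a * d]mulrC.
  move=> s t e1 e2 hs ht h1 h2; have := inc t s e1 e2 ht hs h1 h2.
  by rewrite ![t * _ + s * _]addrC.
- have ab : `|a| <= `|b| by exact: le_trans aw (ltW wb).
  have [k [P [Q [P0 Q0 area inc]]]] := main b a d c ab wb hb hd.
  exists k, P, Q; split => //; first by rewrite distrC [c * b]mulrC [a * d]mulrC.
  move=> s t e1 e2 hs ht h1 h2; have := inc t s e1 e2 ht hs h1 h2.
  by rewrite ![t * _ + s * _]addrC.
(* Both entries are at most [w]: the strip is vertical and thin. *)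
exists 0, (3 * w), (2 * M + 1); split; [lra|lra| |].
  have : 0 <= `|a * d - c * b| by [].
  have : 0 <= w * M by rewrite mulr_ge0// ltW.
  by lra.
move=> s t e1 e2 hs ht h1 h2; rewrite mul0r subr0; split.
  have := m1 _ _ _ hs aw; have := m1 _ _ _ ht bw.
  have := ler_normD (s * a + t * b) e1; have := ler_normD (s * a) (t * b).
  by lra.
have := m1 _ _ _ hs hc; have := m1 _ _ _ ht hd.
have := ler_normD (s * c + t * d) e2; have := ler_normD (s * c) (t * d).
by lra.
Qed.

End linear_approximation.

(** * Measure of strips, and lower semicontinuity *)

Import HBNNSimple.

Section measure_facts.
Context {R : realType}.

(** The integral is a supremum over the simple functions below: monotonicity is an
    inclusion of sets of such functions, and so applies to the Hausdorff measure of
    the fibers as it stands. *)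
Lemma le_integral_any d (T : measurableType d) (mu : {measure set T -> \bar R})
    (f g : T -> \bar R) : (forall x, (0 <= f x)%E) -> (forall x, (f x <= g x)%E) ->
  (\int[mu]_x f x <= \int[mu]_x g x)%E.
Proof.
move=> f0 fg; have g0 x : (0 <= g x)%E by exact: le_trans (f0 x) (fg x).
rewrite !ge0_integralE//; apply: ereal_sup_le => _ [h hf <-].
exists h => // x.
apply: le_trans (hf x) _; rewrite /restrict /=; by case: ifP.
Qed.

Lemma limn_einf_ge (u : (\bar R)^nat) (c : \bar R) N :
  (forall n, (N <= n)%N -> (c <= u n)%E) -> (c <= limn_einf u)%E.
Proof.
move=> h; rewrite limn_einf_lim.
have nd : nondecreasing_seq (einfs u) by exact: nondecreasing_einfs.
have /cvg_lim -> // := ereal_nondecreasing_cvgn nd.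
apply: (@le_trans _ _ (einfs u N)); last by apply: ereal_sup_ubound; exists N.
by apply: le_ereal_inf_tmp => _ [n /= Nn <-]; exact: h.
Qed.

Lemma limn_einf_le (u : (\bar R)^nat) (c : \bar R) :
  (forall n, (u n <= c)%E) -> (limn_einf u <= c)%E.
Proof.
move=> h; rewrite limn_einf_lim.
have nd : nondecreasing_seq (einfs u) by exact: nondecreasing_einfs.
have /cvg_lim -> // := ereal_nondecreasing_cvgn nd.
apply: ge_ereal_sup => _ [n _ <-]; apply: le_trans (h n).
by apply: ereal_inf_lbound; exists n => /=.
Qed.

(** A rectangle sheared vertically, with slope [k]. *)
Definition strip (u0 w0 k P Q : R) : set (R * R) :=
  [set v | `|v.1 - u0| <= P /\ `|v.2 - w0 - k * (v.1 - u0)| <= Q].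

Lemma measurable_strip (u0 w0 k P Q : R) : measurable (strip u0 w0 k P Q).
Proof.
have m1 : measurable_fun setT (fun v : R * R => v.1 - u0).
  by apply: measurable_funB => //; exact: measurable_fst.
have m2 : measurable_fun setT (fun v : R * R => v.2 - w0 - k * (v.1 - u0)).
  apply: measurable_funB; last by apply: measurable_funM.
  by apply: measurable_funB => //; exact: measurable_snd.
have -> : strip u0 w0 k P Q = (fun v : R * R => v.1 - u0) @^-1` `[- P, P] `&`
    (fun v : R * R => v.2 - w0 - k * (v.1 - u0)) @^-1` `[- Q, Q].
  by apply/seteqP; split => v /=; rewrite !in_itv /= -!ler_norml.
by apply: measurableI; rewrite -[X in measurable X]setTI; [exact: m1|exact: m2].
Qed.

Lemma strip_measure (u0 w0 k P Q : R) : 0 <= P -> 0 <= Q ->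
  (((@lebesgue_measure R) \x (@lebesgue_measure R)) (strip u0 w0 k P Q) =
   (4 * (P * Q))%:E)%E.
Proof.
move=> P0 Q0.
transitivity (\int[@lebesgue_measure R]_x
    ((fun=> (2 * Q)%:E) \_ `[(u0 - P)%R, (u0 + P)%R]) x)%E.
  apply: eq_integral.
  move=> x _; rewrite /= /restrict.
  case: ifPn => [|] xi.
    have xs : xsection (strip u0 w0 k P Q) x =
        `[w0 + k * (x - u0) - Q, w0 + k * (x - u0) + Q]%classic.
      apply/seteqP; split => y; rewrite /xsection /= inE /strip /=.
        by move=> [_]; rewrite in_itv/= ler_norml => /andP[? ?]; apply/andP; split; lra.
      rewrite in_itv/= => /andP[? ?]; split.
        by move: xi; rewrite inE /= in_itv /= => /andP[? ?]; rewrite ler_norml; apply/andP; split; lra.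
      by rewrite ler_norml; apply/andP; split; lra.
    rewrite xs lebesgue_measure_itv /= lte_fin.
    case: ifPn => [_|]; first by rewrite -EFinB; congr (_%:E); ring.
    rewrite -leNgt => q; have -> : Q = 0 by lra.
    by rewrite mulr0.
  rewrite (_ : xsection _ _ = set0) ?measure0//.
  apply/seteqP; split => // y; rewrite /xsection /= inE /strip /= => -[+ _].
  rewrite ler_norml => /andP[? ?]; move/negP: xi; apply.
  by rewrite inE /= in_itv /=; apply/andP; split; lra.
have mI : (@lebesgue_measure R) `[u0 - P, u0 + P]%classic = (2 * P)%:E.
  rewrite lebesgue_measure_itv /= lte_fin.
  case: ifPn => [_|].
    rewrite -EFinB; congr (_%:E).
    ring.
  rewrite -leNgt lerD2l => PN.
  have PN' : P <= 0 by rewrite -(oppr_ge0 P); exact: le_trans PN.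
  have P00 : P = 0 by apply: le_anti; rewrite P0 PN'.
  by rewrite P00 mulr0.
rewrite -integral_mkcond integral_cst; last exact: measurable_itv.
transitivity ((2 * Q)%:E * (2 * P)%:E)%E; first by congr (_ * _)%E.
by rewrite -EFinM; congr (_%:E); ring.
Qed.

End measure_facts.

(** * Koranyi distances and Hausdorff content *)

Section koranyi_facts.
Context {R : realType}.
Implicit Types p q : heis R.

Lemma koranyi_le p (c : R) : 0 <= c -> N4 p <= c ^+ 4 -> koranyi p <= c.
Proof.
move=> c0 pc.
have p0 : 0 <= N4 p.
  by rewrite /N4; apply: addr_ge0; [exact: sqr_ge0|rewrite mulr_ge0// sqr_ge0].
have -> : c = (c ^+ 4) `^ 4^-1.
  by rewrite -powR_mulrn// -powRrM divff ?powRr1.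
by apply: ge0_ler_powR => //; rewrite nnegrE// exprn_ge0.
Qed.

Lemma utile_bounds p : utile p ->
  [/\ -1 <= p.1.1, p.1.1 <= 1, -1 <= p.1.2, p.1.2 <= 1 & -1 <= p.2 /\ p.2 <= 1].
Proof.
move=> /and3P[/andP[a1 a2] /andP[b1 b2] /andP[c1 c2]].
by split => //; try exact: ltW; split => //; exact: ltW.
Qed.

(** A tile has diameter at most [4 h]: after a left translation and a dilation this
    is [N4 (q^-1 p) <= 8^2 + 16 * 3^2 <= 4^4] in the unit tile. *)
Lemma hdist_tile (h : R) l p q : 0 <= h -> utile p -> utile q ->
  hdist (hmul l (dil h p)) (hmul l (dil h q)) <= 4 * h.
Proof.
move=> h0 /utile_bounds[p1 p1' p2 p2' [p3 p3']] /utile_bounds[q1 q1' q2 q2' [q3 q3']].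
apply: koranyi_le; first by rewrite mulr_ge0.
set x := p.1.1 - q.1.1; set y := p.1.2 - q.1.2.
set z := p.2 - q.2 + 2^-1 * (p.1.1 * q.1.2 - q.1.1 * p.1.2).
have -> : N4 (hmul (hinv (hmul l (dil h q))) (hmul l (dil h p))) =
    h ^+ 4 * ((x ^+ 2 + y ^+ 2) ^+ 2 + 16 * z ^+ 2).
  rewrite /N4 /hmul /hinv /dil /x /y /z /=; by field.
have hx : x ^+ 2 <= 4 by rewrite /x; nra.
have hy : y ^+ 2 <= 4 by rewrite /y; nra.
have hz1 : `|p.1.1 * q.1.2 - q.1.1 * p.1.2| <= 2.
  apply: le_trans (ler_normB _ _) _; rewrite !normrM.
  have n1 : `|p.1.1| <= 1 by rewrite ler_norml p1 p1'.
  have n2 : `|p.1.2| <= 1 by rewrite ler_norml p2 p2'.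
  have n3 : `|q.1.1| <= 1 by rewrite ler_norml q1 q1'.
  have n4 : `|q.1.2| <= 1 by rewrite ler_norml q2 q2'.
  by rewrite -[2]/(1 + 1) lerD// mulr_ile1.
have hz : z ^+ 2 <= 9.
  rewrite -(@real_normK _ z) ?num_real//.
  have : `|z| <= 3 by move: hz1; rewrite /z !ler_norml => /andP[? ?]; apply/andP; split; lra.
  by have := normr_ge0 z; nra.
rewrite (_ : (4 * h) ^+ 4 = h ^+ 4 * 256); last by ring.
rewrite ler_wpM2l ?exprn_ge0//.
have hxy : (x ^+ 2 + y ^+ 2) ^+ 2 <= 64.
  by have := sqr_ge0 x; have := sqr_ge0 y; nra.
lra.
Qed.

(** The dominant term of the gauge near the origin is [16 z^2], hence the square in
    the hypothesis. *)
Lemma hdist_near (d : R) p q : 0 <= d -> d <= 1 ->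
  bounded_by 2 p -> bounded_by 2 q -> near_pt (d ^+ 2 / 16) p q ->
  hdist p q <= d.
Proof.
move=> d0 d1 [p1 p2 p3] [q1 q2 q3] [n1 n2 n3].
apply: koranyi_le => //; set e := d ^+ 2 / 16 in n1 n2 n3 *.
have e0 : 0 <= e by rewrite divr_ge0// sqr_ge0.
have e1 : e <= 1 by rewrite /e; nra.
have -> : d ^+ 4 = 256 * e ^+ 2 by rewrite /e; field.
rewrite /N4 /hmul /hinv /=.
set x := - q.1.1 + p.1.1; set y := - q.1.2 + p.1.2; set z := _ + 2^-1 * _.
have hx : `|x| <= e by rewrite /x addrC.
have hy : `|y| <= e by rewrite /y addrC.
have hz : `|z| <= 3 * e.
  have -> : z = (p.2 - q.2) + 2^-1 * (x * p.1.2 - p.1.1 * y).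
    by rewrite /z /x /y; ring.
  apply: le_trans (ler_normD _ _) _; rewrite (_ : 3 * e = e + 2 * e); last by ring.
  apply: lerD => //; rewrite normrM ger0_norm ?invr_ge0//.
  have : `|x * p.1.2 - p.1.1 * y| <= e * 2 + 2 * e.
    apply: le_trans (ler_normB _ _) _; rewrite !normrM.
    by apply: lerD; apply: ler_pM.
  by lra.
have sq c u : 0 <= c -> `|u| <= c -> u ^+ 2 <= c ^+ 2 :> R.
  move=> c0 uc; rewrite -(@real_normK _ u) ?num_real//.
  by rewrite lerXn2r ?nnegrE.
have := sq _ _ e0 hx; have := sq _ _ e0 hy.
have := sq _ _ (mulr_ge0 (ler0n R 3) e0) hz.
rewrite exprMn => hz2 hy2 hx2.
have hxy : (x ^+ 2 + y ^+ 2) ^+ 2 <= (2 * e ^+ 2) ^+ 2.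
  rewrite lerXn2r ?nnegrE //.
  - by apply: addr_ge0; exact: sqr_ge0.
  - by apply: mulr_ge0 => //; exact: sqr_ge0.
  - by rewrite mulrDl mul1r lerD.
have he : e ^+ 2 <= 1 by rewrite expr_le1.
have he2 : (2 * e ^+ 2) ^+ 2 <= 4 * e ^+ 2.
  have ee : e ^+ 2 * e ^+ 2 <= e ^+ 2 by rewrite ler_piMr ?sqr_ge0.
  by rewrite (_ : (2 * e ^+ 2) ^+ 2 = 4 * (e ^+ 2 * e ^+ 2)) ?ler_wpM2l//; ring.
have := sqr_ge0 e; lra.
Qed.

End koranyi_facts.

Section hausdorff_facts.
Context {R : realType} (T : Type) (d : T -> T -> R).

Lemma ediam_le (A : set T) (r : R) : 0 <= r ->
  (forall x y, A x -> A y -> d x y <= r) -> (ediam d A <= r%:E)%E.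
Proof.
move=> r0 h; rewrite /ediam ge_max lee_fin r0 /=.
by apply: ge_ereal_sup => _ [x Ax [y Ay <-]]; rewrite lee_fin; exact: h.
Qed.

Lemma ediam_ge0 (A : set T) : (0 <= ediam d A)%E.
Proof. by rewrite /ediam le_max lexx. Qed.

Lemma ediam_set0 : ediam d set0 = 0%E.
Proof.
apply: le_anti; rewrite ediam_ge0 andbT.
by apply: ediam_le.
Qed.

(** A finite cover, completed by empty sets, is admissible in the definition of the
    content. *)
Lemma content_finite (I : eqType) (s : seq I) (U : I -> set T) (A : set T)
    (r delta : R) : 0 <= r -> r <= delta ->
  (forall i, i \in s -> forall x y, U i x -> U i y -> d x y <= r) ->
  (forall x, A x -> exists2 i, i \in s & U i x) ->
  (hausdorff_content d 2 delta A <= ((size s)%:R * r ^+ 2)%:E)%E.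
Proof.
move=> r0 rd hU hA.
pose V n := if onth s n is Some i then U i else set0.
have Vr n : (ediam d (V n) <= r%:E)%E.
  rewrite /V; case E : (onth s n) => [i|]; last by rewrite ediam_set0 lee_fin.
  by apply: ediam_le => //; apply: hU; apply/onthP; exists n.
apply: (@le_trans _ _ (\sum_(0 <= i <oo) (ediam d (V i) `^ 2))%E).
  apply: ereal_inf_lbound; exists V => //; split; last first.
    by move=> i; apply: le_trans (Vr i) _; rewrite lee_fin.
  move=> x /hA[i si Ux]; exists (index i s) => //.
  by rewrite /V onthE (nth_map i) ?index_mem// nth_index.
apply: lime_le; first by apply: is_cvg_nneseries => n _ _; exact: poweR_ge0.
apply: nearW => n.
apply: (@le_trans _ _ ((minn n (size s))%:R * r ^+ 2)%:E); last first.
  by rewrite lee_fin ler_wpM2r ?sqr_ge0// ler_nat geq_minr.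
elim: n => [|n ih].
  by rewrite big_geq// lee_fin mulr_ge0 ?sqr_ge0.
rewrite big_nat_recr//=; case: (ltnP n (size s)) => ns.
  have -> : minn n.+1 (size s) = (minn n (size s)).+1.
    by rewrite (minn_idPl ns) (minn_idPl (ltnW ns)).
  set m := minn n _ in ih *.
  have -> : m.+1%:R * r ^+ 2 = m%:R * r ^+ 2 + r ^+ 2 by rewrite -natr1; ring.
  rewrite EFinD; apply: leeD => //.
  have -> : (r ^+ 2)%:E = (r%:E `^ 2)%E by rewrite poweR_EFin powR_mulrn.
  apply: gt0_ler_poweR; rewrite ?in_itv /=; [by []| | |exact: Vr].
  - by rewrite leey andbT; exact: ediam_ge0.
  - by rewrite leey andbT lee_fin.
have -> : minn n.+1 (size s) = minn n (size s).
  by rewrite (minn_idPr ns) (minn_idPr (leqW ns)).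
rewrite /V onthE nth_default ?size_map// ediam_set0 poweR0r ?adde0//.
Qed.

End hausdorff_facts.

(** * Small fibers of a contact map *)

Section fibers.
Context {R : realType}.
Implicit Types p q : heis R.
Local Notation leb2 := ((@lebesgue_measure R) \x (@lebesgue_measure R))%E.

(** On the tiles of the cover [C] outside [P] only the uniform bound [M] is
    available, but these tiles are few. *)
Lemma sum_cover_le (I : eqType) (P C : seq I) (f : I -> R) (M : R) :
  uniq P -> uniq C -> {subset P <= C} -> (forall i, f i <= M) ->
  \sum_(i <- C) f i <= \sum_(i <- P) f i + M * ((size C)%:R - (size P)%:R).
Proof.
move=> uP uC PC fM.
have e : perm_eq [seq i <- C | i \in P] P.
  apply: uniq_perm => //; first exact: filter_uniq.
  move=> i; rewrite mem_filter; case: (boolP (i \in P)) => //= /PC ->//.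
rewrite (bigID (mem P)) /= -big_filter (perm_big _ e) lerD2l.
apply: (@le_trans _ _ (\sum_(i <- C | i \notin P) M)); first exact: ler_sum.
rewrite big_const_seq iter_addr_0 -[_ *+ _]mulr_natr.
have -> : (size C)%:R = (size P)%:R + (count (predC (mem P)) C)%:R :> R.
  by rewrite -natrD -(count_predC (mem P) C) -(perm_size e) size_filter.
by rewrite addrC addKr.
Qed.

(** On a small tile the projection of the map is affine up to [w * h], and the
    determinant of its linear part is the horizontal jacobian. *)
Lemma tile_image_strip (b : heis R -> heis R) : smooth setT b ->
  exists2 M : R, 0 <= M & forall w, 0 < w -> w <= 1 -> exists2 d, 0 < d &
    forall h p, 0 < h -> h <= d -> bounded_by 2 p -> exists S : set (R * R),
    [/\ measurable S,
      (leb2 S <= (h ^+ 2 * (12 * `|hjac b p| + 24 * w * (M + 1)))%:E)%E &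
      forall q, utile q -> S (hproj (b (hmul p (dil h q))))].
Proof.
move=> sb; have db p := smooth_diff p sb.
have db1 p := diff_fst (db p).
have s1 : smooth setT (fun p => (b p).1.1).
  by move=> k; apply: Ck_fst; [exact: openT|apply: Ck_fst; [exact: openT|exact: sb]].
have s2 : smooth setT (fun p => (b p).1.2).
  by move=> k; apply: Ck_snd; [exact: openT|apply: Ck_fst; [exact: openT|exact: sb]].
have d1 w p : 'D_w (fun p => (b p).1.1) p = ('D_w b p).1.1.
  by rewrite (derive_fst _ (db1 p)) (derive_fst _ (db p)).
have d2 w p : 'D_w (fun p => (b p).1.2) p = ('D_w b p).1.2.
  by rewrite (derive_snd _ (db1 p)) (derive_fst _ (db p)).
have [M1 [hM1 a1]] := tile_approx s1; have [M2 [hM2 a2]] := tile_approx s2.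
exists (`|M1| + `|M2|); first by rewrite addr_ge0.
set M := `|M1| + `|M2|.
have le1 x : x <= M1 -> x <= M.
  by move=> xM; apply: le_trans xM _; apply: le_trans (ler_norm _) _; rewrite /M lerDl.
have le2 x : x <= M2 -> x <= M.
  by move=> xM; apply: le_trans xM _; apply: le_trans (ler_norm _) _; rewrite /M lerDr.
move=> w w0 w1; have [e1 e10 h1] := a1 w w0; have [e2 e20 h2] := a2 w w0.
exists (Num.min e1 e2); first by rewrite lt_min e10.
move=> h p h0; rewrite le_min => /andP[he1 he2] bp.
have [hx1 hy1] := hM1 _ bp; have [hx2 hy2] := hM2 _ bp.
have M0 : 0 <= M by rewrite addr_ge0.
have [k [P [Q [P0 Q0 PQ hS]]]] :=
  strip_cover w0 w1 M0 (le1 _ hx1) (le1 _ hy1) (le2 _ hx2) (le2 _ hy2).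
exists (strip (b p).1.1 (b p).1.2 k (h * P) (h * Q)); split.
- exact: measurable_strip.
- rewrite strip_measure ?mulr_ge0 ?(ltW h0)// lee_fin.
  rewrite (_ : 4 * _ = h ^+ 2 * (4 * (P * Q))); last by ring.
  rewrite ler_wpM2l ?sqr_ge0//; apply: le_trans PQ _.
  by rewrite lerD2r ler_wpM2l// !d1 !d2 /hjac mulrC [X in _ - X]mulrC [X in X - _]mulrC.
- move=> q uq; have [q1 q1' q2 q2' _] := utile_bounds uq.
  have nq1 : `|q.1.1| <= 1 by rewrite ler_norml q1 q1'.
  have nq2 : `|q.1.2| <= 1 by rewrite ler_norml q2 q2'.
  have := h1 _ _ _ h0 he1 bp uq; have := h2 _ _ _ h0 he2 bp uq.
  set A := 'D_(hX p) _ p in hS *; set B := 'D_(hY p) _ p in hS *.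
  set A' := 'D_(hX p) (fun _ => _.1.2) p in hS *; set B' := 'D_(hY p) (fun _ => _.1.2) p in hS *.
  set f := b (hmul _ _) => E2 E1.
  set r1 := f.1.1 - (b p).1.1 - _ in E1; set r2 := f.1.2 - (b p).1.2 - _ in E2.
  have F1 : `|r1 / h| <= w by rewrite normrM normfV (gtr0_norm h0) ler_pdivrMr.
  have F2 : `|r2 / h| <= w by rewrite normrM normfV (gtr0_norm h0) ler_pdivrMr.
  have [G1 G2] := hS _ _ _ _ nq1 nq2 F1 F2.
  have hn : h != 0 by rewrite gt_eqF.
  rewrite /strip /hproj /=; split.
    rewrite (_ : f.1.1 - _ = h * (q.1.1 * A + q.1.2 * B + r1 / h)); last by rewrite /r1; field.
    by rewrite normrM (gtr0_norm h0) ler_wpM2l// ltW.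
  rewrite (_ : f.1.2 - _ - _ =
    h * (q.1.1 * A' + q.1.2 * B' + r2 / h - k * (q.1.1 * A + q.1.2 * B + r1 / h)));
    last by rewrite /r1 /r2; field.
  by rewrite normrM (gtr0_norm h0) ler_wpM2l// ltW.
Qed.

End fibers.

(** * Counting the tiles that meet a fiber *)

Section small.
Context {R : realType}.
Implicit Types p q : heis R.
Local Notation leb2 := ((@lebesgue_measure R) \x (@lebesgue_measure R))%E.

Definition tile_count (I : Type) (c : R) (s : seq I) (S : I -> set (R * R)) v : \bar R :=
  (\sum_(i <- s) (c%:E * (\1_(S i) v)%:E))%E.

Section tile_count.
Variables (I : eqType) (c : R) (s : seq I) (S : I -> set (R * R)).
Hypotheses (c0 : 0 <= c) (mS : forall i, measurable (S i)).

Lemma tile_countE v : tile_count c s S v = ((size [seq i <- s | v \in S i])%:R * c)%:E.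
Proof.
rewrite /tile_count; elim: s => [|i t ih]; first by rewrite big_nil mul0r.
rewrite big_cons ih indicE /=; case: (v \in S i) => /=.
  by rewrite mule1 -natr1 -EFinD; congr (_%:E); ring.
by rewrite mule0 add0e.
Qed.

Let mterm i : measurable_fun setT (fun v => c%:E * (\1_(S i) v)%:E)%E.
Proof.
by apply: measurable_funeM; apply/measurable_EFinP; exact: measurable_indic.
Qed.

Lemma measurable_tile_count : measurable_fun setT (tile_count c s S).
Proof. by apply: emeasurable_sum => i; exact: mterm. Qed.

Lemma tile_count_ge0 v : (0 <= tile_count c s S v)%E.
Proof. by rewrite tile_countE lee_fin mulr_ge0. Qed.

Lemma integral_tile_count (m : I -> R) :
  (forall i, i \in s -> (leb2 (S i) <= (m i)%:E)%E) ->
  (\int[leb2]_v tile_count c s S v <= (c * \sum_(i <- s) m i)%:E)%E.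
Proof.
move=> hm; rewrite /tile_count ge0_integral_sum//; last first.
  by move=> i v _; rewrite mule_ge0 ?lee_fin.
rewrite mulr_sumr -sumEFin big_seq [leRHS]big_seq; apply: lee_sum => i si.
have e : (\int[leb2]_x (\1_(S i) x)%:E = leb2 (S i))%E.
  rewrite integral_indic; [by rewrite setIT|exact: measurableT|exact: mS].
rewrite ge0_integralZl//; last by apply/measurable_EFinP; exact: (measurable_indic (mS i)).
by rewrite e EFinM; apply: lee_wpmul2l; [rewrite lee_fin|exact: hm].
Qed.

End tile_count.

End small.

(** * Contact maps with small fibers *)

Section small_fibers.
Context {R : realType}.
Implicit Types p q : heis R.
Local Notation leb2 := ((@lebesgue_measure R) \x (@lebesgue_measure R))%E.

(** The condition on [N4] keeps the tiles in a fixed bounded set. *)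
Definition cover (H : R) k (X : seq (int * int * int)) :=
  [seq v <- refine k X | N4 (lat (scale H k) v) <= 3].

(** The tile containing a point of the ball is close to the ball, hence contained in
    the refinement of a coarse tile close to the ball. *)
Lemma refine_cover (H : R) k X p v : 0 < H -> 2 ^+ 16 * H <= 1 -> (0 < k)%N ->
  (forall u, N4 (lat H u) <= 1 + 2 ^+ 16 * H -> u \in X) ->
  N4 p <= 1 -> utile (loc (scale H k) v p) -> v \in cover H k X.
Proof.
move=> H0 H1 k0 hX p1 pv; set h := scale H k in pv.
have hH : h <= H.
  by rewrite /h /scale ler_pdivrMr ?ltr0n ?expn_gt0// ler_peMr ?(ltW H0)// ler1n expn_gt0.
have h0 : 0 < h by rewrite /h /scale divr_gt0// ltr0n expn_gt0.
have t16 : (2 : R) ^+ 16 = 4 * 2 ^+ 14 by rewrite -[16%N]/(2 + 14)%N exprD; congr (_ * _); ring.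
have t14 : 1 <= (2 : R) ^+ 14 by rewrite exprn_ege1// ler1n.
move: t16 t14 H1 hX; set T := (2 : R) ^+ 14; move=> -> T1 H1 hX.
have Tn : 0 <= T by lra.
have TH : T * h <= T * H by rewrite ler_wpM2l.
have HT : H <= T * H by rewrite ler_peMl// ltW.
have [_ n1] : near_pt (4 * h) p (lat h v) /\ `|N4 p - N4 (lat h v)| <= T * h.
  by apply: N4_tile => //; [lra|left; lra].
have q1 : N4 (lat h v) <= 1 + T * h.
  by move: n1; rewrite ler_norml => /andP[? ?]; lra.
have Hn : H != 0 by rewrite gt_eqF.
have [u hu] := loc_ex (lat h v) Hn.
have [_ n2] : near_pt (4 * H) (lat h v) (lat H u) /\ `|N4 (lat h v) - N4 (lat H u)| <= T * H.
  by apply: N4_tile => //; [lra|left; lra].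
rewrite mem_filter; apply/andP; split; first by rewrite -/h; lra.
apply: (refine_mem Hn k0 _ hu); apply: hX.
by move: n2; rewrite ler_norml => /andP[? ?]; lra.
Qed.

Lemma kappa_small (c : R) : 0 < c -> exists n, kappa ^+ n <= c.
Proof.
move=> c0; have t : (1 : R) <= 2 ^+ 26 by rewrite exprn_ege1// ler1n.
have t0 : 0 < (2 ^+ 26 : R)^-1 by rewrite invr_gt0 exprn_gt0.
have t1 : (2 ^+ 26 : R)^-1 <= 1 by rewrite invf_le1// exprn_gt0.
have k0 : 0 <= kappa :> R by rewrite /kappa subr_ge0.
have k1 : `|kappa : R| < 1 by rewrite ger0_norm// /kappa gtrBl.
have /cvgrPdist_lt/(_ c c0)[n _ hn] := cvg_expr k1.
exists n; have := hn n (leqnn n); rewrite sub0r normrN ger0_norm ?exprn_ge0//.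
exact: ltW.
Qed.

Lemma hmul_dil_one (c : R) p : hmul p (dil c (hone R)) = p.
Proof.
by case: p => [[x y] z]; rewrite /hmul /dil /hone /= !mulr0 mul0r !addr0 subr0 mulr0 addr0.
Qed.

Lemma utile_one : utile (hone R).
Proof.
by rewrite /utile /hone /=; apply/and3P; split; apply/andP; split; lra.
Qed.

Lemma pos_fraction (N x : R) : 0 < N -> 0 < x -> exists2 y, 0 < y & x = N * y.
Proof.
move=> N0 x0; exists (x / N); first exact: divr_gt0.
by rewrite mulrC divfK// gt_eqF.
Qed.

(** The value [g v] is [(4 h)^2] times the number of tiles whose strip contains [v],
    for a tile size [h <= d / 4]. The constants are chosen in this order: the number [n] of steps, the
    initial lattice, so fine that the tiles near the sphere are negligible even
    when the jacobian is [2^(64 n)], then the map, then the accuracy [w] of the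
    linear approximation, and last [h]. *)
Theorem small_fibers (eps : R) : 0 < eps -> exists b : heis R -> heis R,
  [/\ ball_contacto b, forall p, near_pt eps p (b p) &
  forall d : R, 0 < d -> exists g : R * R -> \bar R, [/\ measurable_fun setT g,
    forall v, (0 <= g v)%E,
    forall v delta, d <= delta ->
      (hausdorff_content (@hdist R) 2 delta
         [set p | (N4 p <= 1)%R /\ hproj (b p) = v] <= g v)%E &
    (\int[leb2]_v g v <= eps%:E)%E]].
Proof.
move=> eps0.
(* The final bound is [192 * (512 * del) + 384 * (512 * del)]: with [S] the sum of the
   jacobians over the cover [C], the total is
   [16 h^2 * (h^2 * (12 S + 24 w (M + 1) |C|))]. *)
have [eps' eps'0 eps'E] := pos_fraction (addr_gt0 (ltr0Sn R 191) (ltr0Sn R 383)) eps0.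
have [del del0 delE] := pos_fraction (ltr0Sn R 511) eps'0.
have [n hn] : exists n, kappa ^+ n <= del by exact: kappa_small.
have L0 : 0 < ((2 : R) ^+ 64) ^+ n by rewrite !exprn_gt0.
set Lam := ((2 : R) ^+ 64) ^+ n in L0.
have e10 : 0 < Num.min 1 (del / Lam) by rewrite lt_min ltr01 divr_gt0.
have [k0 [k00 H1 [P0 [X0 [[uP0 uX0] P0in hX0 hcnt hvol]]]]] := sphere_tiles e10.
set H := scale (4 : R) k0 in H1 P0in hX0 hcnt hvol.
have H0 : 0 < H by rewrite /H /scale divr_gt0// ltr0n expn_gt0.
have H1' : H <= 1.
  by apply: le_trans H1; rewrite ler_peMl ?(ltW H0)// exprn_ege1// ler1n.
have e20 : 0 < Num.min eps del by rewrite lt_min eps0.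
have [b [ab hj hb [K [c [c0 hP]]]]] := iteration H0 H1' uP0 P0in n e20.
have [[sb _] _ _] := ab.
exists b; split => // [p|d d0].
  have [n1 n2 n3] := hb p; have m : Num.min eps del <= eps by rewrite ge_min lexx.
  by split; apply: le_trans m.
have [M M0 hM] := tile_image_strip sb.
have M1 : 0 < M + 1 by rewrite ltr_wpDl.
have w0 : 0 < Num.min 1 (del / (M + 1)) by rewrite lt_min ltr01 divr_gt0.
have w1 : Num.min 1 (del / (M + 1)) <= 1 by rewrite ge_min lexx.
have [d1 d10 hS] := hM _ w0 w1; set w := Num.min 1 _ in w0 w1 hS.
have m0 : 0 < Num.min d1 (d / 4) by rewrite lt_min d10 divr_gt0.
have [K' hK'] := scale_small H0 m0.
pose k := maxn (maxn K 1) K'.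
have kK : (K <= k)%N by rewrite /k !leq_max leqnn.
have k1 : (0 < k)%N by rewrite /k !leq_max leqnn orbT.
have := hK' k (leq_maxr _ _); rewrite le_min => /andP[hd1 hd].
have [P [uP sP inP sumP]] := hP k kK.
set h := scale H k in hd1 hd inP.
have h0 : 0 < h by rewrite /h /scale divr_gt0// ltr0n expn_gt0.
have hn0 : h != 0 by rewrite gt_eqF.
have /choice[S hSS] : forall u, exists S : set (R * R), measurable S /\
    (bounded_by 2 (lat h u) ->
      (leb2 S <= (h ^+ 2 * (12 * `|hjac b (lat h u)| + 24 * w * (M + 1)))%:E)%E /\
      forall q, utile q -> S (hproj (b (hmul (lat h u) (dil h q))))).
  move=> u; have [bu|nb] := pselect (bounded_by 2 (lat h u)).
    by have [S [? ? ?]] := hS _ _ h0 hd1 bu; exists S.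
  by exists set0; split => //.
have mS u : measurable (S u) by have [] := hSS u.
pose C := cover H k X0.
have Cb u : u \in C -> bounded_by 2 (lat h u).
  by rewrite mem_filter => /andP[? _]; exact: N4_bounded.
have h40 : 0 <= (4 * h) ^+ 2 by exact: sqr_ge0.
exists (tile_count ((4 * h) ^+ 2) C S); split.
- exact: measurable_tile_count.
- by move=> v; exact: tile_count_ge0.
- move=> v delta ddelta; rewrite tile_countE.
  apply: (@content_finite _ _ _ _ _ (fun u => [set p | utile (loc h u p)])).
  + by rewrite mulr_ge0// ltW.
  + by apply: le_trans ddelta; rewrite mulrC -ler_pdivlMr.
  + move=> u _ x y ux uy; rewrite -(lat_loc u x hn0) -(lat_loc u y hn0).
    by apply: hdist_tile => //; exact: ltW.
  + move=> x /= [x1 <-]; have [u hu] := loc_ex x hn0; exists u => //.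
    have uC : u \in C by exact: (refine_cover H0 H1 k1 hX0 x1 hu).
    rewrite mem_filter uC andbT inE.
    have [_ /(_ (Cb u uC))[_ /(_ _ hu)]] := hSS u.
    by rewrite lat_loc.
apply: le_trans (integral_tile_count h40 mS
  (m := fun u => h ^+ 2 * (12 * `|hjac b (lat h u)| + 24 * w * (M + 1))) _) _.
  by move=> u uC; have [_ /(_ (Cb u uC))[]] := hSS u.
have h44 : h ^+ 4 * (16 ^ k)%:R = H ^+ 4.
  by have := scale4 H 0 k; rewrite add0n [scale H 0]/scale expn0 divr1.
have PC : {subset P <= C}.
  move=> u uP'; apply: (refine_cover (p := lat h u) H0 H1 k1 hX0).
    by apply: le_trans (inP _ uP') _; rewrite gerBl ltW.
  rewrite -/h; have := loc_lat u (hone R) hn0.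
  rewrite hmul_dil_one.
  by move=> ->; exact: utile_one.
have uC : uniq C by apply: filter_uniq; exact: (@uniq_refine R k X0 k1 uX0).
have := sum_cover_le uP uC PC (fun u => hj (lat h u)); rewrite -/Lam.
move: sumP; rewrite /tile_sum -/h.
set sC := \sum_(u <- C) `|_|; set sP' := \sum_(u <- P) `|_| => sumP hC.
have sizeC : ((size C)%:R : R) <= (size X0)%:R * (16 ^ k)%:R.
  by rewrite -natrM ler_nat -size_refine size_filter count_size.
have sizeP : ((size P)%:R : R) = (size P0)%:R * (16 ^ k)%:R by rewrite sP natrM.
have -> : \sum_(u <- C) h ^+ 2 * (12 * `|hjac b (lat h u)| + 24 * w * (M + 1)) =
    h ^+ 2 * (12 * sC + (size C)%:R * (24 * w * (M + 1))).
  rewrite -mulr_sumr big_split /= -mulr_sumr big_const_seq iter_addr_0 count_predT.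
  by rewrite -[_ *+ size C]mulr_natl.
have h4 : 0 <= h ^+ 4 by rewrite exprn_ge0// ltW.
have V1 : h ^+ 4 * (size C)%:R <= 257.
  apply: (@le_trans _ _ ((size X0)%:R * H ^+ 4)).
    by rewrite -h44 mulrCA ler_wpM2l.
  have m1 : Num.min 1 (del / Lam) <= 1 by rewrite ge_min lexx.
  move: hcnt hvol m1; rewrite mulrBl; set x1 := _ * _; set x2 := _ * H ^+ 4.
  by set x3 := Num.min _ _; clear => ? ? ?; lra.
have V2 : h ^+ 4 * (Lam * ((size C)%:R - (size P)%:R)) <= del.
  apply: (@le_trans _ _ (Lam * (((size X0)%:R - (size P0)%:R) * H ^+ 4))).
    rewrite mulrCA ler_wpM2l ?(ltW L0)// -h44 sizeP.
    by rewrite [leRHS]mulrCA ler_wpM2l// mulrBl lerB.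
  rewrite mulrC -ler_pdivlMr//; apply: le_trans hcnt _.
  by rewrite ge_min lexx orbT.
have V3 : kappa ^+ n * ((size P0)%:R * H ^+ 4) <= del * 256.
  apply: (@le_trans _ _ (del * ((size P0)%:R * H ^+ 4))).
    by rewrite ler_wpM2r// mulr_ge0// exprn_ge0// ltW.
  by rewrite ler_wpM2l// ltW.
have V4 : Num.min eps del <= del by rewrite ge_min lexx orbT.
have V5 : h ^+ 4 * sC <= 512 * del.
  have : h ^+ 4 * sC <= h ^+ 4 * sP' + h ^+ 4 * (Lam * ((size C)%:R - (size P)%:R)).
    by rewrite -mulrDr ler_wpM2l.
  move: V2 V3 V4 sumP del0.
  set x1 := _ ^+ 4 * (Lam * _); set x2 := kappa ^+ n * _; set x3 := h ^+ 4 * sP'; set x4 := h ^+ 4 * sC.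
  set x5 := Num.min _ _; clear => ? ? ? ? ? ?; lra.
have V6 : w * (M + 1) <= del.
  by rewrite -ler_pdivlMr// /w ge_min lexx orbT.
have V7 : w * (M + 1) * (h ^+ 4 * (size C)%:R) <= 512 * del.
  apply: (@le_trans _ _ (del * 257)); last by rewrite mulrC ler_wpM2r ?(ltW del0)// ler_nat.
  apply: ler_pM => //; first by rewrite mulr_ge0// ltW.
  by rewrite mulr_ge0.
rewrite lee_fin eps'E delE.
rewrite (_ : (4 * h) ^+ 2 * _ =
  192 * (h ^+ 4 * sC) + 384 * (w * (M + 1) * (h ^+ 4 * (size C)%:R))); last by ring.
rewrite [leRHS]mulrDl; apply: lerD; apply: ler_wpM2l; first exact: ler0n.
- exact: V5.
- exact: ler0n.
- exact: V7.
Qed.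

End small_fibers.

(** * The unit ball *)

Section unit_ball.
Context {R : realType}.
Implicit Types p q w : heis R.
Local Notation ball1 := (hclosed_ball (hone R) 1).

Lemma N4_ge0 p : 0 <= N4 p.
Proof. by rewrite /N4 addr_ge0 ?sqr_ge0// mulr_ge0// sqr_ge0. Qed.

Lemma koranyi_exp4 p : koranyi p ^+ 4 = N4 p.
Proof.
by rewrite /koranyi -powR_mulrn ?powR_ge0// -powRrM mulVf// powRr1//; exact: N4_ge0.
Qed.

Lemma unit_ballE : ball1 = [set p | N4 p <= 1].
Proof.
have e p : hmul (hinv (hone R)) p = p.
  by case: p => [[x y] z]; rewrite /hmul /hinv /hone /= !oppr0 mulr0 mul0r subr0 mulr0 !add0r addr0.
apply/seteqP; split => p; rewrite /hclosed_ball /hdist /= e.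
  by move=> h; rewrite -koranyi_exp4 exprn_ile1// powR_ge0.
by move=> h; apply: koranyi_le => //; rewrite expr1n.
Qed.

Lemma continuous_N4 : continuous (@N4 R).
Proof.
have C0 : Ck 0 setT (@N4 R); last by move=> p; exact: C0.
have [Cx Cy Cz] := Ck_coord 0 (@openT (heis R)).
have Cs : Ck 0 setT (fun p : heis R => p.1.1 * p.1.1 + p.1.2 * p.1.2).
  by apply: Ck_add; [exact: openT|..]; apply: Ck_mul => //; exact: openT.
apply: (Ck_eq (f := fun p => (p.1.1 * p.1.1 + p.1.2 * p.1.2) * (p.1.1 * p.1.1 + p.1.2 * p.1.2)
  + 16 * (p.2 * p.2))) => //; first exact: openT.
apply: Ck_add; [exact: openT|by apply: Ck_mul => //; exact: openT|].
apply: Ck_mul; [exact: openT|exact: Ck_cst|].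
by apply: Ck_mul => //; exact: openT.
Qed.

Lemma open_N4_lt c : open [set p : heis R | N4 p < c].
Proof.
apply: (@open_comp _ _ (@N4 R) [set x | x < c]); last exact: open_lt.
by move=> p _; exact: continuous_N4.
Qed.

Lemma open_N4_gt c : open [set p : heis R | c < N4 p].
Proof.
apply: (@open_comp _ _ (@N4 R) [set x | c < x]); last exact: open_gt.
by move=> p _; exact: continuous_N4.
Qed.

Lemma closed_N4_le c : closed [set p : heis R | N4 p <= c].
Proof.
apply: (@preimage_closed _ _ (@N4 R) [set x | x <= c]); last exact: closed_le.
by move=> p _; exact: continuous_N4.
Qed.

Lemma interior_ball p : N4 p < 1 -> interior ball1 p.
Proof.
have := @open_N4_lt 1; rewrite unit_ballE => o p1.
have sub : [set p : heis R | N4 p < 1] `<=` [set p : heis R | N4 p <= 1].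
  by move=> q /= /ltW.
by move: sub; rewrite open_subsetE//; apply.
Qed.

Lemma frontier_ball p : frontier ball1 p -> 1 <= N4 p.
Proof. by move=> [_ np]; rewrite leNgt; apply/negP => /interior_ball. Qed.

(** The gauge is a sum of convex functions. Segments from a point of the sphere to
    points of the ball thus stay in the ball. *)
Lemma N4_convex p q (s : R) : 0 <= s -> s <= 1 ->
  N4 (p + s *: (q - p)) <= (1 - s) * N4 p + s * N4 q.
Proof.
move=> s0 s1; case: p => [[x y] z]; case: q => [[x' y'] z'].
rewrite /N4 /=.
have sq (a b : R) : (a + s * (b - a)) ^+ 2 <= (1 - s) * a ^+ 2 + s * b ^+ 2.
  have e : (1 - s) * a ^+ 2 + s * b ^+ 2 - (a + s * (b - a)) ^+ 2 =
    s * (1 - s) * (a - b) ^+ 2 by ring.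
  by rewrite -subr_ge0 e mulr_ge0 ?sqr_ge0// mulr_ge0// subr_ge0.
set a := x ^+ 2 + y ^+ 2; set b := x' ^+ 2 + y' ^+ 2.
have hz := sq z z'.
have hab : (x + s * (x' - x)) ^+ 2 + (y + s * (y' - y)) ^+ 2 <= a + s * (b - a).
  by have := sq x x'; have := sq y y'; rewrite /a /b; lra.
have := sq a b.
have : ((x + s * (x' - x)) ^+ 2 + (y + s * (y' - y)) ^+ 2) ^+ 2 <= (a + s * (b - a)) ^+ 2.
  have A := sqr_ge0 (x + s * (x' - x)); have B := sqr_ge0 (y + s * (y' - y)).
  by rewrite lerXn2r ?nnegrE//; [exact: addr_ge0|apply: le_trans hab; exact: addr_ge0].
move: hz; rewrite -![s *: _]/(s * _); lra.
Qed.

(** By convexity the segment from [p] to [q] stays in the ball, so the difference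
    quotients of [g] along it are constant for small positive steps. *)
Lemma derive_inward (g : heis R -> heis R) p q (U : set (heis R)) : open U -> U p ->
  N4 p <= 1 -> N4 q <= 1 -> differentiable g p ->
  (forall u, U u -> N4 u <= 1 -> g u = u) -> 'D_(q - p) g p = q - p.
Proof.
move=> oU Up p1 q1 dg hg; set v := q - p.
have gp : g p = p by exact: hg.
have dv : derivable g p v by exact: diff_derivable.
rewrite /derive cvg_at_rightE//.
apply: cvg_lim => //; apply: cvg_near_cst.
have nU : \forall h \near (0 : R), U (h *: v + p).
  have c : (fun h : R => h *: v + p) h @[h --> (0 : R)] --> p.
    rewrite -[X in _ --> X]add0r -(scale0r v).
    by apply: cvgD; [apply: cvgZr_tmp; exact: cvg_id|exact: cvg_cst].
  by apply: c; exact: open_nbhs_nbhs.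
have nU' : \forall h \near (0 : R)^'+, U (h *: v + p) by apply: cvg_within; exact: nU.
near=> h.
have h0 : 0 < h by near: h; exact: nbhs_right_gt.
have h1 : h <= 1 by near: h; apply: nbhs_right_le.
have Uh : U (h *: v + p) by near: h.
rewrite /= [g (_ + _)]hg//.
  by rewrite gp addrK scalerA mulVf ?scale1r// gt_eqF.
apply: (@le_trans _ _ ((1 - h) * N4 p + h * N4 q)).
  by rewrite addrC; apply: N4_convex => //; exact: ltW.
have a : (1 - h) * N4 p <= (1 - h) * 1 by rewrite ler_wpM2l// subr_ge0.
have b : h * N4 q <= h * 1 by rewrite ler_wpM2l// ltW.
lra.
Unshelve. all: by end_near.
Qed.

(** The directions [q - p] with [q] in the ball span the tangent space, so the
    differential of an extension of the identity is the identity even at a point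
    of the sphere, where extensions are not unique. *)
Lemma diff_inward (g : heis R -> heis R) p w (U : set (heis R)) : open U -> U p ->
  N4 p <= 1 -> differentiable g p ->
  (forall u, U u -> N4 u <= 1 -> g u = u) -> 'd g p w = w.
Proof.
move=> oU Up p1 dg hg.
(* Small enough for [c *: w] to lie in the ball. *)
pose c := (1 + N4 w)^-1; have w1 : 0 < 1 + N4 w by rewrite ltr_pwDl// N4_ge0.
have c0 : 0 < c by rewrite invr_gt0.
have c1 : c <= 1 by rewrite invf_le1// lerDl N4_ge0.
have Nw : N4 (c *: w) <= 1.
  apply: (@le_trans _ _ (c * N4 w)); last first.
    by rewrite /c mulrC ler_pdivrMr// mul1r lerDr.
  have -> : N4 (c *: w) = c * (c ^+ 3 * (w.1.1 ^+ 2 + w.1.2 ^+ 2) ^+ 2 + 16 * (c * w.2 ^+ 2)).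
    by rewrite /N4 /= -![c *: _]/(c * _); ring.
  rewrite ler_wpM2l ?(ltW c0)// /N4; apply: lerD.
    by rewrite ler_piMl ?sqr_ge0// exprn_ile1// ltW.
  by rewrite ler_wpM2l// ler_piMl ?sqr_ge0.
have N0 : N4 (0 : heis R) <= 1.
  by rewrite -[0 : heis R]/(((0, 0), 0) : heis R) /N4 /=; lra.
have e1 := derive_inward oU Up p1 Nw dg hg.
have e0 := derive_inward oU Up p1 N0 dg hg.
rewrite deriveE// in e1; rewrite deriveE// in e0.
have cw : 'd g p (c *: w) = c *: w.
  have e : c *: w = (c *: w - p) - (0 - p) by rewrite sub0r opprK subrK.
  by rewrite e linearB e1 e0.
have : c *: 'd g p w = c *: w by rewrite -linearZ.
by apply: scalerI; rewrite gt_eqF.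
Qed.

End unit_ball.

(** * Contactomorphisms supported in the open unit ball *)

Section conclusion.
Context {R : realType}.
Implicit Types p q w : heis R.
Local Notation ball1 := (hclosed_ball (hone R) 1).
Local Notation leb2 := ((@lebesgue_measure R) \x (@lebesgue_measure R))%E.

(** An injective map that fixes every point outside the ball cannot move a point
    out of it. *)
Lemma ball_contacto_stable (b : heis R -> heis R) p : ball_contacto b -> N4 p <= 1 -> N4 (b p) <= 1.
Proof.
move=> [_ [b' [_ bK _]] [c c0 hc]] p1; rewrite leNgt; apply/negP => bp1.
have /(can_inj bK) e : b (b p) = b p by apply: hc; move: c0; lra.
by move: bp1; rewrite e ltNge p1.
Qed.

Lemma ball_contacto_inv_stable (b b' : heis R -> heis R) p : ball_contacto b -> cancel b' b ->
  N4 p <= 1 -> N4 (b' p) <= 1.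
Proof.
move=> [_ _ [c c0 hc]] b'K p1; rewrite leNgt; apply/negP => bp1.
have e : b (b' p) = b' p by apply: hc; move: c0; lra.
by move: bp1; rewrite -e b'K ltNge p1.
Qed.

Lemma smooth_smooth_on (f : heis R -> heis R) A : smooth setT f -> smooth_on A f.
Proof. by move=> sf p Ap; exists setT, f; split => //; exact: openT. Qed.

Lemma ball_contacto_diffeomorphism (b : heis R -> heis R) : ball_contacto b -> diffeomorphism ball1 ball1 b.
Proof.
move=> ab; have [[sb _] [b' [[sb' _] bK b'K]] _] := ab.
rewrite unit_ballE; split.
- split.
  + by move=> p /=; exact: ball_contacto_stable.
  + by move=> p q _ _; exact: (can_inj bK).
  + move=> q /= q1; exists (b' q); last exact: b'K.
    exact: (ball_contacto_inv_stable ab b'K).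
- exact: smooth_smooth_on.
- by exists b'; [move=> p _; exact: bK|exact: smooth_smooth_on].
Qed.

(** In the open ball every extension agrees with [b] near the point; near the sphere
    [b] is the identity on the ball, and so is the differential of any extension. *)
Lemma ball_contacto_contact_on (b : heis R -> heis R) : ball_contacto b -> contact_on ball1 b.
Proof.
move=> ab; have [[sb hb] _ [c c0 hc]] := ab.
rewrite unit_ballE => p /= p1 U g [oU Up sg bg] w hw.
have dg : differentiable g p by exact: (sg 1%N).1.
have db := smooth_diff p sb.
have [lt1|ge1] := ltP (N4 p) 1.
  have bgp : \near p, b p = g p.
    have nU : nbhs p U by exact: open_nbhs_nbhs.
    have nB : nbhs p [set u | N4 u < 1] by apply: open_nbhs_nbhs; split => //; exact: open_N4_lt.
    apply: filterS2 nU nB => u Uu u1; apply: bg => //=; exact: ltW.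
  rewrite -deriveE// -(near_eq_derive w bgp).
  exact: hb.
have idp : b p = p by apply: hc; lra.
rewrite idp.
have oU' : open (U `&` [set u | 1 - c < N4 u]) by apply: openI => //; exact: open_N4_gt.
rewrite (diff_inward w oU' _ p1 dg)//; first by split => //=; lra.
by move=> u [Uu /= uc] u1; rewrite -bg//; exact: hc.
Qed.

Lemma content_ge0 (delta : R) (A : set (heis R)) :
  (0 <= hausdorff_content (@hdist R) 2 delta A)%E.
Proof.
apply: le_ereal_inf_tmp => _ [U _ <-]; apply: nneseries_ge0 => n _ _.
exact: poweR_ge0.
Qed.

Lemma hausdorff_ge0 (A : set (heis R)) : (0 <= hausdorff_measure (@hdist R) 2 A)%E.
Proof.
apply: le_trans (content_ge0 1 A) _.
by apply: ereal_sup_ubound; exists 1 => /=; [exact: ltr01|].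
Qed.

Lemma inv_small (d : R) : 0 < d -> exists N, forall n, (N <= n)%N -> n.+1%:R^-1 <= d.
Proof.
move=> d0; exists (Num.truncn d^-1) => n Nn.
have di : 0 <= d^-1 by rewrite invr_ge0 ltW.
have /andP[_ /ltW h] := truncn_itv di.
rewrite -[leRHS]invrK lef_pV2 ?posrE ?invr_gt0//.
by apply: le_trans h _; rewrite ler_nat.
Qed.

End conclusion.

Theorem theorem1p6 (R : realType) (eps : R) (eps_gt0 : 0 < eps) :
  let B := hclosed_ball (hone R) 1 in
  exists beta : heis R -> heis R,
    [/\ contact_diffeomorphism B B beta,
        (forall p, frontier B p -> beta p = p) /\
          closure [set p | B p /\ beta p <> p] `<=` interior B,
        forall p, B p -> hdist p (beta p) < eps &
        (\int[(@lebesgue_measure R) \x (@lebesgue_measure R)]_v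
            hausdorff_measure (@hdist R) 2
              [set p | B p /\ hproj (beta p) = v]
          < eps%:E)%E].
Proof.
move=> B.
pose d := Num.min (eps / 2) 1.
have d0 : 0 < d by rewrite lt_min ltr01 andbT divr_gt0.
have d1 : d <= 1 by rewrite ge_min lexx orbT.
have deps : d < eps.
  by apply: (@le_lt_trans _ _ (eps / 2)); [rewrite ge_min lexx|rewrite ltr_pdivrMr// ltr_pMr// ltr1n].
have m0 : 0 < Num.min (eps / 2) (d ^+ 2 / 16).
  by rewrite lt_min; apply/andP; split; apply: divr_gt0 => //; exact: exprn_gt0.
have [b [ab hb hg]] := small_fibers m0.
have [_ _ [c c0 hc]] := ab.
exists b; split.
- by split; [exact: ball_contacto_diffeomorphism|exact: ball_contacto_contact_on].
- split.
    by move=> p /frontier_ball p1; apply: hc; move: c0; lra.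
  move=> p clp; apply: interior_ball.
  have : [set p | N4 p <= 1 - c] p.
    rewrite (_ : [set p | _] = closure [set p | N4 p <= 1 - c]); last first.
      by apply/closure_id; exact: closed_N4_le.
    apply: closureS clp => q [_ bq] /=; rewrite leNgt; apply/negP => /hc; exact: bq.
  by move=> /= p1; move: c0; lra.
- rewrite /B unit_ballE => p /= p1; apply: le_lt_trans deps.
  have bd q : N4 q <= 1 -> bounded_by 2 q.
    by move=> q1; apply: N4_bounded; apply: le_trans q1 _; rewrite ler1n.
  apply: hdist_near => //; [exact: ltW|exact: bd|apply: bd; exact: ball_contacto_stable|].
  have [n1 n2 n3] := hb p.
  have m : Num.min (eps / 2) (d ^+ 2 / 16) <= d ^+ 2 / 16 by rewrite ge_min lexx orbT.
  by split; apply: le_trans m.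
pose F v := hausdorff_measure (@hdist R) 2 [set p | N4 p <= 1 /\ hproj (b p) = v].
rewrite (_ : (fun v => _) = F); last by rewrite /B unit_ballE.
have /choice[g hgn] n := hg n.+1%:R^-1 ltac:(by rewrite invr_gt0 ltr0n).
have Fg v : (F v <= limn_einf (g^~ v))%E.
  apply: ge_ereal_sup => _ [delta /= delta0 <-].
  have [N hN] := inv_small delta0.
  apply: (limn_einf_ge (N := N)) => n Nn.
  by have [_ _ h _] := hgn n; apply: h; exact: hN.
apply: (@le_lt_trans _ _ (eps / 2)%:E); last first.
  by rewrite lte_fin ltr_pdivrMr// ltr_pMr// ltr1n.
have Fle := le_integral_any ((@lebesgue_measure R) \x (@lebesgue_measure R))%E
  (fun v => hausdorff_ge0 _) Fg.
apply: le_trans Fle _.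
have := @fatou _ _ R ((@lebesgue_measure R) \x (@lebesgue_measure R))%E setT measurableT g.
move=> /(_ _ _)/le_trans; apply.
- by move=> n; have [] := hgn n.
- by move=> n v _; have [_ + _ _] := hgn n; apply.
apply: limn_einf_le => n; have [_ _ _ h] := hgn n.
by apply: le_trans h _; rewrite lee_fin ge_min lexx.
Qed.
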